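(* Let $P,Q\in \{C^1([0,1])\}^{2\times 2}$ be symmetric real matrix-valued functions such that all eigenvalues of the operators $\mathcal{A}_P$ and $\mathcal{A}_Q$ are simple. Let $a\in\{L^2(0,1)\}^2$ be a generating element with respect to both $\mathcal{A}_P$ and $\mathcal{A}_Q$. Let $u$ be the solution of $$\begin{cases}\partial_t u(x,t)-\partial_x^2u(x,t)+P(x)u(x,t)=0, & (x,t)\in(0,1)\times(0,\infty),\\ \partial_xu(0,t)=\partial_xu(1,t)=0, & t\in(0,\infty),\\ u(x,0)=a(x), & x\in(0,1),\end{cases}$$ and let $v$ be the solution of $$\begin{cases}\partial_t v(x,t)-\partial_x^2v(x,t)+Q(x)v(x,t)=0, & (x,t)\in(0,1)\times(0,\infty),\\ \partial_xv(0,t)=\partial_xv(1,t)=0, & t\in(0,\infty),\\ v(x,0)=a(x), & x\in(0,1).\end{cases}$$ Let $0<T<\infty$. If $$u(0,t)=v(0,t),\qquad u(1,t)=v(1,t)\qquad\text{for all } 0<t<T,$$ then $P(x)=Q(x)$ for all $x\in[0,1]$.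
   Context: All functions are real-valued; $u=(u_1,u_2)^{\rm T}$ and $v=(v_1,v_2)^{\rm T}$ take values in $\mathbb{R}^2$. The space $\{L^2(0,1)\}^2$ carries the inner product $(f,g)=\int_0^1\bigl(f_1(x)g_1(x)+f_2(x)g_2(x)\bigr)\,dx$. For a symmetric real matrix-valued function $P\in\{C^1([0,1])\}^{2\times2}$, $\mathcal{A}_P$ denotes the operator $-\frac{d^2}{dx^2}+P(x)$ in $\{L^2(0,1)\}^2$ with homogeneous Neumann boundary conditions at $x=0$ and $x=1$; $\mathcal{A}_Q$ is defined in the same way with $Q$ in place of $P$. When all eigenvalues of $\mathcal{A}_P$ are simple, they are written $\lambda_1<\lambda_2<\cdots$, with corresponding eigenfunctions $\psi_1,\psi_2,\dots$ (each determined up to a nonzero scalar factor). An element $a\in\{L^2(0,1)\}^2$ is called a generating element with respect to $\mathcal{A}_P$ if $(a,\psi_n)\neq0$ for every $n\in\mathbb{N}=\{1,2,\dots\}$; and similarly for $\mathcal{A}_Q$. The solution of the parabolic problem with initial value $a\in\{L^2(0,1)\}^2$ is the classical (semigroup) one, $u(\cdot,t)=e^{-t\mathcal{A}_P}a$ and $v(\cdot,t)=e^{-t\mathcal{A}_Q}a$ for $t>0$; it is continuous in $x$ up to the boundary for $t>0$, so the boundary values are well defined. *)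

(* Defs.v *)
From HB Require Import structures.
From mathcomp Require Import all_boot all_order all_algebra.
From mathcomp Require Import all_classical all_reals all_analysis.

Set Implicit Arguments.
Unset Strict Implicit.
Unset Printing Implicit Defensive.

Import Order.TTheory GRing.Theory Num.Theory.
Import numFieldNormedType.Exports.

Local Open Scope classical_set_scope.
Local Open Scope ring_scope.

(* Functions of the space variable are total on R, but only their values on
   [0, 1] (or almost everywhere on ]0, 1[ for elements of L^2) are used.
   R^2 is the type 'cV[R]_2, and f x i 0 is the i-th component of f x. *)

Section SpaceVariable.
Context (R : realType).
Implicit Types (f g h psi : R -> 'cV[R]_2) (P : R -> 'M[R]_2).

(* l is the derivative at x of the restriction of f to [0, 1]: two-sided for
   0 < x < 1, one-sided at x = 0 and x = 1. *)
Definition has_deriv01 (f : R -> R) (x l : R) : Prop :=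
  (f y - f x) / (y - x) @[y --> within `[0, 1] x^'] --> l.

Definition C1_01 (f : R -> R) : Prop :=
  exists2 df : R -> R,
    forall x : R, x \in `[0, 1] -> has_deriv01 f x (df x) &
    {within `[0, 1], continuous df}.

Definition C1mx P : Prop := forall i j, C1_01 (fun x => P x i j).

Definition symmetric_on01 P : Prop :=
  forall x : R, x \in `[0, 1] -> (P x)^T = P x.

(* Membership in L^2(0, 1); f \_ A is f on A and 0 elsewhere. *)
Definition L2_01 (f : R -> R) : Prop :=
  f \_ `]0, 1[ \in Lfun (@lebesgue_measure R) 2%:E.

Definition L2v f : Prop := forall i, L2_01 (fun x => f x i 0).

Definition inner f g : R :=
  \int[lebesgue_measure]_(x in `]0, 1[) (f x 0 0 * g x 0 0 + f x 1 0 * g x 1 0).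

(* The graph of A_P = - d^2/dx^2 + P in L^2(0, 1)^2, with domain the
   f in H^2(0, 1)^2 such that f'(0) = f'(1) = 0.  An element of H^2 is
   represented by its C^1 version on [0, 1]; its derivative df is the primitive
   of a square integrable function, the weak second derivative ddf. *)
Definition operA P f h : Prop :=
  exists df ddf : R -> 'cV[R]_2,
    [/\ L2v ddf,
        forall (x : R) i, x \in `[0, 1] ->
          has_deriv01 (fun y => f y i 0) x (df x i 0) /\
          df x i 0 =
            df 0 i 0 + \int[lebesgue_measure]_(y in `[0, x]) ddf y i 0,
        df 0 = 0 /\ df 1 = 0 &
        {ae lebesgue_measure, forall x : R, x \in `]0, 1[ ->
          h x = - ddf x + P x *m f x}].

(* Elements of the domain are continuous, so that being nonzero, or
   proportional, in L^2 is the same as on [0, 1]. *)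
Definition eigenfunction P (lam : R) psi : Prop :=
  operA P psi (fun x => lam *: psi x) /\
  (exists2 x, x \in `[0, 1] & psi x != 0).

Definition simple_eigenvalue P (lam : R) : Prop :=
  exists2 psi, eigenfunction P lam psi &
    forall f, operA P f (fun x => lam *: f x) ->
      exists c : R, forall x : R, x \in `[0, 1] -> f x = c *: psi x.

Definition eigenvalueA P (lam : R) : Prop :=
  exists psi, eigenfunction P lam psi.

Definition all_eigenvalues_simple P : Prop :=
  forall lam, eigenvalueA P lam -> simple_eigenvalue P lam.

(* When the eigenvalues are simple, the eigenfunctions are exactly the nonzero
   multiples of the psi_n, so no enumeration of the spectrum is needed. *)
Definition generating P (a : R -> 'cV[R]_2) : Prop :=
  L2v a /\
  forall lam psi, eigenfunction P lam psi -> inner a psi != 0.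

End SpaceVariable.

Definition continuous_strip (R : realType) (w : R -> R -> 'cV[R]_2) : Prop :=
  forall i, {within [set p : R * R | p.1 \in `[0, 1] /\ 0 < p.2],
    continuous (fun p : R * R => w p.1 p.2 i 0)}.

(* u is the solution of u_t - u_xx + P u = 0, u_x(0, .) = u_x(1, .) = 0,
   u(., 0) = a.  For a only in L^2, the initial value is the L^2 limit as
   t -> 0+.  The regularity on [0, 1] x ]0, +oo[ is that of e^{- t A_P} a for a
   continuous P, and with it the solution is unique on [0, 1] by the energy
   estimate. *)
Definition parabolic_solution (R : realType) (P : R -> 'M[R]_2)
    (a : R -> 'cV[R]_2) (u : R -> R -> 'cV[R]_2) : Prop :=
  exists ut ux uxx : R -> R -> 'cV[R]_2,
    [/\ [/\ continuous_strip u, continuous_strip ut, continuous_strip ux &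
            continuous_strip uxx],
        forall (x t : R) i, x \in `[0, 1] -> 0 < t ->
          [/\ is_derive t 1 (fun s => u x s i 0) (ut x t i 0),
              has_deriv01 (fun y => u y t i 0) x (ux x t i 0) &
              has_deriv01 (fun y => ux y t i 0) x (uxx x t i 0)],
        forall x t : R, x \in `]0, 1[ -> 0 < t ->
          ut x t - uxx x t + P x *m u x t = 0,
        forall t : R, 0 < t -> ux 0 t = 0 /\ ux 1 t = 0 &
        (\int[lebesgue_measure]_(x in `]0%R, 1%R[)
            (\sum_(i < 2) (u x t i 0 - a x i 0) ^+ 2)%:E)%E
          @[t --> 0^'+] --> 0%E].

(* Main.v *)
(* Integrating a heat solution y in time against the derivatives of a Landau kernel produces
   functions c_k with c_k'' = P c_k + c_(k+1), and sum_k t^(2k)/(2k)! c_k is almost a solution of the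
   wave equation U_xx - U_tt = P U with U(., 0) close to y(., 0).  Two heat solutions y, z, with
   potentials P, Q, and the same Cauchy data at x = 0 thus give two waves with the same Cauchy data
   there, and energy estimates with time and space exchanged yield
     |z(x0, 0) - y(x0, 0)|^2 <= C int_0^x0 |y(., 0)|^2
   with C depending only on bounds of P and Q.  By reflection the same holds with int_x0^1.  Both
   bounds apply to finite combinations of time translates of u and v.

   Such combinations of u are L^2-dense.  Indeed (u(s), u(r)) depends only on s + r and is completely
   monotone, which gives enough analyticity to extend (k, u(s)) = 0 from an interval to all s > 0; the
   space of these k is invariant under the compact Green operator of A_P + const, hence is 0 or
   contains an eigenfunction, which a generating a excludes.

   Cutting u(., t) off at x0 and approximating the left part by such a combination, the two bounds
   force v = u on ]0, 1[ x ]0, T[.  Then (P - Q) u = 0, so the rows of P - Q are orthogonal to u(s) for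
   s < T, and they vanish by density. *)

(* The traces and the Neumann condition give [u] and [v] the same lateral Cauchy data, but the heat
   equation is ill-posed sideways: these data control nothing in L^2. The wave equation is
   well-posed in both directions, hence the passage to waves. It needs no analyticity in time: the
   kernel is a polynomial whose degree grows with the number K of terms, its derivatives cost about
   K^K, and the factorial (2K)! in the wave series beats this. So an arbitrarily short time window
   suffices, for solutions merely bounded on it. The comparison bound is asymmetric: its right side
   contains only one of the two solutions, because the difference of the two waves has source (Q -
   P) U plus a term absorbed by a large exponential weight in x. A combination that is small on one
   side of a point therefore has a small deviation at that point, whatever it does on the other
   side; this is why control is needed from both ends. No spectral expansion is used, only one
   eigenvector in an invariant subspace, and all compactness arguments are limits along a free
   ultrafilter. Data are extended by clamping to continuous functions on the whole line, so that
   integrals can be manipulated freely. *)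
Require Import Defs.
From mathcomp Require Import all_boot all_order all_algebra.
From mathcomp Require Import ring lra zify.
From mathcomp Require Import all_classical all_reals all_analysis measurable_realfun.
Set Implicit Arguments.
Unset Strict Implicit.
Unset Printing Implicit Defensive.
Import Order.TTheory GRing.Theory Num.Theory.
Import numFieldNormedType.Exports.
Local Open Scope classical_set_scope.
Local Open Scope ring_scope.

(** * Calculus on segments *)

Section Calculus.
Context (R : realType).
Notation mu := (@lebesgue_measure R).
Implicit Types (f g F : R -> R) (a b c x y : R).

(** Not oriented: the value is 0 as soon as [b <= a], see [Int_eq0]. Additivity in [Int_cat]
    therefore asks for ordered bounds. *)
Definition Int a b f : R := \int[mu]_(x in `[a, b]) f x.

Lemma continuous_integrable a b f : continuous f ->
  mu.-integrable `[a, b] (EFin \o f).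
Proof.
move=> cf; apply: continuous_compact_integrable; first exact: segment_compact.
exact: continuous_subspaceT.
Qed.

Lemma IntD a b f g : continuous f -> continuous g ->
  Int a b (fun x => f x + g x) = Int a b f + Int a b g.
Proof. by move=> cf cg; rewrite /Int RintegralD//; exact: continuous_integrable. Qed.

Lemma IntB a b f g : continuous f -> continuous g ->
  Int a b (fun x => f x - g x) = Int a b f - Int a b g.
Proof. by move=> cf cg; rewrite /Int RintegralB//; exact: continuous_integrable. Qed.

Lemma IntZ a b c f : continuous f -> Int a b (fun x => c * f x) = c * Int a b f.
Proof. by move=> cf; rewrite /Int RintegralZl//; exact: continuous_integrable. Qed.

Lemma eq_Int a b f g : (forall x, a <= x -> x <= b -> f x = g x) ->
  Int a b f = Int a b g.
Proof.
by move=> fg; apply: eq_Rintegral => x; rewrite inE/= in_itv/= => /andP[? ?]; exact: fg.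
Qed.

Lemma le_Int a b f g : continuous f -> continuous g ->
  (forall x, a <= x -> x <= b -> f x <= g x) -> Int a b f <= Int a b g.
Proof.
move=> cf cg fg; apply: le_Rintegral => //; try exact: continuous_integrable.
by move=> x /=; rewrite in_itv/= => /andP[? ?]; exact: fg.
Qed.

Lemma Int_ge0 a b f : (forall x, a <= x -> x <= b -> 0 <= f x) -> 0 <= Int a b f.
Proof. by move=> f0; apply: Rintegral_ge0 => x /=; rewrite in_itv/= => /andP[]; exact: f0. Qed.

Lemma ler_norm_Int a b f : continuous f -> `|Int a b f| <= Int a b (fun x => `|f x|).
Proof. by move=> cf; apply: le_normr_Rintegral => //; exact: continuous_integrable. Qed.

Lemma Int_cst a b c : a <= b -> Int a b (fun=> c) = c * (b - a).
Proof.
move=> ab; rewrite /Int Rintegral_cst//= lebesgue_measure_itv/= lte_fin.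
by case: ltgtP ab => //= ->; rewrite subrr.
Qed.

Lemma Int_cat a b c f : continuous f -> a <= b -> b <= c ->
  Int a c f = Int a b f + Int b c f.
Proof.
move=> cf ab bc; rewrite /Int.
have := @Rintegral_itvB R f (BLeft a) (BRight c) b (continuous_integrable _ _ cf).
rewrite !bnd_simp => /(_ ab bc).
rewrite Rintegral_itv_obnd_cbnd; last first.
  apply: integrableS (continuous_integrable a c cf) => //.
  by apply: subset_itvr; rewrite bnd_simp.
by move=> <-; rewrite addrCA subrr addr0.
Qed.

Lemma Int_eq0 a b f : b <= a -> Int a b f = 0.
Proof.
rewrite le_eqVlt => /predU1P[->|ba]; rewrite /Int.
  by rewrite set_itv1 Rintegral_set1.
by rewrite set_itv_ge ?Rintegral_set0// bnd_simp -ltNge.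
Qed.

(** The retraction of the line onto [a, b] when [a <= b]. Composing with it turns continuity on a
    segment into continuity everywhere, through [continuous_comp_within]. *)
Definition clamp a b x := Num.max a (Num.min b x).

Lemma clamp_ge a b x : a <= clamp a b x.
Proof. by rewrite /clamp le_max lexx. Qed.

Lemma clamp_le a b x : a <= b -> clamp a b x <= b.
Proof. by move=> ab; rewrite /clamp ge_max ab/= ge_min lexx. Qed.

Lemma clamp_id a b x : a <= x -> x <= b -> clamp a b x = x.
Proof. by move=> ax xb; rewrite /clamp (min_idPr xb) (max_idPr ax). Qed.

Lemma continuous_clamp a b : continuous (clamp a b).
Proof.
move=> x; rewrite /clamp.
apply: (@continuous_max R R (cst a) (fun x => Num.min b x)) => //.
  exact: cvg_cst.
by apply: (@continuous_min R R (cst b) id); [exact: cvg_cst|exact: cvg_id].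
Qed.

Lemma continuous_comp_within (S T U : topologicalType) (A : set T) (f : T -> U) (g : S -> T) :
  {within A, continuous f} -> continuous g -> (forall s, A (g s)) ->
  continuous (f \o g).
Proof.
move=> /subspace_continuousP cf cg Ag s.
move=> B /(cf _ (Ag s)) /= /(cg s) /= H.
have : nbhs s (fun t => A (g t) -> B (f (g t))) by exact: H.
move=> {}H; rewrite /= !nbhs_simpl/=.
by apply: (@filterS _ (nbhs s) _ _ _ _ H) => t /=; apply; exact: Ag.
Qed.

Lemma continuous_uncurry_comp (T : topologicalType) (f : R -> R -> R) (g h : T -> R) :
  continuous (fun p : R * R => f p.1 p.2) -> continuous g -> continuous h ->
  continuous (fun t => f (g t) (h t)).
Proof.
move=> cf cg ch t.
exact: (@continuous2_cvg T R R R (nbhs t) _ g h f (g t) (h t) (cf (g t, h t)) (cg t) (ch t)).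
Qed.

Lemma continuousDf (T : topologicalType) (f g : T -> R) : continuous f -> continuous g ->
  continuous (fun t => f t + g t).
Proof. by move=> cf cg t; apply: cvgD; [exact: cf|exact: cg]. Qed.

Lemma continuousBf (T : topologicalType) (f g : T -> R) : continuous f -> continuous g ->
  continuous (fun t => f t - g t).
Proof. by move=> cf cg t; apply: cvgB; [exact: cf|exact: cg]. Qed.

Lemma continuousNf (T : topologicalType) (f : T -> R) : continuous f ->
  continuous (fun t => - f t).
Proof. by move=> cf t; apply: cvgN; exact: cf. Qed.

Lemma continuousMf (T : topologicalType) (f g : T -> R) : continuous f -> continuous g ->
  continuous (fun t => f t * g t).
Proof. by move=> cf cg t; apply: cvgM; [exact: cf|exact: cg]. Qed.

Lemma continuousXf (T : topologicalType) (f : T -> R) n : continuous f ->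
  continuous (fun t => f t ^+ n).
Proof.
move=> cf; elim: n => [|n IH]; first by move=> t; exact: cvg_cst.
by rewrite (_ : (fun t => _) = fun t => f t * f t ^+ n); [exact: continuousMf|apply/funext => t; rewrite exprS].
Qed.

Lemma continuous_normf (T : topologicalType) (f : T -> R) : continuous f ->
  continuous (fun t => `|f t|).
Proof. by move=> cf t; apply: cvg_norm; exact: cf. Qed.

Lemma continuous_expRf (T : topologicalType) (f : T -> R) : continuous f ->
  continuous (fun t => expR (f t)).
Proof. by move=> cf t; apply: continuous_comp; [exact: cf|exact: continuous_expR]. Qed.

Lemma continuous_sumf (T : topologicalType) (I : Type) (s : seq I) (P : pred I) (f : I -> T -> R) :
  (forall i, P i -> continuous (f i)) -> continuous (fun t => \sum_(i <- s | P i) f i t).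
Proof.
move=> cf; elim: s => [|i s IH].
  rewrite (_ : (fun t => _) = cst 0); first by move=> t; exact: cvg_cst.
  by apply/funext => t; rewrite big_nil.
rewrite (_ : (fun t => _) = fun t => (if P i then f i t else 0) + \sum_(i <- s | P i) f i t).
  by apply: continuousDf => //; case: (boolP (P i)) => [/cf//|_ t]; exact: cvg_cst.
by apply/funext => t; rewrite big_cons; case: ifP => //; rewrite add0r.
Qed.

Lemma continuous_cstf (T : topologicalType) (c : R) : continuous (fun _ : T => c).
Proof. by move=> t; exact: cvg_cst. Qed.

Lemma continuous_compf (T U : topologicalType) (f : U -> R) (g : T -> U) :
  continuous f -> continuous g -> continuous (fun t => f (g t)).
Proof. by move=> cf cg t; apply: continuous_comp; [exact: cg|exact: cf]. Qed.

Lemma continuous_idf : continuous (fun x : R => x).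
Proof. by move=> t; exact: cvg_id. Qed.

Lemma continuous_fstf : continuous (fun p : R * R => p.1).
Proof. by move=> t; exact: cvg_fst. Qed.

Lemma continuous_sndf : continuous (fun p : R * R => p.2).
Proof. by move=> t; exact: cvg_snd. Qed.

End Calculus.

(** Joint continuity is always phrased as continuity of [fun p => f p.1 p.2]; the last clauses
    recognise this form to compose [f] with two continuous maps, slices included. *)
Ltac cts_step := match goal with
  | H : continuous ?f |- continuous ?f => exact H
  | H : continuous ?f |- continuous (fun x => ?f x) => exact H
  | H : continuous (fun x => ?f x) |- continuous ?f => exact H
  | H : forall i, continuous (?f i) |- continuous (?f ?i) => exact (H i)
  | H : forall i, continuous (?f i) |- continuous (fun x => ?f ?i x) => exact (H i)
  | H : forall i, continuous (fun x => ?f i x) |- continuous (?f ?i) => exact (H i)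
  | H : forall i, continuous (fun x => ?f i x) |- continuous (fun x => ?f ?i x) => exact (H i)
  | H : forall i, continuous (fun x => ?f x i) |- continuous (fun x => ?f x ?i) => exact (H i)
  | H : forall i j, continuous (fun x => ?f x i j) |- continuous (fun x => ?f x ?i ?j) => exact (H i j)
  | H : forall i j, continuous (?f i j) |- continuous (?f ?i ?j) => exact (H i j)
  | H : forall i j, continuous (?f i j) |- continuous (fun x => ?f ?i ?j x) => exact (H i j)
  | |- continuous (fun x => x) => exact: continuous_idf
  | |- continuous fst => exact: continuous_fstf
  | |- continuous snd => exact: continuous_sndf
  | |- continuous (fun p => fst p) => exact: continuous_fstf
  | |- continuous (fun p => snd p) => exact: continuous_sndf
  | |- continuous (fun _ => ?c) => exact: continuous_cstf
  | |- continuous (GRing.mul ?c) => notypeclasses refine (@continuousMf _ _ (fun=> c) (fun x => x) _ _)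
  | |- continuous (GRing.add ?c) => notypeclasses refine (@continuousDf _ _ (fun=> c) (fun x => x) _ _)
  | |- continuous GRing.opp => notypeclasses refine (@continuousNf _ _ (fun x => x) _)
  | |- continuous (fun t => _ + _) => notypeclasses refine (continuousDf _ _)
  | |- continuous (fun t => _ - _) => notypeclasses refine (continuousBf _ _)
  | |- continuous (fun t => - _) => notypeclasses refine (continuousNf _)
  | |- continuous (fun t => _ * _) => notypeclasses refine (continuousMf _ _)
  | |- continuous (fun t => _ ^+ _) => notypeclasses refine (continuousXf _)
  | |- continuous (fun t => `|_|) => notypeclasses refine (continuous_normf _)
  | |- continuous (fun t => expR _) => notypeclasses refine (continuous_expRf _)
  | |- continuous (fun t => @bigop _ _ _ _ _) => notypeclasses refine (@continuous_sumf _ _ _ _ _ _ _); move=> ? _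
  | H : continuous (fun p => ?f p.1 p.2) |- continuous (fun t => ?f (@?g t) (@?h t)) =>
    notypeclasses refine (@continuous_uncurry_comp _ _ f g h H _ _)
  | H : continuous (fun p => ?f p.1 p.2) |- continuous (?f ?a) =>
    notypeclasses refine (@continuous_uncurry_comp _ _ f (fun=> a) (fun x => x) H _ _)
  | H : forall i, continuous (fun p => ?f i p.1 p.2) |- continuous (fun t => ?f ?i (@?g t) (@?h t)) =>
    notypeclasses refine (@continuous_uncurry_comp _ _ (f i) g h (H i) _ _)
  | H : forall i, continuous (fun p => ?f i p.1 p.2) |- continuous (?f ?i ?a) =>
    notypeclasses refine (@continuous_uncurry_comp _ _ (f i) (fun=> a) (fun x => x) (H i) _ _)
  | H : continuous ?f |- continuous (fun t => ?f (@?g t)) =>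
    notypeclasses refine (@continuous_compf _ _ _ f g H _)
  | H : forall i, continuous (?f i) |- continuous (fun t => ?f ?i (@?g t)) =>
    notypeclasses refine (@continuous_compf _ _ _ (f i) g (H i) _)
  | H : forall i j, continuous (?f i j) |- continuous (fun t => ?f ?i ?j (@?g t)) =>
    notypeclasses refine (@continuous_compf _ _ _ (f i j) g (H i j) _)
  end.
Ltac cts := repeat (cbv beta; cts_step).

(* Not a notation: a goal [is_derive _ _ _ _] would be handed to type class resolution. *)
Definition Der (R : realType) (f : R -> R) (x l : R) : Prop := is_derive x 1 f l.

Section Derivatives.
Context (R : realType).
Implicit Types (f g F : R -> R) (a b c x y l m : R).

Lemma Der_eq f x l m : Der f x l -> l = m -> Der f x m.
Proof. by move=> ? <-. Qed.

Lemma DerD f g x l m : Der f x l -> Der g x m -> Der (fun y => f y + g y) x (l + m).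
Proof. by move=> df dg; exact: (is_deriveD df dg). Qed.

Lemma DerB f g x l m : Der f x l -> Der g x m -> Der (fun y => f y - g y) x (l - m).
Proof. by move=> df dg; exact: (is_deriveB df dg). Qed.

Lemma DerN f x l : Der f x l -> Der (fun y => - f y) x (- l).
Proof. by move=> df; exact: (is_deriveN df). Qed.

Lemma DerM f g x l m : Der f x l -> Der g x m ->
  Der (fun y => f y * g y) x (l * g x + f x * m).
Proof.
move=> df dg; apply: (Der_eq (is_deriveM df dg)).
by rewrite /GRing.scale/= addrC [g x * _]mulrC.
Qed.

Lemma Der_cst c x : Der (fun=> c) x 0.
Proof. exact: is_derive_cst. Qed.

Lemma Der_id x : Der (fun y : R => y) x 1.
Proof. exact: is_derive_id. Qed.

Lemma DerX f n x l : Der f x l -> Der (fun y => f y ^+ n) x (n%:R * f x ^+ n.-1 * l).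
Proof.
move=> df; case: n => [|n]; first by rewrite !mul0r; exact: Der_cst.
have := @is_deriveX _ _ f n.+1 x 1 l df.
rewrite (_ : f ^+ n.+1 = fun y => f y ^+ n.+1); last by apply/funext => y; rewrite exprfctE.
by move=> /Der_eq; apply; rewrite /GRing.scale/=.
Qed.

Lemma Der_comp f g x l m : Der f (g x) l -> Der g x m ->
  Der (fun y => f (g y)) x (l * m).
Proof.
move=> df dg; apply: (Der_eq (is_derive1_comp df dg)).
by rewrite /GRing.scale/= mulrC.
Qed.

Lemma Der_expR f x l : Der f x l -> Der (fun y => expR (f y)) x (expR (f x) * l).
Proof. by move=> df; apply: (@Der_comp expR f) => //; exact: is_derive_expR. Qed.

Lemma Der_sum (I : Type) (s : seq I) (P : pred I) (f : I -> R -> R) x (l : I -> R) :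
  (forall i, P i -> Der (f i) x (l i)) ->
  Der (fun y => \sum_(i <- s | P i) f i y) x (\sum_(i <- s | P i) l i).
Proof.
move=> df; elim: s => [|i s IH].
  rewrite big_nil (_ : (fun y => _) = fun=> 0); first exact: Der_cst.
  by apply/funext => t; rewrite big_nil.
rewrite big_cons; case: ifPn => Pi.
  rewrite (_ : (fun y => _) = fun y => f i y + \sum_(i <- s | P i) f i y).
    by apply: DerD => //; exact: df.
  by apply/funext => t; rewrite big_cons Pi.
rewrite (_ : (fun y => _) = fun y => \sum_(i <- s | P i) f i y)//.
by apply/funext => t; rewrite big_cons (negbTE Pi).
Qed.

Lemma Der_continuous f x l : Der f x l -> {for x, continuous f}.
Proof. by move=> [df _]; apply/differentiable_continuous/derivable1_diffP. Qed.

Lemma Der_local f g a b x l : a < x -> x < b ->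
  (forall y, a < y -> y < b -> f y = g y) -> Der f x l -> Der g x l.
Proof.
move=> ax xb fg df; apply: (near_eq_is_derive _ df).
have : \forall y \near x, y \in `]a, b[ by apply: near_in_itvoo; rewrite in_itv/= ax.
by apply: filterS => y; rewrite in_itv/= => /andP[? ?]; exact: fg.
Qed.

Lemma le_of_Der_le0 F (f : R -> R) a b : a <= b -> continuous F ->
  (forall x, a < x -> x < b -> Der F x (f x)) ->
  (forall x, a < x -> x < b -> f x <= 0) -> F b <= F a.
Proof.
rewrite le_eqVlt => /predU1P[->//|ab] cF dF f0.
have [|c] := @MVT R F f a b ab _ (continuous_subspaceT cF).
  by move=> x; rewrite in_itv/= => /andP[]; exact: dF.
rewrite in_itv/= => /andP[ac cb] /eqP; rewrite subr_eq => /eqP ->.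
by rewrite gerDr mulr_le0_ge0 ?f0// subr_ge0 ltW.
Qed.

Lemma eq_of_Der0 F a b : a <= b -> continuous F ->
  (forall x, a < x -> x < b -> Der F x 0) -> F b = F a.
Proof.
move=> ab cF dF; apply/eqP; rewrite eq_le (le_of_Der_le0 ab cF dF)//=.
rewrite -lerN2; apply: (@le_of_Der_le0 (fun x => - F x) (fun=> 0)) => //.
  exact: continuousNf.
by move=> x ax xb; rewrite -oppr0; apply: DerN; exact: dF.
Qed.

Lemma FTC2 F f a b : a <= b -> continuous F -> continuous f ->
  (forall x, a < x -> x < b -> Der F x (f x)) -> Int a b f = F b - F a.
Proof.
rewrite le_eqVlt => /predU1P[->|ab] cF cf dF; first by rewrite Int_eq0// subrr.
have := @continuous_FTC2 R f F a b ab (continuous_subspaceT cf).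
rewrite /Int /Rintegral => -> //; last first.
  by move=> x; rewrite in_itv/= => /andP[ax xb]; rewrite derive1E (@derive_val _ _ _ _ _ _ _ (dF x ax xb)).
split; last 2 first.
- by apply: cvg_at_right_filter; exact: cF.
- by apply: cvg_at_left_filter; exact: cF.
by move=> x; rewrite in_itv/= => /andP[ax xb]; have [] := dF x ax xb.
Qed.

Lemma FTC1 f a x : continuous f -> a < x -> Der (fun y => Int a y f) x (f x).
Proof.
move=> cf ax.
have xx1 : x < x + 1 by rewrite ltrDl.
have [dF eF] := @continuous_FTC1_closed R f a x (x + 1) xx1 (continuous_integrable a (x + 1) cf) ax (cf x).
by apply: (DeriveDef dF); rewrite -derive1E; exact: eF.
Qed.

Lemma continuous_Int f a : continuous f -> continuous (fun y => Int a y f).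
Proof.
move=> cf x.
(* A segment reaching beyond [x]: for upper ends near [x], clamping to it changes no integral,
   including upper ends below [a], where both integrals are 0. *)
set b := Num.max a x + 1.
have ab : a <= b by rewrite /b ler_wpDr// le_max lexx.
have := parameterized_integral_continuous ab (continuous_integrable a b cf).
move/(@continuous_comp_within _ _ _ _ _ (clamp a b)) => /(_ (@continuous_clamp R a b)).
have h s : [set` `[a, b]] (clamp a b s) by rewrite /= in_itv/= clamp_ge clamp_le.
move=> /(_ h) /(_ x) H.
have eqx y : y < b -> ((fun x0 => parameterized_integral lebesgue_measure a x0 f) \o clamp a b) y = Int a y f.
  move=> yb; rewrite /= /parameterized_integral -/(Int a _ f).
  have [ay|ya] := leP a y; first by rewrite clamp_id// ltW.
  rewrite !Int_eq0//; first exact: ltW.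
  by rewrite /clamp (min_idPr (ltW yb)) (max_idPl (ltW ya)).
have xb : x < b by rewrite /b ltr_pwDr// le_max lexx orbT.
have H' : (((parameterized_integral lebesgue_measure a)^~ f \o clamp a b) y @[y --> x]) --> Int a x f.
  by rewrite -(eqx _ xb).
apply: cvg_trans H'; apply: near_eq_cvg.
have : \forall y \near x, y < b by exact: lt_nbhsl.
by apply: filterS => y yb; rewrite -eqx.
Qed.

(** A primitive of a nonnegative function with zero integral is constant, so its derivative, the
    function itself, is 0 at interior points. *)
Lemma Int_eq0_ge0 f a b x : continuous f -> (forall y, a <= y -> y <= b -> 0 <= f y) ->
  Int a b f = 0 -> a < x -> x < b -> f x = 0.
Proof.
move=> cf f0 If ax xb.
have G0 y : a <= y -> y <= b -> Int a y f = 0.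
  move=> ay yb; apply/eqP; rewrite eq_le; apply/andP; split; last first.
    by apply: Int_ge0 => z az zy; apply: f0 => //; exact: le_trans yb.
  rewrite -If (Int_cat cf ay yb) lerDl.
  by apply: Int_ge0 => z yz zb; apply: f0 => //; exact: le_trans yz.
have d1 := FTC1 cf ax.
have d0 : Der (fun y => Int a y f) x 0.
  apply: (@Der_local (fun=> 0) _ a b) (Der_cst 0 x) => // y ay yb.
  by rewrite G0// ltW.
by rewrite -(@derive_val _ _ _ _ _ _ _ d1) (@derive_val _ _ _ _ _ _ _ d0).
Qed.

Lemma Der_mulc c x : Der ( *%R c) x c.
Proof. by have := DerM (Der_cst c x) (Der_id x); rewrite mul0r add0r mulr1. Qed.

Lemma Der_addc c x : Der (+%R c) x 1.
Proof. by have := DerD (Der_cst c x) (Der_id x); rewrite add0r. Qed.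

Lemma Der_opp x : Der (-%R) x (-1).
Proof. exact: DerN (Der_id x). Qed.

End Derivatives.

Ltac der_struct := repeat (cbv beta; first
  [ eassumption
  | match goal with
    | |- Der (fun _ => ?c) _ _ => notypeclasses refine (Der_cst _ _)
    | |- Der (GRing.mul _) _ _ => notypeclasses refine (Der_mulc _ _)
    | |- Der (GRing.add _) _ _ => notypeclasses refine (Der_addc _ _)
    | |- Der GRing.opp _ _ => notypeclasses refine (Der_opp _)
    | |- Der (fun y => y) _ _ => notypeclasses refine (Der_id _)
    | |- Der (fun y => _ + _) _ _ => notypeclasses refine (DerD _ _)
    | |- Der (fun y => _ - _) _ _ => notypeclasses refine (DerB _ _)
    | |- Der (fun y => - _) _ _ => notypeclasses refine (DerN _)
    | |- Der (fun y => _ * _) _ _ => notypeclasses refine (DerM _ _)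
    | |- Der (fun y => _ ^+ _) _ _ => notypeclasses refine (DerX _ _)
    | |- Der (fun y => expR _) _ _ => notypeclasses refine (Der_expR _)
    | |- Der (fun y => @bigop _ _ _ _ _) _ _ => notypeclasses refine (Der_sum _ _); move=> ? _
    end
  | match goal with H : forall _, Der _ _ _ |- _ => notypeclasses refine (H _) end ]).
(** The derivative is computed by unification; what remains is the equality between the computed
    value and the expected one. *)
Ltac der := notypeclasses refine (Der_eq _ _); [der_struct|cbv beta].

(** * Integrals depending on a parameter *)

Section ParametricIntegrals.
Context (R : realType).
Implicit Types (f : R -> R -> R) (a b s x y : R).

(** Compactness of the segment makes continuity in the parameter uniform in [z]. *)
Lemma tube f a b s e : continuous (fun p : R * R => f p.1 p.2) -> 0 < e ->
  \forall t \near s, forall z, a <= z -> z <= b -> `|f z t - f z s| < e.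
Proof.
move=> cf e0.
have := @segment_compact R a b.
move/compact_near_coveringP => /(_ R (nbhs s) (fun t z => `|f z t - f z s| < e) _).
have H : forall z, [set` `[a, b]] z -> \forall x' \near z & i \near s, `|f x' i - f x' s| < e.
  move=> z _.
  pose g (p : R * R) := `|f p.1 p.2 - f p.1 s|.
  have cg : continuous g by rewrite /g; cts.
  have g0 : g (z, s) = 0 by rewrite /g/= subrr normr0.
  have /cvgrPdist_lt /(_ e e0) := cg (z, s); rewrite g0.
  apply: filterS => -[x t]/=.
  by rewrite sub0r normrN /g/= normr_id.
move=> /(_ H); apply: filterS => t Ht z az zb.
by apply: Ht; rewrite /= in_itv/= az.
Qed.

Lemma continuous_Int_param f a : continuous (fun p : R * R => f p.1 p.2) ->
  continuous (fun p : R * R => Int a p.1 (fun z => f z p.2)).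
Proof.
move=> cf [c s]; apply/cvgrPdist_lt => /= e e0.
have e2 : 0 < e / 2 by rewrite divr_gt0.
pose L := `|c - a| + 1.
have L0 : 0 < L by rewrite ltr_wpDl.
have eL : 0 < e / 2 / L by rewrite divr_gt0.
have cfs t : continuous (f ^~ t) by cts.
have T := @tube f a (c + 1) s _ cf eL.
have /cvgrPdist_lt /(_ _ e2) C := @continuous_Int R (f ^~ s) a (cfs s) c.
have cc1 : \forall y \near c, y < c + 1 by apply: lt_nbhsl; rewrite ltrDl.
near=> p.
have pc : p.1 < c + 1 by near: p; exact: (@cvg_fst _ _ (nbhs c) (nbhs s) _ _ cc1).
have H1 : `|Int a c (f ^~ s) - Int a p.1 (f ^~ s)| < e / 2.
  by near: p; exact: (@cvg_fst _ _ (nbhs c) (nbhs s) _ _ C).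
have H2 z : a <= z -> z <= c + 1 -> `|f z p.2 - f z s| < e / 2 / L.
  by move: z; near: p; exact: (@cvg_snd _ _ (nbhs c) (nbhs s) _ _ T).
rewrite -[X in `|X|](subrKA (Int a p.1 (f ^~ s))).
apply: le_lt_trans (ler_normD _ _) _; rewrite [ltRHS](splitr e) ltr_leD//.
rewrite distrC -IntB//.
have [ap|pa] := leP a p.1; last by rewrite Int_eq0 ?normr0 ?ltW.
apply: le_trans (ler_norm_Int _ _ _) _; first by apply: continuousBf.
apply: (@le_trans _ _ (Int a p.1 (fun=> e / 2 / L))).
  apply: le_Int; [by apply: continuous_normf; apply: continuousBf|exact: continuous_cstf|].
  by move=> x ax xp; apply/ltW/H2 => //; apply: le_trans xp _; exact: ltW.
rewrite Int_cst// mulrAC ler_pdivrMr// ler_pM2l//.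
by have := ler_norm (c - a); rewrite /L; lra.
Unshelve. all: by end_near.
Qed.

Lemma continuous_Int_slice f a b : continuous (fun p : R * R => f p.1 p.2) ->
  continuous (fun s => Int a b (fun z => f z s)).
Proof.
move=> cf; have cI := continuous_Int_param (a := a) cf.
have cb : continuous (fun _ : R => b) by cts.
have cid : continuous (fun s : R => s) by cts.
exact: (@continuous_uncurry_comp R R (fun c s => Int a c (f ^~ s)) _ _ cI cb cid).
Qed.

(** The domination comes from [tube]: for [t] near [s], [fs z t] stays within 1 of [fs z s], which
    gives the integrable bound [|fs z s| + 1]. *)
Lemma Der_Int f fs a b u v s : continuous (fun p : R * R => f p.1 p.2) ->
  continuous (fun p : R * R => fs p.1 p.2) -> u < s -> s < v ->
  (forall z t, a <= z -> z <= b -> u < t -> t < v -> Der (f z) t (fs z t)) ->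
  Der (fun t => Int a b (fun z => f z t)) s (Int a b (fun z => fs z s)).
Proof.
move=> cf cfs us sv df.
have cfz t : continuous (f ^~ t) by cts.
have cfsz t : continuous (fs ^~ t) by cts.
have T := @tube fs a b s 1 cfs ltr01.
have UV : \forall t \near s, t \in `]u, v[ by apply: near_in_itvoo; rewrite in_itv/= us.
have [d /= d0 Hd] := (nbhs_ballP _ _).1 (filterI T UV).
have dd t : t \in `]s - d, s + d[ -> (forall z, a <= z -> z <= b -> `|fs z t - fs z s| < 1) /\ (u < t < v).
  rewrite in_itv/= => td.
  have [] := Hd t; last by rewrite in_itv/=; split.
  by rewrite /ball/= ltr_distlC.
have sI : [set` `]s - d, s + d[] s by rewrite /= in_itv/= ltrBlDr ltrDl d0.
pose F (t : R) (z : R) := f z t.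
have h1 t : [set` `]s - d, s + d[] t -> (@lebesgue_measure R).-integrable `[a, b] (EFin \o F t).
  by move=> _; apply: continuous_integrable; exact: cfz.
have h2 t z : [set` `]s - d, s + d[] t -> [set` `[a, b]] z -> derivable (F ^~ z) t 1.
  move=> /dd[_ /andP[ut tv]] /=; rewrite in_itv/= => /andP[az zb].
  by have [] := df z t az zb ut tv.
have h3 t z : [set` `]s - d, s + d[] t -> [set` `[a, b]] z -> `|partial1of2 F t z| <= `|fs z s| + 1.
  move=> /dd[H /andP[ut tv]] /=; rewrite in_itv/= => /andP[az zb].
  rewrite partial1of2E (@derive_val _ _ _ _ _ _ _ (df z t az zb ut tv)).
  have := ltW (H z az zb); rewrite -lerBlDl; apply: le_trans.
  exact: lerB_dist.
have cG : continuous (fun z => `|fs z s| + 1) by cts.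
have h0 z : 0 <= `|fs z s| + 1 by rewrite addr_ge0.
have hm : measurable [set` `[a, b]] by exact: measurable_itv.
have D := @derivable_under_integral R _ _ lebesgue_measure F _ hm s _ _ sI h1 h2 _ h0 (continuous_integrable a b cG) h3.
have E := @differentiation_under_integral R _ _ lebesgue_measure F _ hm s _ _ sI h1 h2 _ h0 (continuous_integrable a b cG) h3.
apply: DeriveDef; first exact: D.
rewrite -derive1E; etransitivity; first exact: E.
apply: eq_Int => z az zb.
by rewrite partial1of2E (@derive_val _ _ _ _ _ _ _ (df z s az zb us sv)).
Qed.

End ParametricIntegrals.

(** * Differentiation of integrals over the slices of a triangle *)

Section Leibniz.
Context (R : realType).
Implicit Types (f fs : R -> R -> R) (s x y l : R).

Lemma Der_eps (A : R -> R) s l :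
  (forall e, 0 < e -> \forall t \near s, `|A t - A s - (t - s) * l| <= e * `|t - s|) ->
  Der A s l.
Proof.
move=> H.
have C : h^-1 *: (A (h *: (1 : R) + s) - A s) @[h --> 0^'] --> l.
  apply/cvgrPdist_le => /= e e0.
  have := H e e0; rewrite (near_shift 0 s) => He.
  have He' : \forall h \near 0^', `|A (h + s) - A s - h * l| <= e * `|h|.
    apply: cvg_within; apply: filterS He => h /=.
    by rewrite subr0 addrK.
  have n0 : \forall h \near (0 : R)^', h != 0 by exact: nbhs_dnbhs_neq.
  near=> h.
  have h0 : h != 0 by near: h.
  rewrite /GRing.scale/= mulr1.
  have -> : l - h^-1 * (A (h + s) - A s) = - (h^-1 * (A (h + s) - A s - h * l)).
    by rewrite [in RHS]mulrBr mulKf// opprB.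
  rewrite normrN normrM normfV ler_pdivrMl ?normr_gt0// [`|h| * e]mulrC.
  by near: h.
apply: DeriveDef; first by apply/cvg_ex; exists l.
exact: (cvg_lim _ C).
Unshelve. all: by end_near.
Qed.

Lemma MVT_bound (F f : R -> R) x y s m e : continuous F ->
  (forall t, x < t -> t < y -> Der F t (f t)) -> x < s -> s < y ->
  (forall t, x < t -> t < y -> `|f t - m| <= e) ->
  forall t, x < t -> t < y -> `|F t - F s - (t - s) * m| <= e * `|t - s|.
Proof.
move=> cF dF xs sy fm t xt ty.
have [->|st] := eqVneq t s; first by rewrite !subrr mul0r subr0 normr0 mulr0.
wlog: s t xs sy xt ty st / s < t => [H|{}st].
  have [//|ts|eq] := ltgtP s t; [exact: H| |by rewrite eq eqxx in st].
  have -> : F t - F s - (t - s) * m = - (F s - F t - (s - t) * m) by ring.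
  rewrite normrN (distrC t s).
  by apply: H => //; rewrite eq_sym.
have [|c] := @MVT R F f s t st _ (continuous_subspaceT cF).
  by move=> z; rewrite in_itv/= => /andP[sz zt]; apply: dF; [exact: lt_trans sz|exact: lt_trans zt _].
rewrite in_itv/= => /andP[sc ct] ->.
rewrite mulrC -mulrBr normrM mulrC ler_wpM2r//; apply: fm; [exact: lt_trans sc|exact: lt_trans ct _].
Qed.

(* Leibniz rule on the slices z in [0, l - s] of a triangle. *)
Lemma Der_Int_triangle f fs l s : continuous (fun p : R * R => f p.1 p.2) ->
  continuous (fun p : R * R => fs p.1 p.2) -> 0 < s -> s < l ->
  (forall z t, 0 <= z -> z <= l -> 0 < t -> t < l -> Der (f z) t (fs z t)) ->
  Der (fun t => Int 0 (l - t) (f ^~ t)) s (Int 0 (l - s) (fs ^~ s) - f (l - s) s).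
Proof.
move=> cf cfs s0 sl df.
pose G b t := Int 0 b (f ^~ t).
pose Gs b t := Int 0 b (fs ^~ t).
have cfst : continuous (f ^~ s) by cts.
have cG := continuous_Int_param (a := 0) cf.
have cGs := continuous_Int_param (a := 0) cfs.
(* The part [G (l - t) s], treated in [dB], only sees the moving end. In the increment left here the
   second argument varies but the end [l - t] still moves, so [Der_Int] does not apply directly; a
   mean value bound and the joint continuity of [Gs] do. *)
have dA : Der (fun t => G (l - t) t - G (l - t) s) s (Gs (l - s) s).
  apply: Der_eps => e e0.
  have /cvgrPdist_le /(_ e e0) [[/= U V] [/nbhs_ballP[d1 /= d10 H1] /nbhs_ballP[d2 /= d20 H2]] H] := cGs (l - s, s).
  have nd : \forall t \near s, `|s - t| < Num.min (Num.min d1 d2) (Num.min s (l - s)).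
    apply/nbhs_ballP; exists (Num.min (Num.min d1 d2) (Num.min s (l - s))) => //=.
    by rewrite !lt_min d10 d20 s0 subr_gt0.
  apply: filterS nd => t; rewrite !lt_min => /andP[/andP[t1 t2] /andP[t3 t4]].
  rewrite [G (l - s) s - _]subrr subr0.
  set d := Num.min d2 (Num.min s (l - s)).
  have dd2 : d <= d2 by rewrite /d ge_min lexx.
  have dds : d <= s by rewrite /d !ge_min lexx orbT.
  have ddl : d <= l - s by rewrite /d !ge_min lexx !orbT.
  have td : `|s - t| < d by rewrite /d !lt_min t2 t3.
  have d0 : 0 < d by rewrite /d !lt_min d20 s0 subr_gt0.
  move: td; rewrite distrC ltr_distl => /andP[td1 td2].
  apply: (@MVT_bound (G (l - t)) (Gs (l - t)) (s - d) (s + d)) => //; try lra.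
  - exact: continuous_Int_slice.
  - move=> r r1 r2; apply: (@Der_Int _ f fs 0 (l - t) 0 l) => //; try lra.
    by move=> z r' z0 zlt r'0 r'l; apply: df => //; lra.
  - move=> r r1 r2; rewrite distrC.
    apply: (H (l - t, r)); split => /=.
      by apply: H1; rewrite /ball/= (_ : _ - _ = t - s) 1?distrC//; ring.
    by apply: H2; rewrite /ball/= ltr_distl; apply/andP; split; lra.
have dB : Der (fun t => G (l - t) s) s (f (l - s) s * (0 - 1)).
  have d1 : Der (fun t : R => l - t) s (0 - 1) by exact: DerB (Der_cst _ _) (Der_id _).
  apply: (Der_comp (f := fun b => G b s) _ d1).
  by apply: FTC1 => //; rewrite subr_gt0.
have := DerD dA dB.
rewrite (_ : (fun t => _) = fun t => G (l - t) t); last by apply/funext => t; rewrite subrK.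
by move=> /Der_eq; apply; rewrite mulrBr mulr0 mulr1 sub0r.
Qed.

Lemma continuous_Int_triangle f l : continuous (fun p : R * R => f p.1 p.2) ->
  continuous (fun t => Int 0 (l - t) (f ^~ t)).
Proof.
move=> cf; have cG := continuous_Int_param (a := 0) cf.
have cb : continuous (fun t : R => l - t) by cts.
have cid : continuous (fun s : R => s) by cts.
exact: (@continuous_uncurry_comp R R (fun c s => Int 0 c (f ^~ s)) _ _ cG cb cid).
Qed.

End Leibniz.

(** * Sidewise energy estimates *)

Section Sidewise.
Context (R : realType).
Implicit Types (z s t : R).

(** Source of all the Cauchy-Schwarz inequalities below. When [C] is 0 the quadratic is affine, and
    a nonzero slope would let it reach -1. *)
Lemma discriminant_le (A B C : R) : 0 <= C ->
  (forall t, 0 <= A - 2 * t * B + t ^+ 2 * C) -> B ^+ 2 <= A * C.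
Proof.
move=> C0 H; have [C00|Cn0] := eqVneq C 0.
  rewrite C00 mulr0; have [->|Bn0] := eqVneq B 0; first by rewrite expr0n.
  have := H ((A + 1) / B / 2); rewrite C00 mulr0 addr0.
  have -> : A - 2 * ((A + 1) / B / 2) * B = -1 by field.
  by lra.
have Cgt : 0 < C by rewrite lt_neqAle eq_sym Cn0.
have := H (B / C).
have -> : A - 2 * (B / C) * B + (B / C) ^+ 2 * C = (A * C - B ^+ 2) / C by field.
by rewrite pmulr_lge0 ?invr_gt0// subr_ge0.
Qed.

Lemma Int_CauchySchwarz (a b : R) (f g : R -> R) : continuous f -> continuous g ->
  Int a b (fun x => f x * g x) ^+ 2 <=
  Int a b (fun x => f x ^+ 2) * Int a b (fun x => g x ^+ 2).
Proof.
move=> cf cg; apply: discriminant_le => [|t].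
  by apply: Int_ge0 => x _ _; exact: sqr_ge0.
rewrite -!IntZ; [|by cts..].
rewrite -IntB; [|by cts..].
rewrite -IntD; [|by cts..].
apply: Int_ge0 => x _ _.
have -> : f x ^+ 2 - 2 * t * (f x * g x) + t ^+ 2 * g x ^+ 2 = (f x - t * g x) ^+ 2 by ring.
exact: sqr_ge0.
Qed.

(** A wave-type function is read sideways: [z] is the evolution variable, the Cauchy data vanish on
    z = 0, and [dt0] is a reflection condition on t = 0. The weight [w] is of Carleman type: each
    estimate gains negative powers of [lam]. *)
Variables (d dx dt dxx dxt dtt : R -> R -> R) (l lam : R).
Hypotheses (l0 : 0 < l) (lam0 : 0 < lam).
Hypotheses (cd : continuous (fun p : R * R => d p.1 p.2))
  (cdx : continuous (fun p : R * R => dx p.1 p.2))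
  (cdt : continuous (fun p : R * R => dt p.1 p.2))
  (cdxx : continuous (fun p : R * R => dxx p.1 p.2))
  (cdxt : continuous (fun p : R * R => dxt p.1 p.2))
  (cdtt : continuous (fun p : R * R => dtt p.1 p.2)).
Hypothesis Hd_t : forall z t, 0 <= z -> z <= l -> 0 < t -> t < l ->
  Der (dx z) t (dxt z t) /\ Der (dt z) t (dtt z t).
Hypothesis Hd_x : forall z t, 0 < z -> z < l -> 0 <= t -> t <= l ->
  [/\ Der (d^~ t) z (dx z t), Der (dx^~ t) z (dxx z t) & Der (dt^~ t) z (dxt z t)].
Hypothesis d00 : forall t, 0 <= t -> t <= l -> [/\ d 0 t = 0, dx 0 t = 0 & dt 0 t = 0].
Hypothesis dt0 : forall z, 0 <= z -> z <= l -> dt z 0 = 0.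

Let w z := expR (- (lam * z)).
Let w0 z : 0 < w z. Proof. exact: expR_gt0. Qed.
Let cw : continuous w. Proof. rewrite /w; cts. Qed.
Let dw z : Der w z (w z * - lam).
Proof. by rewrite /w; der. Qed.

(** Integral over the triangle 0 <= z, 0 <= s, z + s <= l, which is what the data on z = 0, 0 <= s
    <= l determine. The side z + s = l is characteristic. *)
Definition II (g : R -> R -> R) : R := Int 0 l (fun s => Int 0 (l - s) (g ^~ s)).

Lemma le_II (g h : R -> R -> R) : continuous (fun p : R * R => g p.1 p.2) ->
  continuous (fun p : R * R => h p.1 p.2) ->
  (forall z s, 0 <= z -> z <= l -> 0 <= s -> s <= l -> g z s <= h z s) -> II g <= II h.
Proof.
move=> cg ch gh; apply: le_Int; [exact: continuous_Int_triangle..|].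
move=> s s0 sl; apply: le_Int; [cts|cts|].
by move=> z z0 zl; apply: gh => //; lra.
Qed.

Lemma IIZ c (g : R -> R -> R) : continuous (fun p : R * R => g p.1 p.2) ->
  II (fun z s => c * g z s) = c * II g.
Proof.
move=> cg; rewrite /II -IntZ; last exact: continuous_Int_triangle.
by apply: eq_Int => s s0 sl; rewrite -IntZ//; cts.
Qed.

Lemma IID (g h : R -> R -> R) : continuous (fun p : R * R => g p.1 p.2) ->
  continuous (fun p : R * R => h p.1 p.2) ->
  II (fun z s => g z s + h z s) = II g + II h.
Proof.
move=> cg ch; rewrite /II -IntD; [|exact: continuous_Int_triangle..].
by apply: eq_Int => s s0 sl; rewrite -IntD//; cts.
Qed.

(** Since [a] is a mere pointwise derivative, with no continuity, the proof compares monotone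
    functions and does not integrate [a]. *)
Lemma II_le_Der (g : R -> R -> R) (A a : R -> R) : continuous (fun p : R * R => g p.1 p.2) ->
  continuous A -> (forall s, 0 < s -> s < l -> Der A s (a s)) ->
  (forall s, 0 < s -> s < l -> Int 0 (l - s) (g ^~ s) <= a s) -> II g <= A l - A 0.
Proof.
move=> cg cA dA ga.
have cT := @continuous_Int_triangle R g l cg.
have := @le_of_Der_le0 R (fun s => Int 0 s (fun s => Int 0 (l - s) (g ^~ s)) - A s)
  (fun s => Int 0 (l - s) (g ^~ s) - a s) 0 l (ltW l0).
rewrite (@Int_eq0 _ 0 0)// -/(II g) => H.
suff : II g - A l <= 0 - A 0 by lra.
apply: H.
- by apply: continuousBf => //; exact: continuous_Int.
- by move=> s s0 sl; apply: DerB (dA _ s0 sl); apply: FTC1.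
- by move=> s s0 sl; rewrite subr_le0; exact: ga.
Qed.

(** The integral of (w d^2)' = w (- lam d^2 + 2 d dx) is nonnegative because d = 0 at z = 0. After
    multiplication by 2 lam, the difference of the two sides is w (lam d - 2 dx)^2. *)
Lemma slice_poincare s : 0 <= s -> s <= l ->
  lam ^+ 2 * Int 0 (l - s) (fun z => w z * d z s ^+ 2) <=
  4 * Int 0 (l - s) (fun z => w z * dx z s ^+ 2).
Proof.
move=> s0 sl.
have cds : continuous (d^~ s) by cts.
have cdxs : continuous (dx^~ s) by cts.
have E := @FTC2 R (fun z => w z * d z s ^+ 2)
  (fun z => w z * - lam * d z s ^+ 2 + w z * (2 * d z s * dx z s)) 0 (l - s).
have {}E : 0 <= Int 0 (l - s) (fun z => w z * - lam * d z s ^+ 2 + w z * (2 * d z s * dx z s)).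
  rewrite E; [|lra|by cts|by cts|].
    have [-> _ _] := d00 s0 sl.
    by rewrite expr0n/= mulr0 subr0 mulr_ge0 ?sqr_ge0 ?ltW.
  move=> z z0 zl; have zl' : z < l by lra.
  have [D1 _ _] := Hd_x z0 zl' s0 sl.
  by have Dw := dw z; der; rewrite expr1.
rewrite -!IntZ; [|by cts..].
rewrite -subr_ge0 -IntB; [|by cts..].
have : 0 <= 2 * lam * Int 0 (l - s) (fun z => w z * - lam * d z s ^+ 2 + w z * (2 * d z s * dx z s)).
  by rewrite mulr_ge0// mulr_ge0// ltW.
rewrite -IntZ; last by cts.
move/le_trans; apply; apply: le_Int; [by cts..|].
move=> z _ _; rewrite -subr_ge0.
have -> : 4 * (w z * dx z s ^+ 2) - lam ^+ 2 * (w z * d z s ^+ 2) -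
  2 * lam * (w z * - lam * d z s ^+ 2 + w z * (2 * d z s * dx z s)) =
  w z * (lam * d z s - 2 * dx z s) ^+ 2 by ring.
by rewrite mulr_ge0 ?sqr_ge0// ltW.
Qed.

Let F z s := dxx z s - dtt z s.
Let cF : continuous (fun p : R * R => F p.1 p.2). Proof. by rewrite /F; cts. Qed.

(** Follow the momentum, the slice integral of w dx dt, as s varies. Its loss through the
    characteristic side is at most w (dt^2 + dx^2) / 2 there, which equals the slice integral of a
    z-derivative; differentiating the weight yields lam (dt^2 + dx^2) / 2, enough to absorb dx F.
    The momentum is 0 at s = l, where the slice is a point, and at s = 0, where dt = 0. *)
Lemma II_dx2 : II (fun z s => w z * dx z s ^+ 2) <= 4 / lam ^+ 2 * II (fun z s => w z * F z s ^+ 2).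
Proof.
pose A s := Int 0 (l - s) (fun z => w z * (dx z s * dt z s)).
pose g z s := lam / 4 * (w z * dx z s ^+ 2) + (- lam^-1) * (w z * F z s ^+ 2).
have cwp : continuous (fun p : R * R => w p.1).
  by move=> p; apply: (continuous_comp (f := fst)); [exact: cvg_fst|exact: cw].
have cg : continuous (fun p : R * R => g p.1 p.2) by rewrite /g; cts.
have : II g <= A l - A 0.
  apply: (II_le_Der (a := fun s => Int 0 (l - s) (fun z => w z * (dxt z s * dt z s + dx z s * dtt z s)) -
     w (l - s) * (dx (l - s) s * dt (l - s) s))) => //.
  - by apply: (@continuous_Int_triangle R (fun z s => w z * (dx z s * dt z s))); cts.
  - move=> s s0 sl.
    apply: (@Der_Int_triangle R (fun z s => w z * (dx z s * dt z s))
      (fun z s => w z * (dxt z s * dt z s + dx z s * dtt z s))); [by cts|by cts|exact: s0|exact: sl|].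
    move=> z t z0 zl t0 tl; have [D1 D2] := Hd_t z0 zl t0 tl.
    by der; rewrite mul0r add0r.
  - move=> s s0 sl.
    have cs (h : R -> R -> R) : continuous (fun p : R * R => h p.1 p.2) -> continuous (h^~ s).
      by move=> ch; cts.
    have c1 := cs _ cdx; have c2 := cs _ cdt; have c3 := cs _ cdxx.
    have c4 := cs _ cdxt; have c5 := cs _ cdtt; have cFs := cs _ cF.
    have E := @FTC2 R (fun z => w z * (dt z s ^+ 2 + dx z s ^+ 2) / 2)
      (fun z => w z * - lam * (dt z s ^+ 2 + dx z s ^+ 2) / 2 + w z * (dt z s * dxt z s + dx z s * dxx z s)) 0 (l - s).
    have {}E : w (l - s) * (dt (l - s) s ^+ 2 + dx (l - s) s ^+ 2) / 2 =
        Int 0 (l - s) (fun z => w z * - lam * (dt z s ^+ 2 + dx z s ^+ 2) / 2 + w z * (dt z s * dxt z s + dx z s * dxx z s)).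
      rewrite E; [|lra|by cts|by cts|].
        have [_ -> ->] := d00 (ltW s0) (ltW sl).
        by rewrite expr0n/= addr0 mulr0 mul0r subr0.
      move=> z z0 zl; have zl' : z < l by lra.
      have [_ D1 D2] := Hd_x z0 zl' (ltW s0) (ltW sl).
      by have Dw := dw z; der; rewrite !expr1; field.
    have H : w (l - s) * (dx (l - s) s * dt (l - s) s) <= w (l - s) * (dt (l - s) s ^+ 2 + dx (l - s) s ^+ 2) / 2.
      rewrite -mulrA ler_pM2l//.
      by have := sqr_ge0 (dt (l - s) s - dx (l - s) s); rewrite sqrrB; lra.
    rewrite lerBrDr; apply: le_trans (lerD (lexx _) H) _; rewrite -lerBrDr E -IntB; [|by cts..].
    apply: le_Int; [by rewrite /g; cts|by cts|].
    move=> z _ _; rewrite -subr_ge0 /g /F.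
    have -> : w z * (dxt z s * dt z s + dx z s * dtt z s) -
      (w z * - lam * (dt z s ^+ 2 + dx z s ^+ 2) / 2 + w z * (dt z s * dxt z s + dx z s * dxx z s)) -
      (lam / 4 * (w z * dx z s ^+ 2) + - lam^-1 * (w z * (dxx z s - dtt z s) ^+ 2)) =
      w z * (lam / 2 * dt z s ^+ 2 + lam^-1 * (lam / 2 * dx z s - (dxx z s - dtt z s)) ^+ 2).
      by field; rewrite gt_eqF.
    rewrite mulr_ge0 ?(ltW (w0 _))// addr_ge0// mulr_ge0 ?sqr_ge0 ?invr_ge0 ?divr_ge0 ?(ltW lam0)//.
have -> : A l = 0 by rewrite /A Int_eq0// subrr.
have -> : A 0 = 0.
  rewrite /A; transitivity (Int 0 (l - 0) (fun=> 0 : R)); last by rewrite Int_cst ?mul0r// subr0 ltW.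
  apply: eq_Int => z z0 zl; rewrite dt0 ?mulr0//; lra.
rewrite subrr /g IID; [|by cts..].
rewrite !IIZ; [|by cts..].
move=> H; rewrite -(@ler_pM2l _ (lam / 4)) ?divr_gt0//.
have -> : lam / 4 * (4 / lam ^+ 2 * II (fun z s => w z * F z s ^+ 2)) =
  lam^-1 * II (fun z s => w z * F z s ^+ 2) by field; rewrite gt_eqF.
by move: H; rewrite mulNr subr_le0.
Qed.

(** The factor lam^-4 is what later allows zeroth-order terms of the equation to be absorbed. *)
Lemma II_d2 : II (fun z s => w z * d z s ^+ 2) <= 16 / lam ^+ 4 * II (fun z s => w z * F z s ^+ 2).
Proof.
have cwp : continuous (fun p : R * R => w p.1).
  by move=> p; apply: (continuous_comp (f := fst)); [exact: cvg_fst|exact: cw].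
have H1 : II (fun z s => lam ^+ 2 * (w z * d z s ^+ 2)) <= II (fun z s => 4 * (w z * dx z s ^+ 2)).
  apply: le_Int => [||s s0 sl].
  - by apply: (@continuous_Int_triangle R (fun z s => lam ^+ 2 * (w z * d z s ^+ 2))); cts.
  - by apply: (@continuous_Int_triangle R (fun z s => 4 * (w z * dx z s ^+ 2))); cts.
  have cds : continuous (d^~ s) by cts.
  have cdxs : continuous (dx^~ s) by cts.
  by have := slice_poincare s0 sl; rewrite !IntZ; [|by cts..].
move: H1; rewrite !IIZ; [|by cts..] => H1.
have l2 : 0 < lam ^+ 2 by rewrite exprn_gt0.
rewrite -(ler_pM2l l2); apply: (le_trans H1).
apply: (le_trans (ler_wpM2l _ II_dx2)); first by [].
by rewrite le_eqVlt; apply/orP; left; apply/eqP; field; rewrite gt_eqF.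
Qed.

(** With p = dx + dt, the source is F = (d/dz - d/dt) p, so p is transported along the lines z + s =
    const and its flux through the characteristic side cancels exactly. What remains at s = 0 is
    half the weighted integral of dx^2, and integrating dx along s = 0 gives the value at the
    vertex. *)
Lemma sidewise_bound : d l 0 ^+ 2 <= l * expR (lam * l) / lam * II (fun z s => w z * F z s ^+ 2).
Proof.
pose p z s := dx z s + dt z s.
pose B s := Int 0 (l - s) (fun z => w z * p z s ^+ 2 / 2).
pose g z s := - (2 * lam)^-1 * (w z * F z s ^+ 2).
have cp : continuous (fun q : R * R => p q.1 q.2) by rewrite /p; cts.
have cwp : continuous (fun p : R * R => w p.1).
  by move=> q; apply: (continuous_comp (f := fst)); [exact: cvg_fst|exact: cw].
have cg : continuous (fun p : R * R => g p.1 p.2) by rewrite /g; cts.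
have : II g <= B l - B 0.
  apply: (II_le_Der (a := fun s => Int 0 (l - s) (fun z => w z * (p z s * (dxt z s + dtt z s))) -
     w (l - s) * p (l - s) s ^+ 2 / 2)) => //.
  - by apply: (@continuous_Int_triangle R (fun z s => w z * p z s ^+ 2 / 2)); cts.
  - move=> s s0 sl.
    apply: (@Der_Int_triangle R (fun z s => w z * p z s ^+ 2 / 2)
      (fun z s => w z * (p z s * (dxt z s + dtt z s)))); [by cts|by cts|exact: s0|exact: sl|].
    move=> z t z0 zl t0 tl; have [D1 D2] := Hd_t z0 zl t0 tl.
    by rewrite /p; der; field.
  - move=> s s0 sl.
    have cs (h : R -> R -> R) : continuous (fun p : R * R => h p.1 p.2) -> continuous (h^~ s).
      by move=> ch; cts.
    have c1 := cs _ cp; have c3 := cs _ cdxx.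
    have c4 := cs _ cdxt; have c5 := cs _ cdtt; have cFs := cs _ cF.
    have E := @FTC2 R (fun z => w z * p z s ^+ 2 / 2)
      (fun z => w z * - lam * p z s ^+ 2 / 2 + w z * (p z s * (dxx z s + dxt z s))) 0 (l - s).
    have {}E : w (l - s) * p (l - s) s ^+ 2 / 2 =
        Int 0 (l - s) (fun z => w z * - lam * p z s ^+ 2 / 2 + w z * (p z s * (dxx z s + dxt z s))).
      rewrite E; [|lra|by cts|by cts|].
        have [_ d1 d2] := d00 (ltW s0) (ltW sl).
        by rewrite /p d1 d2 addr0 expr0n/= mulr0 mul0r subr0.
      move=> z z0 zl; have zl' : z < l by lra.
      have [_ D1 D2] := Hd_x z0 zl' (ltW s0) (ltW sl).
      by have Dw := dw z; rewrite /p; der; field.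
    rewrite E -IntB; [|by cts..].
    apply: le_Int; [by rewrite /g; cts|by cts|].
    move=> z _ _; rewrite -subr_ge0 /g /F.
    have -> : w z * (p z s * (dxt z s + dtt z s)) -
      (w z * - lam * p z s ^+ 2 / 2 + w z * (p z s * (dxx z s + dxt z s))) -
      - (2 * lam)^-1 * (w z * (dxx z s - dtt z s) ^+ 2) =
      w z * (lam * (2 * lam ^+ 2)^-1 * (lam * p z s - (dxx z s - dtt z s)) ^+ 2).
      by field; rewrite gt_eqF.
    rewrite mulr_ge0 ?(ltW (w0 _))// mulr_ge0 ?sqr_ge0// divr_ge0 ?mulr_ge0 ?sqr_ge0 ?(ltW lam0)//.
have -> : B l = 0 by rewrite /B Int_eq0// subrr.
rewrite /g IIZ; last by cts.
have cdx0 : continuous (dx^~ 0) by cts.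
have cd0 : continuous (d^~ 0) by cts.
have -> : B 0 = Int 0 l (fun z => 2^-1 * (w z * dx z 0 ^+ 2)).
  rewrite /B subr0; apply: eq_Int => z z0 zl.
  by rewrite /p dt0// addr0; ring.
rewrite IntZ; last by cts.
set J := II _; set X := Int 0 l _ => H.
have {}H : X <= J / lam.
  have : - (2 * lam)^-1 * J = - (J / lam / 2) by field; rewrite gt_eqF.
  by move: H; lra.
have J0 : 0 <= J.
  apply: Int_ge0 => s _ _; apply: Int_ge0 => z _ _.
  by rewrite mulr_ge0 ?sqr_ge0// ltW.
have dl : d l 0 = Int 0 l (fun z => 1 * dx z 0).
  rewrite (@FTC2 R (d^~ 0)); [|exact: ltW|by []|by cts|].
    by have [->] := d00 (lexx 0) (ltW l0); rewrite subr0.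
  move=> z z0 zl; rewrite mul1r.
  by have [D1 _ _] := Hd_x z0 zl (lexx 0) (ltW l0).
rewrite dl; apply: (le_trans (Int_CauchySchwarz _ _ _ _)); [by cts..|].
have -> : Int 0 l (fun=> 1 ^+ 2) = l.
  by rewrite Int_cst ?ltW// expr1n mul1r subr0.
rewrite -!mulrA ler_pM2l//.
apply: (@le_trans _ _ (expR (lam * l) * X)).
  rewrite -IntZ; last by cts.
  apply: le_Int; [by cts..|].
  move=> z z0 zl; rewrite mulrA ler_peMl ?sqr_ge0//.
  by rewrite /w -expRD -expR0 ler_expR -mulrBr mulr_ge0 ?subr_ge0 ?(ltW lam0).
by rewrite ler_pM2l ?expR_gt0// mulrC.
Qed.

End Sidewise.

(** * Forward energy estimate for a system of waves *)

Section Energy.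
Context (R : realType) (I : finType).
Implicit Types (z s t : R).
Variables (Z Zx Zt Zxx Zxt Ztt : I -> R -> R -> R) (l m r : R).
Hypotheses (l1 : l <= 1) (m0 : 0 <= m) (r0 : 0 <= r).
Hypotheses (cZ : forall i, continuous (fun p : R * R => Z i p.1 p.2))
  (cZx : forall i, continuous (fun p : R * R => Zx i p.1 p.2))
  (cZt : forall i, continuous (fun p : R * R => Zt i p.1 p.2))
  (cZxx : forall i, continuous (fun p : R * R => Zxx i p.1 p.2))
  (cZxt : forall i, continuous (fun p : R * R => Zxt i p.1 p.2))
  (cZtt : forall i, continuous (fun p : R * R => Ztt i p.1 p.2)).
Hypothesis HZ_t : forall i z t, 0 <= z -> z <= l -> 0 < t -> t < l ->
  [/\ Der (Z i z) t (Zt i z t), Der (Zx i z) t (Zxt i z t) & Der (Zt i z) t (Ztt i z t)].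
Hypothesis HZ_x : forall i z t, 0 < z -> z < l -> 0 <= t -> t <= l ->
  Der (Zx i ^~ t) z (Zxx i z t) /\ Der (Zt i ^~ t) z (Zxt i z t).
Hypothesis Zx0 : forall i t, 0 <= t -> t <= l -> Zx i 0 t = 0.
Hypothesis Z0 : forall i z, 0 <= z -> z <= l -> Z i z 0 = 0 /\ Zx i z 0 = 0.
Hypothesis HZ : forall z t, 0 <= z -> z <= l -> 0 <= t -> t <= l ->
  \sum_i (Ztt i z t - Zxx i z t) ^+ 2 <= m * \sum_i Z i z t ^+ 2 + r.

Let e z t := \sum_i (Zt i z t ^+ 2 + Zx i z t ^+ 2 + Z i z t ^+ 2).
Let E t := Int 0 (l - t) (e ^~ t).
Let ce : continuous (fun p : R * R => e p.1 p.2). Proof. by rewrite /e; cts. Qed.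

(** Energy on the shrinking slices 0 <= z <= l - t: the Neumann condition removes the flux at z = 0,
    and the flux at z = l - t is at most the energy density lost there by shrinking. Then the
    derivative of E is at most (m + 2) E + r, and Gronwall's argument applies; [l <= 1] keeps [l]
    out of the constants. *)
Lemma energy_bound t : 0 <= t -> t <= l ->
  Int 0 (l - t) (fun z => \sum_i Zt i z t ^+ 2) <=
  expR (m + 2) * (Int 0 l (fun z => \sum_i Zt i z 0 ^+ 2) + r).
Proof.
move=> t0 tl.
have cE : continuous E by exact: continuous_Int_triangle.
pose E' s := Int 0 (l - s) (fun z => \sum_i (2 * Zt i z s * Ztt i z s + 2 * Zx i z s * Zxt i z s + 2 * Z i z s * Zt i z s))
   - e (l - s) s.
have dE s : 0 < s -> s < l -> Der E s (E' s).
  move=> s0 sl.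
  apply: (@Der_Int_triangle R e (fun z s => \sum_i (2 * Zt i z s * Ztt i z s + 2 * Zx i z s * Zxt i z s + 2 * Z i z s * Zt i z s))) => //.
    by cts.
  move=> z u z0 zl u0 ul; rewrite /e.
  have D1 i : Der (Z i z) u (Zt i z u) by have [] := HZ_t i z0 zl u0 ul.
  have D2 i : Der (Zx i z) u (Zxt i z u) by have [] := HZ_t i z0 zl u0 ul.
  have D3 i : Der (Zt i z) u (Ztt i z u) by have [] := HZ_t i z0 zl u0 ul.
  by der; apply: eq_bigr => i _; rewrite !expr1.
have bE s : 0 < s -> s < l -> E' s <= (m + 2) * E s + r.
  move=> s0 sl; rewrite /E'.
  have F : Int 0 (l - s) (fun z => \sum_i (2 * Zx i z s * Zxt i z s + 2 * Zt i z s * Zxx i z s))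
     = \sum_i (2 * Zt i (l - s) s * Zx i (l - s) s).
    rewrite (@FTC2 R (fun z => \sum_i (2 * Zt i z s * Zx i z s))); [|lra|by cts|by cts|].
      rewrite [X in _ - X]big1 ?subr0// => i _.
      by rewrite Zx0 ?mulr0// ltW.
    move=> z z0 zl; have zl' : z < l by lra.
    have D1 i : Der (Zx i ^~ s) z (Zxx i z s) by have [] := HZ_x i z0 zl' (ltW s0) (ltW sl).
    have D2 i : Der (Zt i ^~ s) z (Zxt i z s) by have [] := HZ_x i z0 zl' (ltW s0) (ltW sl).
    by der; apply: eq_bigr => i _; ring.
  have Fe : \sum_i (2 * Zt i (l - s) s * Zx i (l - s) s) <= e (l - s) s.
    apply: ler_sum => i _; have := sqr_ge0 (Zt i (l - s) s - Zx i (l - s) s).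
    by have := sqr_ge0 (Z i (l - s) s); rewrite sqrrB; lra.
  rewrite -F in Fe.
  apply: le_trans (lerD (lexx _) (_ : - _ <= - _)) _; first by rewrite lerN2; exact: Fe.
  rewrite -IntB; [|by cts..].
  have rl : Int 0 (l - s) (fun=> r) <= r.
    have sl0 : 0 <= l - s by rewrite subr_ge0 ltW.
    by rewrite Int_cst// subr0 ler_piMr// lerBlDr (le_trans l1)// lerDl ltW.
  apply: le_trans (lerD (lexx _) rl).
  rewrite /E -IntZ; last by cts.
  rewrite -IntD; [|by cts..].
  apply: le_Int; [by cts..|] => z z0 zl.
  have zl' : z <= l by lra.
  have := HZ z0 zl' (ltW s0) (ltW sl) => H.
  rewrite -sumrB.
  apply: (@le_trans _ _ (\sum_i ((Ztt i z s - Zxx i z s) ^+ 2 + 2 * Zt i z s ^+ 2 + Z i z s ^+ 2))).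
    apply: ler_sum => i _.
    have := sqr_ge0 (Zt i z s - (Ztt i z s - Zxx i z s)).
    have := sqr_ge0 (Z i z s - Zt i z s).
    by rewrite !sqrrB !expr2; lra.
  rewrite !big_split/= in H *.
  rewrite /e !big_split/= -!mulr_sumr.
  set a := \sum_i _ in H *; set b := \sum_i Zt i z s ^+ 2; set c := \sum_i Z i z s ^+ 2 in H *.
  have b0 : 0 <= b by apply: sumr_ge0 => i _; exact: sqr_ge0.
  have c0 : 0 <= c by apply: sumr_ge0 => i _; exact: sqr_ge0.
  set d := \sum_i Zx i z s ^+ 2.
  have d0 : 0 <= d by apply: sumr_ge0 => i _; exact: sqr_ge0.
  have mb : 0 <= m * b by rewrite mulr_ge0.
  have md : 0 <= m * d by rewrite mulr_ge0.
  by rewrite !mulrDr !mulrDl; lra.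
have G : E t * expR (- ((m + 2) * t)) - r * t <= E 0 * expR (- ((m + 2) * 0)) - r * 0.
  apply: (@le_of_Der_le0 R (fun s => E s * expR (- ((m + 2) * s)) - r * s)
     (fun s => (E' s - (m + 2) * E s) * expR (- ((m + 2) * s)) - r)) => //.
  - by cts.
  - move=> s s0 sl; have D := dE s s0 (lt_le_trans sl tl).
    by der; ring.
  - move=> s s0 st; have sl := lt_le_trans st tl.
    rewrite subr_le0.
    apply: (@le_trans _ _ (r * expR (- ((m + 2) * s)))).
      by rewrite ler_pM2r ?expR_gt0//; have := bE s s0 sl; lra.
    by rewrite ler_piMr// -expR0 ler_expR oppr_le0 mulr_ge0 ?addr_ge0// ltW.
rewrite !mulr0 oppr0 expR0 mulr1 addr0 in G.
have E0 : E 0 = Int 0 l (fun z => \sum_i Zt i z 0 ^+ 2).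
  rewrite /E subr0; apply: eq_Int => z z0 zl; apply: eq_bigr => i _.
  by have [-> ->] := Z0 i z0 zl; rewrite expr0n/= !addr0.
rewrite -E0.
have Et : Int 0 (l - t) (fun z => \sum_i Zt i z t ^+ 2) <= E t.
  apply: le_Int; [by cts..|] => z _ _; apply: ler_sum => i _.
  by rewrite -addrA lerDl addr_ge0 ?sqr_ge0.
have t1 : t <= 1 by exact: le_trans l1.
apply: (le_trans Et).
have rt : r * t <= r by rewrite ler_piMr.
have G' : E t * expR (- ((m + 2) * t)) <= E 0 + r by lra.
have X : expR (- ((m + 2) * t)) * expR ((m + 2) * t) = 1 by rewrite -expRD addNr expR0.
have -> : E t = E t * expR (- ((m + 2) * t)) * expR ((m + 2) * t) by rewrite -mulrA X mulr1.
apply: (@le_trans _ _ ((E 0 + r) * expR ((m + 2) * t))).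
  by rewrite ler_pM2r ?expR_gt0.
rewrite mulrC ler_wpM2r//.
  rewrite addr_ge0// E0; apply: Int_ge0 => z _ _; apply: sumr_ge0 => i _; exact: sqr_ge0.
by rewrite ler_expR ler_piMr// addr_ge0.
Qed.

End Energy.

(** * Waves built from jets, and comparison of two waves *)

Section Jets.
Context (R : realType).
Implicit Types (x t : R) (p q : 'I_2 -> 'I_2 -> R -> R) (c e : nat -> 'I_2 -> R -> R) (k n K : nat).

Definition mon n t : R := t ^+ n / n`!%:R.

Lemma continuous_mon n : continuous (mon n).
Proof. by rewrite /mon; cts. Qed.

Lemma Der_mon n t : Der (mon n.+1) t (mon n t).
Proof.
rewrite /mon; der; rewrite /= mulr0 addr0 mulr1 factS natrM.
by field; rewrite nat1r !pnatr_eq0 -lt0n fact_gt0.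
Qed.

Lemma mon0 n : mon n 0 = (n == 0)%:R.
Proof. by rewrite /mon expr0n; case: n => [|n] /=; rewrite ?fact0 ?divr1// mul0r. Qed.

Lemma mon_ge0 n t : 0 <= t -> 0 <= mon n t.
Proof. by move=> t0; rewrite divr_ge0 ?exprn_ge0. Qed.

Lemma mon_le n t : 0 <= t -> t <= 1 -> mon n t * n`!%:R <= 1.
Proof.
move=> t0 t1; rewrite /mon divfK ?exprn_ile1//.

Qed.

(** Even and odd normalised powers. [mone'] and [mone''] are the first two derivatives of [mone] and
    [mono] is its primitive; the index shifts by one, the term k = 0 being killed. *)
Definition mone k := mon k.*2.
Definition mono k := mon k.*2.+1.
Definition mone' k : R -> R := if k is j.+1 then mono j else fun=> 0.
Definition mone'' k : R -> R := if k is j.+1 then mone j else fun=> 0.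

Lemma continuous_mones : [/\ forall k, continuous (mone k), forall k, continuous (mono k),
  forall k, continuous (mone' k) & forall k, continuous (mone'' k)].
Proof.
by split=> [k|k|[|k]|[|k]]; try exact: continuous_mon; exact: continuous_cstf.
Qed.

Lemma Der_mones k t : [/\ Der (mono k) t (mone k t), Der (mone k) t (mone' k t) &
  Der (mone' k) t (mone'' k t)].
Proof.
split; first exact: Der_mon.
- case: k => [|k]; last exact: Der_mon.
  rewrite /mone /=.
  have -> : mon 0 = fun=> 1 by apply/funext => s; rewrite /mon expr0 fact0 divr1.
  exact: Der_cst.
- case: k => [|k]; [exact: Der_cst|exact: Der_mon].
Qed.

Definition jet p K c (cx : nat -> 'I_2 -> R -> R) :=
  [/\ forall k i, continuous (c k i), forall k i, continuous (cx k i),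
    forall k i x, (k <= K)%N -> 0 < x -> x < 1 ->
      Der (c k i) x (cx k i x) /\
      Der (cx k i) x (\sum_j p i j x * c k j x + c k.+1 i x) &
    forall k i, cx k i 0 = 0].

(** With [mone] this is the truncated wave, with [mono] its primitive in time vanishing at t = 0. *)
Definition ser (m : nat -> R -> R) K c i x t := \sum_(k < K.+1) m k t * c k i x.

Lemma continuous_ser m K c i : (forall k, continuous (m k)) -> (forall k i, continuous (c k i)) ->
  continuous (fun p : R * R => ser m K c i p.1 p.2).
Proof. by move=> cm cc; rewrite /ser; cts. Qed.

(** Two time derivatives lower the index by one, and this matches the [c k.+1] produced by the jet
    relation. Only the last term is unmatched: it is the defect of the truncated wave. *)
Lemma ser_shift (m : nat -> R -> R) (m' : nat -> R -> R) K c i x t :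
  (forall k, m' k.+1 = m k) -> m' 0 = (fun=> 0) ->
  ser m' K c i x t = ser m K (fun k => c k.+1) i x t - m K t * c K.+1 i x.
Proof.
move=> mS m0; rewrite /ser big_ord_recl m0 mul0r add0r [in RHS]big_ord_recr/= addrK.
by apply: eq_bigr => k _; rewrite /bump/= add1n mS.
Qed.

Lemma ser_Der_t (m m' : nat -> R -> R) K c i x t : (forall k t, Der (m k) t (m' k t)) ->
  Der (ser m K c i x) t (ser m' K c i x t).
Proof.
move=> dm; rewrite /ser.
have D k : Der (m k) t (m' k t) by exact: dm.
by der; apply: eq_bigr => k _; rewrite mulr0 addr0.
Qed.

Lemma ser_Der_x (m : nat -> R -> R) K c (c' : nat -> 'I_2 -> R -> R) i x t :
  (forall k, (k <= K)%N -> Der (c k i) x (c' k i x)) ->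
  Der (ser m K c i ^~ t) x (ser m K c' i x t).
Proof.
move=> dc; rewrite /ser.
have D (k : 'I_K.+1) : Der (c k i) x (c' k i x) by apply: dc; rewrite -ltnS.
by der; apply: eq_bigr => k _; rewrite mul0r add0r.
Qed.

Lemma ser_mul (m : nat -> R -> R) p K c i x t :
  ser m K (fun k i x => \sum_j p i j x * c k j x) i x t = \sum_j p i j x * ser m K c j x t.
Proof.
rewrite /ser; under eq_bigr do rewrite mulr_sumr.
rewrite exchange_big/=; apply: eq_bigr => j _; rewrite mulr_sumr.
by apply: eq_bigr => k _; ring.
Qed.

Lemma serD (m : nat -> R -> R) K c e i x t :
  ser m K (fun k i x => c k i x + e k i x) i x t = ser m K c i x t + ser m K e i x t.
Proof. by rewrite /ser -big_split/=; apply: eq_bigr => k _; rewrite mulrDr. Qed.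

Lemma serB (m : nat -> R -> R) K c e i x t :
  ser m K (fun k i x => c k i x - e k i x) i x t = ser m K c i x t - ser m K e i x t.
Proof. by rewrite /ser -sumrB; apply: eq_bigr => k _; rewrite mulrBr. Qed.

Lemma ser0 (m : nat -> R -> R) K c i x t : (forall k, (k <= K)%N -> c k i x = 0) ->
  ser m K c i x t = 0.
Proof. by move=> c0; rewrite /ser big1// => k _; rewrite c0 ?mulr0// -ltnS. Qed.

Lemma ser_t0 (m : nat -> R -> R) K c i x : (forall k, m k 0 = 0) -> ser m K c i x 0 = 0.
Proof. by move=> m0; rewrite /ser big1// => k _; rewrite m0 mul0r. Qed.

Lemma mones0 k : [/\ mone k 0 = (k == 0)%:R, mono k 0 = 0 & mone' k 0 = 0].
Proof.
split; first by rewrite /mone mon0 double_eq0.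
- by rewrite /mono mon0.
- by case: k => // k; rewrite /= /mono mon0.
Qed.

Lemma ser_mone0 K c i x : ser mone K c i x 0 = c 0 i x.
Proof.
rewrite /ser big_ord_recl/= big1 ?addr0 => [|k _].
  by have [-> _ _] := mones0 0; rewrite mul1r.
by have [-> _ _] := mones0 (bump 0 k); rewrite mul0r.
Qed.

(** The Frobenius norm of a 2 x 2 matrix with entries bounded by [b] is at most 2 b. *)
Lemma sum_sq_mulmx (m : 'I_2 -> 'I_2 -> R) (v : 'I_2 -> R) (b : R) :
  (forall i j, `|m i j| <= b) ->
  \sum_i (\sum_j m i j * v j) ^+ 2 <= 4 * b ^+ 2 * \sum_j v j ^+ 2.
Proof.
move=> mb.
have mb2 i j : m i j ^+ 2 <= b ^+ 2.
  have b0 : 0 <= b := le_trans (normr_ge0 _) (mb i j).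
  by rewrite -[m i j ^+ 2]real_normK ?num_real// lerXn2r ?nnegrE.
apply: (@le_trans _ _ (\sum_(i < 2) 2 * b ^+ 2 * \sum_j v j ^+ 2)).
  apply: ler_sum => i _; rewrite !big_ord_recl !big_ord0 !addr0.
  set a := m i _; set a' := m i _; set x := v _; set y := v _.
  have A : a ^+ 2 <= b ^+ 2 by exact: mb2.
  have A' : a' ^+ 2 <= b ^+ 2 by exact: mb2.
  have H1 : 0 <= (b ^+ 2 - a ^+ 2) * x ^+ 2 by rewrite mulr_ge0 ?sqr_ge0 ?subr_ge0.
  have H2 : 0 <= (b ^+ 2 - a' ^+ 2) * y ^+ 2 by rewrite mulr_ge0 ?sqr_ge0 ?subr_ge0.
  have := sqr_ge0 (a * x - a' * y).
  have -> : (a * x - a' * y) ^+ 2 = a ^+ 2 * x ^+ 2 + a' ^+ 2 * y ^+ 2 - 2 * (a * x) * (a' * y) by ring.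
  have -> : (a * x + a' * y) ^+ 2 = a ^+ 2 * x ^+ 2 + a' ^+ 2 * y ^+ 2 + 2 * (a * x) * (a' * y) by ring.
  move: H1 H2; rewrite !mulrBl !mulrDr; lra.
rewrite sumr_const card_ord; set S := \sum_j _.
by have -> : 2 * b ^+ 2 * S *+ 2 = 4 * b ^+ 2 * S by ring.
Qed.


Lemma absorb_half (J a u v X Y : R) : J <= a + u + v -> a <= 1 / 2 * J ->
  u <= 48 * X -> v <= 24 * Y -> J <= 96 * X + 48 * Y.
Proof. lra. Qed.

(** Here [20 * (b + 1)] is the exponent of the weight in [jet_comparison]; with the factor 16 /
    lam^4 of [II_d2] it brings the zeroth-order term below one half. *)
Lemma weight_large (b : R) : 0 <= b -> 12 * b ^+ 2 * 16 <= 1 / 2 * (20 * (b + 1)) ^+ 4.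
Proof.
move=> b0.
have b1 : b ^+ 2 <= (b + 1) ^+ 2 by rewrite lerXn2r ?nnegrE ?addr_ge0// lerDl.
have b2 : 1 <= (b + 1) ^+ 2 by rewrite exprn_ege1// lerDr.
have -> : (20 * (b + 1)) ^+ 4 = 400 * (400 * ((b + 1) ^+ 2 * (b + 1) ^+ 2)) by ring.
have : (b + 1) ^+ 2 * 1 <= (b + 1) ^+ 2 * (b + 1) ^+ 2 by rewrite ler_wpM2l ?sqr_ge0.
rewrite mulr1; move: b1 b2; set Z := (b + 1) ^+ 2; set Y := Z * Z; set W := b ^+ 2.
by clear; lra.
Qed.

Lemma sum_bound2 (A B S p r : R) : B <= 2 * r -> A <= 4 * p * S ->
  2 * A + 2 * B <= 8 * p * S + 4 * r.
Proof. lra. Qed.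

Lemma sum_bound4 (a u e c p d w r : R) : c <= 2 * r -> e <= 2 * r -> a <= 4 * p * d ->
  u <= 4 * (2 ^+ 2 * p) * w -> 3 * a + 3 * u + 6 * e + 6 * c <= 12 * p * d + 48 * p * w + 24 * r.
Proof. lra. Qed.

Section WaveComparison.
Variables (p q : 'I_2 -> 'I_2 -> R -> R) (K : nat) (c cx e ex : nat -> 'I_2 -> R -> R) (l b rho : R).
Hypotheses (cp : forall i j, continuous (p i j)) (cq : forall i j, continuous (q i j)).
Hypotheses (jc : jet p K c cx) (je : jet q K e ex).
Hypotheses (l0 : 0 < l) (l1 : l < 1).
Hypothesis pb : forall i j x, `|p i j x| <= b.
Hypothesis qb : forall i j x, `|q i j x| <= b.
Hypothesis ce0 : forall k i, (k <= K)%N -> c k i 0 = e k i 0.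
Hypothesis crho : forall i x, 0 <= x -> x <= 1 -> `|c K.+1 i x| <= (K.*2)`!%:R * rho.
Hypothesis erho : forall i x, 0 <= x -> x <= 1 -> `|e K.+1 i x| <= (K.*2)`!%:R * rho.

Let b0 : 0 <= b. Proof. exact: le_trans (normr_ge0 _) (pb ord0 ord0 0). Qed.

Let rho0 : 0 <= rho.
Proof.
have := le_trans (normr_ge0 _) (crho ord0 (lexx 0) ler01).
by rewrite pmulr_rge0// ltr0n fact_gt0.
Qed.

(** The factor (2K)! granted to [c K.+1] and [e K.+1] is the one that t^(2K) / (2K)! removes, so the
    defect is of size [rho]. *)
Lemma mone_rho (f : 'I_2 -> R) x t : (forall i, `|f i| <= (K.*2)`!%:R * rho) ->
  0 <= t -> t <= 1 -> \sum_i (mone K t * f i) ^+ 2 <= 2 * rho ^+ 2 /\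
  \sum_i (mono K t * f i) ^+ 2 <= 2 * rho ^+ 2.
Proof.
move=> fr t0 t1.
have H (m : R) : 0 <= m -> m * (K.*2)`!%:R <= 1 -> \sum_i (m * f i) ^+ 2 <= 2 * rho ^+ 2.
  move=> m0 mK.
  apply: (@le_trans _ _ (\sum_(i < 2) rho ^+ 2)); last by rewrite sumr_const card_ord mulr_natl.
  apply: ler_sum => i _.
  rewrite -[(m * f i) ^+ 2]real_normK ?num_real// lerXn2r ?nnegrE//.
  rewrite normrM (ger0_norm m0); apply: (le_trans (ler_wpM2l m0 (fr i))).
  by rewrite mulrA ler_piMl.
split; apply: H; rewrite ?mon_ge0 ?mon_le//.
apply: le_trans (mon_le K.*2.+1 t0 t1); rewrite ler_wpM2l ?mon_ge0// ler_nat factS.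
by rewrite leq_pmull.
Qed.

Let U := ser mone K c.

(** The energy estimate is applied to the time primitive of the wave, not to the wave: the primitive
    vanishes at t = 0 and has initial velocity [c 0], so that only the L^2 norm of [c 0], and none
    of its derivatives, enters the bound. *)
Lemma jet_energy t : 0 <= t -> t <= l ->
  Int 0 (l - t) (fun z => \sum_i U i z t ^+ 2) <=
  expR (8 * b ^+ 2 + 2) * (Int 0 l (fun z => \sum_i c 0 i z ^+ 2) + 4 * rho ^+ 2).
Proof.
move=> t0 tl.
have [cc ccx Dc cx0] := jc.
have [c1 c2 c3 c4] := continuous_mones.
pose cxx k i x := \sum_j p i j x * c k j x + c k.+1 i x.
have ccxx k i : continuous (cxx k i) by rewrite /cxx; cts.
have := @energy_bound R _ (ser mono K c) (ser mono K cx) U (ser mono K cxx) (ser mone K cx) (ser mone' K c)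
  l (8 * b ^+ 2) (4 * rho ^+ 2) (ltW l1).
rewrite (_ : Int 0 l (fun z => \sum_i c 0 i z ^+ 2) = Int 0 l (fun z => \sum_i U i z 0 ^+ 2)); last first.
  by apply: eq_Int => z _ _; apply: eq_bigr => i _; rewrite /U ser_mone0.
apply => //; try by move=> i; apply: continuous_ser.
- by rewrite mulr_ge0 ?sqr_ge0.
- by rewrite mulr_ge0 ?sqr_ge0.
- move=> i z s z0 zl s0 sl; split; apply: ser_Der_t => k u; by have [] := Der_mones k u.
- move=> i z s z0 zl s0 sl; have z1 : z < 1 by exact: lt_trans l1.
  by split; apply: ser_Der_x => k kK; have [] := Dc k i z kK z0 z1.
- by move=> i s s0 sl; apply: ser0.
- by move=> i z z0 zl; split; apply: ser_t0 => k; have [_ ? _] := mones0 k.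
- move=> z s z0 zl s0 sl.
  have E i : ser mone' K c i z s - ser mono K cxx i z s =
    - (\sum_j p i j z * ser mono K c j z s) + - (mono K s * c K.+1 i z).
    rewrite (ser_shift (m := mono))// /cxx serD ser_mul; ring.
  apply: (@le_trans _ _ (\sum_i (2 * (\sum_j p i j z * ser mono K c j z s) ^+ 2 + 2 * (mono K s * c K.+1 i z) ^+ 2))).
    apply: ler_sum => i _; rewrite E; set A := \sum_j _; set B := mono K s * _.
    have -> : (- A + - B) ^+ 2 = 2 * A ^+ 2 + 2 * B ^+ 2 - (A - B) ^+ 2 by ring.
    by rewrite gerBl sqr_ge0.
  rewrite big_split/= -!mulr_sumr.
  have z1 : z <= 1 by exact: le_trans zl (ltW l1).
  have s1 : s <= 1 by exact: le_trans sl (ltW l1).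
  have [_ H1] := @mone_rho (fun i => c K.+1 i z) z s (fun i => crho i z0 z1) s0 s1.
  have H2 := @sum_sq_mulmx (fun i j => p i j z) (fun j => ser mono K c j z s) b (fun i j => pb i j z).
  exact: sum_bound2 H1 H2.
Qed.

(** The exponential in front undoes the weight, 4 exp (8 b^2 + 2) comes from [jet_energy], and 96
    and 48 are the constants left by [absorb_half]. *)
Definition wave_const : R :=
  expR (20 * (b + 1)) * (96 * b ^+ 2 * (4 * expR (8 * b ^+ 2 + 2)) + 48).

(** The difference d of the two waves satisfies d_xx - d_tt = q d + (q - p) U + defects. The term q
    d is absorbed because the weight is strong, and U is the wave of [c] alone, controlled by
    [jet_energy]; hence [e] does not appear on the right. *)
Lemma jet_comparison i0 : (e 0 i0 l - c 0 i0 l) ^+ 2 <=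
  wave_const * (Int 0 l (fun z => \sum_i c 0 i z ^+ 2) + rho ^+ 2).
Proof.
have [cc ccx Dc cx0] := jc.
have [ce cex De ex0] := je.
have [c1 c2 c3 c4] := continuous_mones.
pose lam := 20 * (b + 1).
have lam0 : 0 < lam by rewrite /lam mulr_gt0// ltr_wpDl.
pose f k i x := e k i x - c k i x.
pose fx k i x := ex k i x - cx k i x.
pose fxx k i x := (\sum_j q i j x * e k j x + e k.+1 i x) - (\sum_j p i j x * c k j x + c k.+1 i x).
have cf k i : continuous (f k i) by rewrite /f; cts.
have cfx k i : continuous (fx k i) by rewrite /fx; cts.
have cfxx k i : continuous (fxx k i) by rewrite /fxx; cts.
pose d := ser mone K f.
pose w (z : R) := expR (- (lam * z)).
have w0 z : 0 <= w z by exact: expR_ge0.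
pose F i z s := ser mone K fxx i z s - ser mone'' K f i z s.
have cF j : continuous (fun p : R * R => F j p.1 p.2).
  by apply: continuousBf; apply: continuous_ser.
have cdd j : continuous (fun p : R * R => d j p.1 p.2) by apply: continuous_ser.
have cU j : continuous (fun p : R * R => U j p.1 p.2) by apply: continuous_ser.
have cw : continuous w by rewrite /w; cts.
have cwp : continuous (fun p : R * R => w p.1) by cts.
have hyp_t j z t : 0 <= z -> z <= l -> 0 < t -> t < l ->
    Der (ser mone K fx j z) t (ser mone' K fx j z t) /\ Der (ser mone' K f j z) t (ser mone'' K f j z t).
  by move=> *; split; apply: ser_Der_t => k u; have [] := Der_mones k u.
have hyp_x j z t : 0 < z -> z < l -> 0 <= t -> t <= l ->
    [/\ Der (d j ^~ t) z (ser mone K fx j z t), Der (ser mone K fx j ^~ t) z (ser mone K fxx j z t) &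
       Der (ser mone' K f j ^~ t) z (ser mone' K fx j z t)].
  move=> z0 zl _ _; have z1 : z < 1 by exact: lt_trans l1.
  by split; apply: ser_Der_x => k kK; have [? ?] := Dc k j z kK z0 z1;
    have [? ?] := De k j z kK z0 z1; apply: DerB.
have hyp_0 j t : 0 <= t -> t <= l -> [/\ d j 0 t = 0, ser mone K fx j 0 t = 0 & ser mone' K f j 0 t = 0].
  by move=> _ _; split; apply: ser0 => k kK; rewrite ?/f ?/fx ?ce0 ?cx0 ?ex0 ?subrr.
have hyp_t0 j z : 0 <= z -> z <= l -> ser mone' K f j z 0 = 0.
  by move=> _ _; apply: ser_t0 => k; have [] := mones0 k.
pose JF := II l (fun z s => w z * \sum_j F j z s ^+ 2).
have JFj j : II l (fun z s => w z * F j z s ^+ 2) <= JF.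
  apply: le_II => //; [by cts|by cts|] => z s _ _ _ _.
  rewrite ler_wpM2l// (bigD1 j)//= lerDl; apply: sumr_ge0 => *; exact: sqr_ge0.
have lw := ltW l0.
have II_sum (g : 'I_2 -> R -> R -> R) : (forall j, continuous (fun p : R * R => g j p.1 p.2)) ->
    II l (fun z s => w z * \sum_j g j z s) = \sum_j II l (fun z s => w z * g j z s).
  move=> cg; rewrite !big_ord_recl big_ord0 addr0 -IID; [|by cts..].
  apply: eq_Int => s _ _; apply: eq_Int => z _ _.
  by rewrite !big_ord_recl big_ord0 addr0 mulrDr.
have cd2 j : continuous (fun p : R * R => d j p.1 p.2 ^+ 2) by cts.
have cF2 j : continuous (fun p : R * R => F j p.1 p.2 ^+ 2) by cts.
have cU2 j : continuous (fun p : R * R => U j p.1 p.2 ^+ 2) by cts.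
have B1 : II l (fun z s => w z * \sum_j d j z s ^+ 2) <= 16 / lam ^+ 4 * JF.
  rewrite /JF !(II_sum (fun j z s => _ ^+ 2))// mulr_sumr; apply: ler_sum => j _.
  apply: (II_d2 l0 lam0 (cdd j) _ _ _ _ _ (hyp_t j) (hyp_x j) (hyp_0 j) (hyp_t0 j));
    by apply: continuous_ser.
have B2 : d i0 l 0 ^+ 2 <= l * expR (lam * l) / lam * II l (fun z s => w z * F i0 z s ^+ 2).
  apply: (sidewise_bound l0 lam0 (cdd i0) _ _ _ _ _ (hyp_t i0) (hyp_x i0) (hyp_0 i0) (hyp_t0 i0));
    by apply: continuous_ser.
have l1' := ltW l1.
have Fb z s : 0 <= z -> z <= l -> 0 <= s -> s <= l ->
    \sum_j F j z s ^+ 2 <= 12 * b ^+ 2 * \sum_j d j z s ^+ 2 + 48 * b ^+ 2 * \sum_j U j z s ^+ 2 + 24 * rho ^+ 2.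
  move=> z0 zl s0 sl.
  have z1 : z <= 1 by exact: le_trans zl _.
  have s1 : s <= 1 by exact: le_trans sl _.
  have E j : F j z s = \sum_k q j k z * d k z s + \sum_k (q j k z - p j k z) * U k z s +
      (mone K s * e K.+1 j z - mone K s * c K.+1 j z).
    have e1 : ser mone K fxx j z s = \sum_k q j k z * ser mone K e k z s + ser mone K (fun k => e k.+1) j z s -
        (\sum_k p j k z * U k z s + ser mone K (fun k => c k.+1) j z s).
      by rewrite /fxx serB !serD !ser_mul.
    have e2 : ser mone K (fun k => f k.+1) j z s = ser mone K (fun k => e k.+1) j z s - ser mone K (fun k => c k.+1) j z s.
      exact: serB.
    have e3 : f K.+1 j z = e K.+1 j z - c K.+1 j z by [].
    rewrite /F e1 (@ser_shift mone mone'')// e2 e3.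
    have -> : \sum_k q j k z * d k z s =
        \sum_k q j k z * ser mone K e k z s - \sum_k q j k z * U k z s.
      by rewrite -sumrB; apply: eq_bigr => k _; rewrite /d serB mulrBr.
    have -> : \sum_k (q j k z - p j k z) * U k z s = \sum_k q j k z * U k z s - \sum_k p j k z * U k z s.
      by rewrite -sumrB; apply: eq_bigr => k _; rewrite mulrBl.
    by ring.
  apply: (@le_trans _ _ (\sum_j (3 * (\sum_k q j k z * d k z s) ^+ 2 +
      3 * (\sum_k (q j k z - p j k z) * U k z s) ^+ 2 +
      6 * (mone K s * e K.+1 j z) ^+ 2 + 6 * (mone K s * c K.+1 j z) ^+ 2))).
    apply: ler_sum => j _; rewrite E.
    set A := \sum_k _; set B := \sum_k _; set C := mone K s * _; set D := mone K s * _.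
    have -> : 3 * A ^+ 2 + 3 * B ^+ 2 + 6 * C ^+ 2 + 6 * D ^+ 2 = (A + B + (C - D)) ^+ 2 +
      ((A - B) ^+ 2 + (A - (C - D)) ^+ 2 + (B - (C - D)) ^+ 2 + 3 * (C + D) ^+ 2) by ring.
    by rewrite lerDl !addr_ge0 ?sqr_ge0// mulr_ge0 ?sqr_ge0.
  rewrite !big_split/= -!mulr_sumr.
  have [H1 _] := @mone_rho (fun i => c K.+1 i z) z s (fun i => crho i z0 z1) s0 s1.
  have [H2 _] := @mone_rho (fun i => e K.+1 i z) z s (fun i => erho i z0 z1) s0 s1.
  have H3 := @sum_sq_mulmx (fun i j => q i j z) (fun j => d j z s) b (fun i j => qb i j z).
  have qpb i j : `|q i j z - p i j z| <= 2 * b.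
    by apply: (le_trans (ler_normB _ _)); rewrite mulr_natl mulr2n lerD.
  have H4 := @sum_sq_mulmx (fun i j => q i j z - p i j z) (fun j => U j z s) (2 * b) qpb.
  rewrite exprMn in H4.
  exact: sum_bound4 H1 H2 H3 H4.
have w1 z : 0 <= z -> w z <= 1.
  by move=> z0; rewrite /w -expR0 ler_expR oppr_le0 mulr_ge0// ltW.
set G := Int 0 l _.
have G0 : 0 <= G by apply: Int_ge0 => z _ _; apply: sumr_ge0 => *; exact: sqr_ge0.
pose E0 := expR (8 * b ^+ 2 + 2).
have E00 : 0 <= E0 by exact: expR_ge0.
pose X := E0 * (G + 4 * rho ^+ 2).
have X0 : 0 <= X by rewrite mulr_ge0// addr_ge0// mulr_ge0// sqr_ge0.
have IIc (k : R) : 0 <= k -> Int 0 l (fun=> k) <= k.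
  by move=> k0; rewrite Int_cst// subr0 ler_piMr.
have BU : II l (fun z s => w z * \sum_j U j z s ^+ 2) <= X.
  apply: (le_trans _ (IIc _ X0)); apply: le_Int => [||s s0 sl].
  - by apply: (@continuous_Int_triangle R (fun z s => w z * \sum_j U j z s ^+ 2)); cts.
  - exact: continuous_cstf.
  apply: (le_trans _ (jet_energy s0 sl)); apply: le_Int; [by cts|by cts|] => z z0 zl.
  by rewrite ler_piMl ?w1//; apply: sumr_ge0 => *; exact: sqr_ge0.
have BW : II l (fun z s => w z * 1) <= 1.
  apply: (le_trans _ (IIc _ ler01)); apply: le_Int => [||s s0 sl].
  - by apply: (@continuous_Int_triangle R (fun z s => w z * 1)); cts.
  - exact: continuous_cstf.
  apply: (@le_trans _ _ (Int 0 (l - s) (fun=> 1))).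
    by apply: le_Int; [by cts|by cts|] => z z0 zl; rewrite mulr1 w1.
  by rewrite Int_cst ?subr_ge0// mul1r subr0 lerBlDr (le_trans l1')// lerDl.
have JF1 : JF <= 12 * b ^+ 2 * II l (fun z s => w z * \sum_j d j z s ^+ 2) +
    48 * b ^+ 2 * II l (fun z s => w z * \sum_j U j z s ^+ 2) + 24 * rho ^+ 2 * II l (fun z s => w z * 1).
  rewrite -!IIZ; [|by cts..].
  rewrite -!IID; [|by cts..].
  apply: le_II; [by cts|by cts|] => z s z0 zl s0 sl.
  rewrite mulr1; apply: (le_trans (ler_wpM2l (w0 z) (Fb z s z0 zl s0 sl))).
  by rewrite le_eqVlt; apply/orP; left; apply/eqP; ring.
have JF0 : 0 <= JF.
  apply: Int_ge0 => s _ _; apply: Int_ge0 => z _ _.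
  by rewrite mulr_ge0//; apply: sumr_ge0 => *; exact: sqr_ge0.
have lam4 : 12 * b ^+ 2 * (16 / lam ^+ 4) <= 1 / 2.
  have l4 : 0 < lam ^+ 4 by rewrite exprn_gt0.
  by rewrite mulrA ler_pdivrMr// weight_large.
have b20 : 0 <= b ^+ 2 by exact: sqr_ge0.
have r20 : 0 <= rho ^+ 2 by exact: sqr_ge0.
have JF2 : JF <= 96 * b ^+ 2 * X + 48 * rho ^+ 2.
  have h1 : 12 * b ^+ 2 * II l (fun z s => w z * \sum_j d j z s ^+ 2) <= 1 / 2 * JF.
    apply: (@le_trans _ _ (12 * b ^+ 2 * (16 / lam ^+ 4 * JF))).
      by apply: ler_wpM2l B1; rewrite mulr_ge0 ?ler0n.
    by rewrite mulrA ler_wpM2r.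
  have h2 : 48 * b ^+ 2 * II l (fun z s => w z * \sum_j U j z s ^+ 2) <= 48 * (b ^+ 2 * X).
    by rewrite mulrA; apply: ler_wpM2l => //; exact: mulr_ge0.
  have h3 : 24 * rho ^+ 2 * II l (fun z s => w z * 1) <= 24 * rho ^+ 2.
    by rewrite ler_piMr// mulr_ge0.
  by rewrite -mulrA; exact: absorb_half JF1 h1 h2 h3.
have -> : e 0 i0 l - c 0 i0 l = d i0 l 0 by rewrite /d ser_mone0.
apply: (le_trans B2).
apply: (@le_trans _ _ (expR lam * JF)).
  have b1 : 1 <= b + 1 by rewrite lerDr.
  have lam1 : 1 <= lam by rewrite /lam (le_trans b1)// ler_peMl ?ler1n// addr_ge0.
  have h : l * expR (lam * l) / lam <= expR lam.
    rewrite ler_pdivrMr// mulrC; apply: ler_pM; rewrite ?expR_ge0 ?ler_expR ?(le_trans l1')//.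
    by rewrite ler_piMr// ltW.
  apply: ler_pM; [| |exact: h|exact: JFj].
    by apply: divr_ge0; [exact: mulr_ge0 lw (expR_ge0 _)|exact: ltW].
  by apply: Int_ge0 => s _ _; apply: Int_ge0 => z _ _; rewrite mulr_ge0 ?sqr_ge0.
rewrite /wave_const -/lam -/E0 -mulrA ler_wpM2l ?expR_ge0//.
apply: (le_trans JF2); rewrite /X.
have h4 : 0 <= b ^+ 2 * E0 * G by rewrite !mulr_ge0.
have h5 : 0 <= b ^+ 2 * E0 * rho ^+ 2 by rewrite !mulr_ge0.
have -> : (96 * b ^+ 2 * (4 * E0) + 48) * (G + rho ^+ 2) =
  96 * b ^+ 2 * (E0 * (G + 4 * rho ^+ 2)) + 48 * rho ^+ 2 + (288 * (b ^+ 2 * E0 * G) + 48 * G) by ring.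
by rewrite lerDl; apply: addr_ge0; rewrite mulr_ge0 ?ler0n.
Qed.

End WaveComparison.
End Jets.

(** * From heat to waves *)

Section Landau.
Context (R : realType).
Implicit Types (x s t r : R) (a b k m n K : nat).

Lemma bounded_rect (f : R -> R -> R) (x0 x1 s0 s1 : R) :
  continuous (fun p : R * R => f p.1 p.2) ->
  exists2 M, 0 <= M & forall x s, x0 <= x -> x <= x1 -> s0 <= s -> s <= s1 -> `|f x s| <= M.
Proof.
move=> cf.
have cpt := compact_setX (@segment_compact R x0 x1) (@segment_compact R s0 s1).
have cc := continuous_compact (continuous_subspaceT cf) cpt.
have [M [_ HM]] := compact_bounded cc.
exists (`|M| + 1) => // x s *; apply: (HM (`|M| + 1)).
  by rewrite (le_lt_trans (ler_norm _))// ltrDl.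
by exists (x, s) => //=; rewrite !in_itv/=; split; apply/andP.
Qed.

(* [dbump k a b] is the k-th derivative of (1 - s)^a (1 + s)^b. *)
Fixpoint dbump k a b s : R := match k with
  | 0 => (1 - s) ^+ a * (1 + s) ^+ b
  | k.+1 => b%:R * dbump k a b.-1 s - a%:R * dbump k a.-1 b s
  end.

Lemma Der_dbump k a b s : Der (dbump k a b) s (dbump k.+1 a b s).
Proof.
elim: k a b => [|k IH] a b /=; first by der; ring.
have D1 := IH a b.-1; have D2 := IH a.-1 b.
by der; rewrite /= !mul0r !add0r.
Qed.

Lemma continuous_dbump k a b : continuous (dbump k a b).
Proof. by move=> s; exact: Der_continuous (Der_dbump k a b s). Qed.

(** A differentiation replaces a product of a + b factors, each at most 2 on [-1, 1], by a sum of a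
    + b products with one factor fewer. *)
Lemma dbump_bound k a b s : -1 <= s -> s <= 1 ->
  `|dbump k a b s| <= (a + b)%:R ^+ k * 2 ^+ (a + b).
Proof.
move=> s1 s2; elim: k a b => [|k IH] a b.
  rewrite /= expr0 mul1r normrM !normrX exprD.
  by apply: ler_pM; rewrite ?exprn_ge0// lerXn2r ?nnegrE// ger0_norm; lra.
rewrite /=; apply: (le_trans (ler_normB _ _)); rewrite !normrM !normr_nat.
have mono n : (n <= a + b)%N -> n%:R ^+ k * 2 ^+ n <= (a + b)%:R ^+ k * 2 ^+ (a + b) :> R.
  move=> nab; apply: ler_pM; rewrite ?exprn_ge0//.
    by rewrite lerXn2r ?nnegrE// ler_nat.
  by rewrite ler_weXn2l// ler1n.
have h1 : b%:R * `|dbump k a b.-1 s| <= b%:R * ((a + b)%:R ^+ k * 2 ^+ (a + b)).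
  by rewrite ler_wpM2l//; apply: (le_trans (IH _ _)); apply: mono; rewrite leq_add2l leq_pred.
have h2 : a%:R * `|dbump k a.-1 b s| <= a%:R * ((a + b)%:R ^+ k * 2 ^+ (a + b)).
  by rewrite ler_wpM2l//; apply: (le_trans (IH _ _)); apply: mono; rewrite leq_add2r leq_pred.
apply: (le_trans (lerD h1 h2)).
by rewrite -mulrDl -natrD addnC mulrA exprS.
Qed.

Lemma dbump_1 k a b : (k < a)%N -> dbump k a b 1 = 0.
Proof.
elim: k a b => [|k IH] a b /= ka; first by rewrite subrr expr0n eqn0Ngt ka mul0r.
rewrite (IH a b.-1) 1?ltnW// (IH a.-1 b) ?mulr0 ?subrr//.
by case: a ka.
Qed.

Lemma dbump_N1 k a b : (k < b)%N -> dbump k a b (-1) = 0.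
Proof.
elim: k a b => [|k IH] a b /= ka; first by rewrite subrr expr0n eqn0Ngt ka mulr0.
rewrite (IH a b.-1) ?(IH a.-1 b) ?mulr0 ?subrr//; first exact: ltnW.
by case: b ka.
Qed.

Variable r : R.
Hypothesis r0 : 0 < r.

Definition landau_mass m := Int (- r) r (fun s => dbump 0 m m (s / r)).

(** The integrand is at least 2^-m (1 - 2 (s/r)^2): if (s/r)^2 <= 1/2 it is at least 2^-m, otherwise
    the minorant is negative. The exponential loss does not matter against a factorial. *)
Lemma landau_mass_ge m : 2 * r / 3 / 2 ^+ m <= landau_mass m.
Proof.
have r0' := r0; have rn0 : r != 0 by rewrite gt_eqF.
have H : Int (- r) r (fun s => (2 ^+ m)^-1 * (1 - 2 * (s / r) ^+ 2)) = 2 * r / 3 / 2 ^+ m.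
  rewrite (@FTC2 R (fun s => (2 ^+ m)^-1 * (s - 2 / 3 * r * (s / r) ^+ 3))); [|lra|by cts|by cts|].
    by field; rewrite expf_neq0.
  by move=> s _ _; der; field; rewrite rn0 expf_neq0.
rewrite -H; apply: le_Int; [by cts| |].
  by rewrite /=; cts.
move=> s s1 s2 /=; rewrite -exprMn.
have -> : (1 - s / r) * (1 + s / r) = 1 - (s / r) ^+ 2 by ring.
set u := (s / r) ^+ 2.
have u0 : 0 <= u by exact: sqr_ge0.
have u1 : u <= 1.
  rewrite /u -[leRHS](expr1n _ 2) -real_normK ?num_real// lerXn2r ?nnegrE//.
  by rewrite ler_norml ler_pdivrMr// ler_pdivlMr// mulN1r mul1r s1.
have m2 : 0 < (2 ^+ m)^-1 :> R by rewrite invr_gt0 exprn_gt0.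
have [uh|uh] := leP u (1 / 2); last first.
  apply: (@le_trans _ _ 0); last by rewrite exprn_ge0// subr_ge0.
  by rewrite pmulr_rle0//; lra.
apply: (@le_trans _ _ (2 ^+ m)^-1); first by rewrite ger_pMr//; lra.
by rewrite -exprVn lerXn2r ?nnegrE ?subr_ge0//; lra.
Qed.

Lemma landau_mass_gt0 m : 0 < landau_mass m.
Proof.
apply: lt_le_trans (landau_mass_ge m).
by rewrite !divr_gt0 ?exprn_gt0// mulr_gt0.
Qed.

(** The k-th derivative of the normalised kernel times (-1)^k, so that an integration by parts in
    time raises [k] by one without a sign. *)
Definition landau m k s := (- r^-1) ^+ k * dbump k m m (s / r) / landau_mass m.

Lemma continuous_landau m k : continuous (landau m k).
Proof.
have cd := @continuous_dbump k m m.
by rewrite /landau; cts.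
Qed.

Lemma Der_landau m k s : Der (landau m k) s (- landau m k.+1 s).
Proof.
rewrite /landau.
have D0 : Der (fun s => s / r) s (1 / r + s * 0) := DerM (Der_id s) (Der_cst r^-1 s).
have D := Der_comp (f := dbump k m m) (g := fun s => s / r) (Der_dbump k m m (s / r)) D0.
by der; rewrite exprS; ring.
Qed.

Lemma landau_end m k : (k < m)%N -> landau m k r = 0 /\ landau m k (- r) = 0.
Proof.
move=> km; have rn0 : r != 0 by rewrite gt_eqF.
by rewrite /landau mulNr divff// dbump_1// dbump_N1// mulr0 mul0r.
Qed.

Lemma landau_ge0 m s : - r <= s -> s <= r -> 0 <= landau m 0 s.
Proof.
move=> s1 s2; rewrite /landau /= expr0 mul1r divr_ge0 ?(ltW (landau_mass_gt0 _))//.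
rewrite -exprMn exprn_ge0// mulr_ge0//.
  by rewrite subr_ge0 ler_pdivrMr// mul1r.
by rewrite -lerBlDl sub0r ler_pdivlMr// mulN1r.
Qed.

Lemma landau_int m : Int (- r) r (landau m 0) = 1.
Proof.
rewrite /landau /=.
have -> : Int (- r) r (fun s => (- r^-1) ^+ 0 * ((1 - s / r) ^+ m * (1 + s / r) ^+ m) / landau_mass m)
  = Int (- r) r (fun s => (landau_mass m)^-1 * dbump 0 m m (s / r)).
  by apply: eq_Int => s _ _; rewrite expr0 mul1r mulrC.
rewrite IntZ; last by rewrite /=; cts.
by rewrite -/(landau_mass m) mulVf// gt_eqF// landau_mass_gt0.
Qed.

(* Integrate the derivative of s (1 - (s/r)^2)^(m+1). *)
Lemma landau_moment m : Int (- r) r (fun s => s ^+ 2 * landau m 0 s) = r ^+ 2 / (2 * m + 3)%:R.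
Proof.
have r0' := r0; have rn0 : r != 0 by rewrite gt_eqF.
have cl := @continuous_landau m 0.
have Mn0 : landau_mass m != 0 by rewrite gt_eqF// landau_mass_gt0.
set X := Int _ _ _.
have H : Int (- r) r (fun s => landau m 0 s - (2 * m + 3)%:R / r ^+ 2 * (s ^+ 2 * landau m 0 s)) = 0.
  have -> : 0 = r * (1 - (r / r) ^+ 2) ^+ m.+1 / landau_mass m - (- r) * (1 - (- r / r) ^+ 2) ^+ m.+1 / landau_mass m.
    by rewrite !mulNr divff// sqrrN expr1n subrr expr0n/= !mulr0 !mul0r !oppr0 addr0.
  rewrite -(@FTC2 R (fun s => s * (1 - (s / r) ^+ 2) ^+ m.+1 / landau_mass m)
     (fun s => landau m 0 s - (2 * m + 3)%:R / r ^+ 2 * (s ^+ 2 * landau m 0 s))); [by []|lra|by cts|by cts|].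
  move=> s _ _; der; rewrite /landau /= expr0 mul1r -exprMn.
  have -> : (1 - s / r) * (1 + s / r) = 1 - (s / r) ^+ 2 by ring.
  rewrite exprS natrD natrM -[m.+1%:R]natr1; set Y := (1 - _) ^+ m.
  by field; rewrite Mn0 rn0.
rewrite IntB// in H; last by cts.
rewrite IntZ// -/X in H; last by cts.
rewrite landau_int in H.
have n0 : (2 * m + 3)%:R != 0 :> R by rewrite pnatr_eq0 addn_eq0 andbF.
have : (2 * m + 3)%:R / r ^+ 2 * X = 1 by lra.
move=> E.
have Nr : (2 * m + 3)%:R / r ^+ 2 != 0 by rewrite mulf_neq0// invr_eq0 expf_neq0.
by rewrite -[X](mulKf Nr) E mulr1 invf_div.
Qed.

End Landau.

(** * Moments of a heat solution *)

Section HeatToWave.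
Context (R : realType).
Implicit Types (x s t r l b M : R) (p q : 'I_2 -> 'I_2 -> R -> R) (i j : 'I_2) (k m n K : nat).

(** Restricted to what the moments see: the times |s| <= r and the Neumann condition at x = 0. *)
Definition heat_on p r (y yt yx yxx : 'I_2 -> R -> R -> R) : Prop :=
  [/\ [/\ forall i, continuous (fun p : R * R => y i p.1 p.2),
         forall i, continuous (fun p : R * R => yt i p.1 p.2),
         forall i, continuous (fun p : R * R => yx i p.1 p.2) &
         forall i, continuous (fun p : R * R => yxx i p.1 p.2)],
    forall i x s, 0 <= x -> x <= 1 -> - r < s -> s < r -> Der (y i x) s (yt i x s),
    forall i x s, 0 < x -> x < 1 -> - r <= s -> s <= r ->
      [/\ Der (y i ^~ s) x (yx i x s), Der (yx i ^~ s) x (yxx i x s) &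
        yt i x s = yxx i x s - \sum_j p i j x * y j x s] &
    forall i s, - r <= s -> s <= r -> yx i 0 s = 0].

(* If y solves the heat equation, the k-th moment c_k satisfies c_k'' = p c_k + c_(k+1). *)
Definition moment r K (y : 'I_2 -> R -> R -> R) k i x :=
  Int (- r) r (fun s => landau r K.+2 k s * y i x s).

Lemma moment_jet p r K y yt yx yxx : 0 < r -> (forall i j, continuous (p i j)) ->
  heat_on p r y yt yx yxx -> jet p K (moment r K y) (moment r K yx).
Proof.
move=> r0 cp [[cy cyt cyx cyxx] Dt Dx yx0].
have cl k := @continuous_landau R r K.+2 k.
have cmom (u : 'I_2 -> R -> R -> R) k i : (forall i, continuous (fun p : R * R => u i p.1 p.2)) ->
    continuous (moment r K u k i).
  move=> cu; apply: (@continuous_Int_slice R (fun s x => landau r K.+2 k s * u i x s)); cts.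
split; [by move=> *; exact: cmom|by move=> *; exact: cmom| |].
- move=> k i x kK x0 x1.
  have D (u ux : 'I_2 -> R -> R -> R) : (forall i, continuous (fun p : R * R => u i p.1 p.2)) ->
      (forall i, continuous (fun p : R * R => ux i p.1 p.2)) ->
      (forall t s, 0 < t -> t < 1 -> - r <= s -> s <= r -> Der (u i ^~ s) t (ux i t s)) ->
      Der (moment r K u k i) x (moment r K ux k i x).
    move=> cu cux du.
    apply: (@Der_Int R (fun s x => landau r K.+2 k s * u i x s)
      (fun s x => landau r K.+2 k s * ux i x s) (- r) r 0 1); [by cts|by cts|exact: x0|exact: x1|].
    move=> s t s0 s1 t0 t1; have d := du t s t0 t1 s0 s1.
    by der; rewrite mul0r add0r.
  split; first by apply: D => // t s t0 t1 s0 s1; have [] := Dx i t s t0 t1 s0 s1.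
  have -> : \sum_j p i j x * moment r K y k j x + moment r K y k.+1 i x = moment r K yxx k i x.
    rewrite /moment.
    have cyx' j : continuous (fun s => y j x s) by cts.
    have cytx' j : continuous (fun s => yt j x s) by cts.
    have cyxx' j : continuous (fun s => yxx j x s) by cts.
    have H : Int (- r) r (fun s => - landau r K.+2 k.+1 s * y i x s + landau r K.+2 k s * yt i x s) = 0.
      (* The exponent [K.+2] exceeds the order [k], so the integration by parts has no boundary
         term. *)
      have [e1 e2] := @landau_end R r r0 K.+2 k (leqW kK).
      rewrite (@FTC2 R (fun s => landau r K.+2 k s * y i x s)); [|lra|by cts|by cts|].
        by rewrite e1 e2 !mul0r subrr.
      move=> s s0 s1; have D1 := Dt i x s (ltW x0) (ltW x1) s0 s1.
      by have D2 := @Der_landau R r K.+2 k s; der.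
    rewrite !big_ord_recl big_ord0 addr0 -[RHS]subr0 -[X in _ = _ - X]H.
    rewrite -!IntZ; [|by cts..].
    rewrite -IntB; [|by cts..].
    rewrite -!IntD; [|by cts..].
    apply: eq_Int => s s0 s1; have [_ _ ->] := Dx i x s x0 x1 s0 s1.
    by rewrite !big_ord_recl big_ord0; ring.
  by apply: D => // t s t0 t1 s0 s1; have [] := Dx i t s t0 t1 s0 s1.
- move=> k i; rewrite /moment.
  transitivity (Int (- r) r (fun=> 0 : R)); last by rewrite Int_cst ?mul0r//; lra.
  by apply: eq_Int => s s0 s1; rewrite yx0 ?mulr0.
Qed.

(** (2K+4)^(K+1) 4^(K+2) / r^(K+1) bounds the derivative of order K + 1 of the kernel before
    normalisation, and 3 * 2^(K+2) is the length 2 r divided by the lower bound of [landau_mass_ge].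
    The denominator fits the hypothesis on [c K.+1] in [jet_comparison]. *)
Definition wave_err M r K : R :=
  3 * M * ((2 * K + 4)%:R ^+ K.+1 * 8 ^+ K.+2 / r ^+ K.+1) / (K.*2)`!%:R.

Lemma moment_bound M r K (y : 'I_2 -> R -> R -> R) i x : 0 < r ->
  (forall i, continuous (fun p : R * R => y i p.1 p.2)) ->
  (forall s, - r <= s -> s <= r -> `|y i x s| <= M) ->
  `|moment r K y K.+1 i x| <= (K.*2)`!%:R * wave_err M r K.
Proof.
move=> r0 cy yM; have rn0 : r != 0 by rewrite gt_eqF.
have f0 : (K.*2)`!%:R != 0 :> R by rewrite pnatr_eq0 -lt0n fact_gt0.
rewrite /wave_err mulrC divfK//.
have cl := @continuous_landau R r K.+2 K.+1.
have cyx' : continuous (fun s => y i x s) by cts.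
have rr : - r <= r by lra.
apply: (le_trans (ler_norm_Int _ _ _)); first by cts.
have mg := @landau_mass_gt0 R r r0 K.+2.
pose B := (2 * K + 4)%:R ^+ K.+1 * 4 ^+ K.+2 / r ^+ K.+1 / landau_mass r K.+2.
have LB s : - r <= s -> s <= r -> `|landau r K.+2 K.+1 s| <= B.
  move=> s0 s1; rewrite /landau /B !normrM normfV (gtr0_norm mg) ler_pM2r ?invr_gt0//.
  rewrite normrX normrN normfV (gtr0_norm r0) exprVn mulrC ler_pM2r ?invr_gt0 ?exprn_gt0//.
  apply: (le_trans (dbump_bound _ _ _ _ _)).
  - by rewrite ler_pdivlMr// mulN1r.
  - by rewrite ler_pdivrMr// mul1r.
  - have -> : (K.+2 + K.+2 = 2 * K + 4)%N by lia.
    have -> : (2 ^+ (2 * K + 4) : R) = 4 ^+ K.+2.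
      have e4 : (2 ^+ 2 : R) = 4 by ring.
      have -> : (2 * K + 4 = 2 * K.+2)%N by lia.
      by rewrite exprM e4.
    by [].
have M0 : 0 <= M.
  by apply: (le_trans (normr_ge0 (y i x 0))); apply: yM; rewrite ?oppr_le0 ltW.
pose B1 := (2 * K + 4)%:R ^+ K.+1 * 4 ^+ K.+2 / r ^+ K.+1 : R.
have B10 : 0 <= B1.
  by apply: divr_ge0; [apply: mulr_ge0; exact: exprn_ge0|apply: exprn_ge0; exact: ltW].
have B0 : 0 <= B by exact: divr_ge0 B10 (ltW mg).
apply: (@le_trans _ _ (Int (- r) r (fun=> B * M))).
  apply: le_Int; [by cts|by cts|] => s s0 s1; rewrite normrM.
  by apply: ler_pM => //; [exact: LB|exact: yM].
rewrite Int_cst//.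
have ma : 0 < 2 * r / 3 / 2 ^+ K.+2 :> R.
  by apply: divr_gt0; [apply: divr_gt0 => //; exact: mulr_gt0|exact: exprn_gt0].
have mi : (landau_mass r K.+2)^-1 <= (2 * r / 3 / 2 ^+ K.+2)^-1.
  by rewrite lef_pV2 ?posrE//; exact: landau_mass_ge.
apply: (@le_trans _ _ (B1 * (2 * r / 3 / 2 ^+ K.+2)^-1 * M * (r - - r))).
  rewrite ler_wpM2r//; first by lra.
  by rewrite ler_wpM2r// /B ler_wpM2l.
have e8 : (4 * 2 : R) = 8 by ring.
rewrite -e8 exprMn.
rewrite le_eqVlt; apply/orP; left; apply/eqP; rewrite /B1; field.
by rewrite rn0 !expf_neq0.
Qed.

Lemma fact_ge_exp n m : (n`! * n ^ m <= (n + m)`!)%N.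
Proof.
elim: m => [|m IH]; first by rewrite expn0 muln1 addn0.
by rewrite addnS factS expnS mulnCA leq_mul// leqW// leq_addr.
Qed.

(** Since (2K)! >= K! K^K and (2K+4)^(K+1) <= 6^(K+1) K^K 2^K, the powers K^K cancel, and 1 / K!
    beats the remaining geometric factor. *)
Lemma wave_err_cvg M r e : 0 <= M -> 0 < r -> 0 < e -> \forall K \near \oo, wave_err M r K <= e.
Proof.
move=> M0 r0 e0; have rn0 : r != 0 by rewrite gt_eqF.
pose A := 3 * M * (6 * (8 * 8) / r).
have A0 : 0 <= A.
  by apply: mulr_ge0; [exact: mulr_ge0|apply: divr_ge0 => //; exact: ltW].
pose B := 6 * (8 * 2) / r.
have B0 : 0 <= B by apply: divr_ge0 => //; exact: ltW.
have eA : 0 < e / (A + 1) by rewrite divr_gt0// ltr_wpDl.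
have /cvgrPdist_le /(_ _ eA) H := @cvg_exp_coeff R B.
have K1 : \forall K \near \oo, (0 < K)%N by exists 1%N.
near=> K.
have K0 : (0 < K)%N by near: K.
have HK : `|0 - exp_coeff B K| <= e / (A + 1) by near: K.
have kf : 0 < K`!%:R :> R by rewrite ltr0n fact_gt0.
apply: (@le_trans _ _ (A * exp_coeff B K)); last first.
  rewrite sub0r normrN ger0_norm in HK; last exact: exp_coeff_ge0.
  apply: (le_trans (ler_wpM2l A0 HK)).
  by rewrite mulrA ler_pdivrMr ?ltr_wpDl// [A * e]mulrC ler_pM2l// lerDl.
rewrite /wave_err /exp_coeff /=.
have KK : 0 < K%:R ^+ K :> R by rewrite exprn_gt0// ltr0n.
have f1 : (K.*2)`!%:R^-1 <= (K`!%:R * K%:R ^+ K)^-1 :> R.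
  rewrite lef_pV2 ?posrE ?ltr0n ?fact_gt0// ?mulr_gt0//.
  by rewrite -natrX -natrM ler_nat -addnn fact_ge_exp.
have f2 : (2 * K + 4)%:R ^+ K.+1 <= 6 ^+ K.+1 * (K%:R ^+ K * 2 ^+ K) :> R.
  apply: (@le_trans _ _ ((6 * K%:R) ^+ K.+1)).
    rewrite lerXn2r ?nnegrE// ?mulr_ge0//.
    by rewrite -natrM ler_nat; clear -K0; lia.
  rewrite exprMn ler_pM2l ?exprn_gt0// exprSr ler_pM2l//.
  by rewrite -natrX ler_nat ltnW// ltn_expl.
have c0 : 0 <= 3 * M * (8 ^+ K.+2 / r ^+ K.+1).
  by apply: mulr_ge0; [exact: mulr_ge0|apply: divr_ge0; apply: exprn_ge0 => //; exact: ltW].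
have := ler_pM _ _ f2 f1; rewrite (exprn_ge0 _ (ler0n _ _)) invr_ge0 ler0n => /(_ isT isT) f3.
have := ler_wpM2l c0 f3.
set lhs := (X in X <= _ -> _); set rhs := (X in _ <= X -> _).
move=> h; apply: (@le_trans _ _ lhs).
  by rewrite /lhs le_eqVlt; apply/orP; left; apply/eqP; ring.
apply: (le_trans h); rewrite /rhs le_eqVlt; apply/orP; left; apply/eqP.
rewrite /A /B !expr_div_n !exprS.
rewrite !exprMn.
field.
by rewrite (gt_eqF kf) (gt_eqF KK) rn0 expf_neq0.
Unshelve. all: by end_near.
Qed.

End HeatToWave.

(** * Comparison of two heat solutions with equal traces at x = 0 *)

Section LeftComparison.
Context (R : realType).
Implicit Types (x s t r l b M : R) (p q : 'I_2 -> 'I_2 -> R -> R) (i j : 'I_2) (k m n K : nat).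

(* Korovkin's argument: |y(s) - y(0)| <= e + C s^2, and the second moment of the Landau kernel tends to 0. *)
Lemma moment0_cvg r (y : 'I_2 -> R -> R -> R) e : 0 < r -> 0 < e ->
  (forall i, continuous (fun p : R * R => y i p.1 p.2)) ->
  \forall K \near \oo, forall i x, 0 <= x -> x <= 1 -> `|moment r K y 0 i x - y i x 0| <= e.
Proof.
move=> r0 e0 cy.
have e2 : 0 < e / 2 by rewrite divr_gt0.
have main i : \forall K \near \oo, forall x, 0 <= x -> x <= 1 -> `|moment r K y 0 i x - y i x 0| <= e.
  have [M M0 HM] := @bounded_rect R (y i) 0 1 (- r) r (cy i).
  have [d /= d0 Hd] := (nbhs_ballP _ _).1 (@tube R (y i) 0 1 0 (e / 2) (cy i) e2).
  have rr : 0 <= r by exact: ltW.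
  have cM : 0 <= 2 * M / d ^+ 2 by apply: divr_ge0; [exact: mulr_ge0|exact: sqr_ge0].
  have kor x s : 0 <= x -> x <= 1 -> - r <= s -> s <= r ->
      `|y i x s - y i x 0| <= e / 2 + 2 * M / d ^+ 2 * s ^+ 2.
    move=> x0 x1 s0 s1; have [sd|ds] := ltP `|s| d.
      apply: (@le_trans _ _ (e / 2)); last by rewrite lerDl mulr_ge0 ?sqr_ge0.
      by apply/ltW/Hd => //; rewrite /ball/= sub0r normrN.
    apply: (@le_trans _ _ (2 * M)).
      apply: (le_trans (ler_normB _ _)); have := HM x s x0 x1 s0 s1; have := HM x 0 x0 x1.
      by rewrite oppr_le0 => /(_ rr rr); lra.
    apply: (@le_trans _ _ (2 * M / d ^+ 2 * s ^+ 2)); last by rewrite lerDr ltW.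
    rewrite mulrAC ler_pdivlMr ?exprn_gt0// ler_wpM2l ?mulr_ge0//.
    by rewrite -[s ^+ 2]real_normK ?num_real// lerXn2r ?nnegrE// ltW.
  pose A := 2 * M / d ^+ 2 * r ^+ 2.
  have A0 : 0 <= A by rewrite /A mulr_ge0 ?sqr_ge0.
  have [N HN] : exists N : nat, A / (e / 2) < N%:R.
    exists (Num.truncn (A / (e / 2))).+1; exact: truncnS_gt.
  have KN : \forall K \near \oo, (N <= K)%N by exists N.
  near=> K; move=> x x0 x1.
  have NK : (N <= K)%N by near: K.
  have cl := @continuous_landau R r K.+2 0.
  have cyx : continuous (fun s => y i x s) by cts.
  rewrite /moment -[y i x 0]mulr1 -(@landau_int R r r0 K.+2) -IntZ//.
  rewrite -IntB; [|by cts..].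
  apply: (le_trans (ler_norm_Int _ _ _)); first by cts.
  apply: (@le_trans _ _ (Int (- r) r (fun s => e / 2 * landau r K.+2 0 s + 2 * M / d ^+ 2 * (s ^+ 2 * landau r K.+2 0 s)))).
    apply: le_Int; [by cts|by cts|] => s s0 s1.
    have L0 := @landau_ge0 R r r0 K.+2 s s0 s1.
    have -> : landau r K.+2 0 s * y i x s - y i x 0 * landau r K.+2 0 s = (y i x s - y i x 0) * landau r K.+2 0 s by ring.
    have -> : e / 2 * landau r K.+2 0 s + 2 * M / d ^+ 2 * (s ^+ 2 * landau r K.+2 0 s) =
      (e / 2 + 2 * M / d ^+ 2 * s ^+ 2) * landau r K.+2 0 s by ring.
    by rewrite normrM (ger0_norm L0) ler_wpM2r// kor.
  rewrite IntD; [|by cts..].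
  rewrite !IntZ; [|by cts..].
  rewrite landau_int// landau_moment// mulr1.
  have : A / (2 * K.+2 + 3)%:R <= e / 2.
    have n0 : 0 < (2 * K.+2 + 3)%:R :> R by rewrite ltr0n addn_gt0 orbT.
    rewrite ler_pdivrMr// mulrC -ler_pdivrMr//; apply: (le_trans (ltW HN)).
    by rewrite ler_nat; clear -NK; lia.
  by rewrite /A -mulrA; lra.
near=> K; move=> i.
have i01 : i = ord0 \/ i = ord_max.
  by case: i => -[|[|//]] h; [left|right]; apply: val_inj.
have H0 : forall x, 0 <= x -> x <= 1 -> `|moment r K y 0 ord0 x - y ord0 x 0| <= e.
  by near: K; exact: main.
have H1 : forall x, 0 <= x -> x <= 1 -> `|moment r K y 0 ord_max x - y ord_max x 0| <= e.
  by near: K; exact: main.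
by case: i01 => ->; [exact: H0|exact: H1].
Unshelve. all: by end_near.
Qed.

(** The limit of [jet_comparison] as K grows with [r] fixed: the order 0 moments tend to the
    solutions at time 0 and [wave_err] tends to 0. The constant does not depend on [r], nor on a
    bound of the solutions. *)
Lemma left_comparison p q r l b (y yt yx yxx z zt zx zxx : 'I_2 -> R -> R -> R) i : 0 < r ->
  0 < l -> l < 1 -> (forall i j, continuous (p i j)) -> (forall i j, continuous (q i j)) ->
  (forall i j x, `|p i j x| <= b) -> (forall i j x, `|q i j x| <= b) ->
  heat_on p r y yt yx yxx -> heat_on q r z zt zx zxx ->
  (forall i s, - r <= s -> s <= r -> y i 0 s = z i 0 s) ->
  (z i l 0 - y i l 0) ^+ 2 <= wave_const b * Int 0 l (fun x => \sum_i y i x 0 ^+ 2).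
Proof.
move=> r0 l0 l1 cp cq pb qb hy hz yz.
have [[cy _ _ _] _ _ _] := hy; have [[cz _ _ _] _ _ _] := hz.
have [M M0 HM] : exists2 M, 0 <= M & forall i x s, 0 <= x -> x <= 1 -> - r <= s -> s <= r -> `|y i x s| <= M /\ `|z i x s| <= M.
  have H (u : 'I_2 -> R -> R -> R) : (forall i, continuous (fun p : R * R => u i p.1 p.2)) ->
    exists2 M, 0 <= M & forall i x s, 0 <= x -> x <= 1 -> - r <= s -> s <= r -> `|u i x s| <= M.
    move=> cu.
    have [M0 M00 H0] := @bounded_rect R (u ord0) 0 1 (- r) r (cu ord0).
    have [M1 M10 H1] := @bounded_rect R (u ord_max) 0 1 (- r) r (cu ord_max).
    exists (M0 + M1); first exact: addr_ge0.
    move=> j x s *; have [->|->] : j = ord0 \/ j = ord_max.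
    - by case: j => -[|[|//]] h; [left|right]; apply: val_inj.
    - by apply: (le_trans (H0 _ _ _ _ _ _)); rewrite ?lerDl.
    - by apply: (le_trans (H1 _ _ _ _ _ _)); rewrite ?lerDr.
  have [M1 M10 H1] := H y cy; have [M2 M20 H2] := H z cz.
  exists (M1 + M2); first exact: addr_ge0.
  move=> j x s x0 x1 s0 s1; split.
    by apply: (le_trans (H1 _ _ _ x0 x1 s0 s1)); rewrite lerDl.
  by apply: (le_trans (H2 _ _ _ x0 x1 s0 s1)); rewrite lerDr.
have nr : - r <= 0 by rewrite oppr_le0 ltW.
have pr := ltW r0.
set G := Int 0 l _; set C := wave_const b; set D := z i l 0 - y i l 0.
have b0 : 0 <= b by exact: le_trans (normr_ge0 _) (pb ord0 ord0 0).
have C0 : 0 <= C.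
  rewrite /C /wave_const; apply: mulr_ge0; first exact: expR_ge0.
  apply: addr_ge0 => //; apply: mulr_ge0; first by apply: mulr_ge0 => //; exact: sqr_ge0.
  by apply: mulr_ge0 => //; exact: expR_ge0.
have cy0 j : continuous (fun x => y j x 0) by cts.
(* every error made below is linear in e *)
have main e : 0 < e -> e <= 1 -> D ^+ 2 <= C * G + e * (8 * M + C * (4 * M + 3)).
  move=> e0 e1.
  have Hy := @moment0_cvg r y e r0 e0 cy.
  have Hz := @moment0_cvg r z e r0 e0 cz.
  have He := @wave_err_cvg R M r e M0 r0 e0.
  have [K [[KY KZ] KE]] : exists K, ((forall i x, 0 <= x -> x <= 1 -> `|moment r K y 0 i x - y i x 0| <= e) /\
     (forall i x, 0 <= x -> x <= 1 -> `|moment r K z 0 i x - z i x 0| <= e)) /\ wave_err M r K <= e.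
    have : \forall K \near \oo, ((forall i x, 0 <= x -> x <= 1 -> `|moment r K y 0 i x - y i x 0| <= e) /\
     (forall i x, 0 <= x -> x <= 1 -> `|moment r K z 0 i x - z i x 0| <= e)) /\ wave_err M r K <= e.
      by near=> K; (split; first split); near: K.
    by case=> N _ HN; exists N; apply: HN => /=.
  have jy := moment_jet K r0 cp hy.
  have jz := moment_jet K r0 cq hz.
  have E0 : 0 <= wave_err M r K.
    have := @moment_bound R M r K y ord0 0 r0 cy (fun s h h' => (HM ord0 0 s (lexx 0) ler01 h h').1).
    by move/(le_trans (normr_ge0 _)); rewrite pmulr_rge0// ltr0n fact_gt0.
  have comp := @jet_comparison R p q K _ _ _ _ l b (wave_err M r K) cp cq jy jz l0 l1 pb qb _ _ _ i.
  have {}comp : (moment r K z 0 i l - moment r K y 0 i l) ^+ 2 <=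
     C * (Int 0 l (fun x => \sum_i moment r K y 0 i x ^+ 2) + wave_err M r K ^+ 2).
    apply: comp.
    - by move=> k j _; apply: eq_Int => s s0 s1; rewrite yz.
    - by move=> j x x0 x1; apply: moment_bound => // s s0 s1; have [] := HM j x s x0 x1 s0 s1.
    - by move=> j x x0 x1; apply: moment_bound => // s s0 s1; have [] := HM j x s x0 x1 s0 s1.
  have cm j : continuous (moment r K y 0 j) by have [+ _ _ _] := jy; apply.
  have IG : Int 0 l (fun x => \sum_i moment r K y 0 i x ^+ 2) <= G + e * (4 * M + 2).
    have -> : G + e * (4 * M + 2) = Int 0 l (fun x => \sum_i y i x 0 ^+ 2) + e * (4 * M + 2) by [].
    apply: (@le_trans _ _ (Int 0 l (fun x => \sum_i y i x 0 ^+ 2 + e * (4 * M + 2)))).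
      apply: le_Int; [by cts|by cts|] => x x0 xl.
      have x1 : x <= 1 by exact: le_trans xl (ltW l1).
      have P j : moment r K y 0 j x ^+ 2 <= y j x 0 ^+ 2 + e * (2 * M + 1).
        have [HMj _] := HM j x 0 x0 x1 nr pr.
        have := KY j x x0 x1; set a := moment _ _ _ _ _ _; set c := y j x 0 in HMj *.
        move=> ac; have -> : a ^+ 2 = c ^+ 2 + (a - c) * (2 * c + (a - c)) by ring.
        rewrite lerD2l; apply: (le_trans (ler_norm _)); rewrite normrM.
        apply: ler_pM => //; apply: (le_trans (ler_normD _ _)).
        by rewrite normrM gtr0_norm//; lra.
      rewrite !big_ord_recl !big_ord0 !addr0; apply: (le_trans (lerD (P _) (P _))).
      by rewrite le_eqVlt; apply/orP; left; apply/eqP; ring.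
    rewrite IntD; [|by cts..]; rewrite lerD2l Int_cst ?(ltW l0)// subr0.
    by rewrite ler_piMr ?(ltW l1)// mulr_ge0 ?(ltW e0)// addr_ge0// mulr_ge0.
  have Dm : D ^+ 2 <= (moment r K z 0 i l - moment r K y 0 i l) ^+ 2 + 8 * M * e.
    have [h1 h2] := HM i l 0 (ltW l0) (ltW l1) nr pr.
    have := KY i l (ltW l0) (ltW l1); have := KZ i l (ltW l0) (ltW l1).
    set a := moment _ _ _ _ _ _; set c := moment _ _ _ _ _ _ => ac cc.
    have hD : `|D| <= 2 * M by apply: (le_trans (ler_normB _ _)); lra.
    set d := a - c.
    have Dd : `|D - d| <= 2 * e.
      have -> : D - d = (c - y i l 0) - (a - z i l 0) by rewrite /D /d; ring.
      by apply: (le_trans (ler_normB _ _)); lra.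
    have -> : D ^+ 2 = d ^+ 2 + 2 * D * (D - d) - (D - d) ^+ 2 by ring.
    apply: (@le_trans _ _ (d ^+ 2 + 2 * D * (D - d))); first by rewrite gerBl sqr_ge0.
    rewrite lerD2l; apply: (le_trans (ler_norm _)); rewrite !normrM gtr0_norm//.
    have := ler_pM (normr_ge0 D) (normr_ge0 (D - d)) hD Dd; lra.
  have E2 : wave_err M r K ^+ 2 <= e.
    rewrite expr2; apply: (le_trans (ler_wpM2l E0 KE)).
    by rewrite ler_piMl ?(ltW e0)// (le_trans KE).
  have := ler_wpM2l C0 (lerD IG E2).
  move: Dm comp; rewrite !mulrDr; lra.
have B0 : 0 <= 8 * M + C * (4 * M + 3).
  by apply: addr_ge0; [exact: mulr_ge0|apply: mulr_ge0 => //; apply: addr_ge0 => //; exact: mulr_ge0].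
set B := 8 * M + _ in main B0.
apply/ler_addgt0Pr => e e0.
pose e' := Num.min 1 (e / (B + 1)).
have e'0 : 0 < e' by rewrite /e' lt_min ltr01 divr_gt0// ltr_wpDl.
have e'1 : e' <= 1 by rewrite /e' ge_min lexx.
apply: (le_trans (main e' e'0 e'1)); rewrite lerD2l.
apply: (@le_trans _ _ (e / (B + 1) * B)); first by rewrite ler_wpM2r// /e' ge_min lexx orbT.
by rewrite mulrAC ler_pdivrMr ?ltr_wpDl// ler_pM2l// lerDl.
Unshelve. all: by end_near.
Qed.

End LeftComparison.

(** * Continuation in time *)

Section Continuation.
Context (R : realType).
Implicit Types (f g m : R -> R) (h s t d B T : R) (a : nat -> R) (i j k n N K : nat).

(** The alternating sum of C(k, j) (-1)^j f (s + j h), signed so as to be nonnegative on completely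
    monotone functions; [dseq] is its analogue for sequences. *)
Fixpoint dif h k f s : R := if k is k'.+1 then dif h k' f s - dif h k' f (s + h) else f s.

Fixpoint dseq k a i : R := if k is k'.+1 then dseq k' a i - dseq k' a i.+1 else a i.

Lemma dif_dseq h k f s i : dif h k f (s + i%:R * h) = dseq k (fun j => f (s + j%:R * h)) i.
Proof.
elim: k i => [//|k IH] i /=; rewrite -!IH; congr (_ - dif h k f _).
by rewrite -addrA -natr1 mulrDl mul1r.
Qed.

Lemma dseqS k a i : dseq k.+1 a i = dseq k (fun j => a j - a j.+1) i.
Proof. by elim: k i => [//|k IH] i; rewrite /= -!IH. Qed.

(* Newton's forward interpolation formula, all differences of order < K vanishing at 0. *)
Lemma newton_bound K a B N : (forall j, (j + K <= N)%N -> `|dseq K a j| <= B) ->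
  (forall j, (j < K)%N -> a j = 0) -> `|a N| <= 'C(N, K)%:R * B.
Proof.
elim: K a N => [|K IH] a N HB a0; first by rewrite bin0 mul1r; apply: (HB N); rewrite addn0.
pose g j := a j - a j.+1.
have gB j : (j < N)%N -> `|g j| <= 'C(j, K)%:R * B.
  move=> jN; apply: IH => [i iK|i iK].
    by rewrite -dseqS; apply: HB; rewrite addnS (leq_ltn_trans iK).
  by rewrite /g !a0 ?subrr// ltnW.
have aN M : a M = a 0 - \sum_(j < M) g j.
  elim: M => [|M IHM]; first by rewrite big_ord0 subr0.
  by rewrite big_ord_recr/= opprD addrA -IHM /g opprB addrC subrK.
have CN M : (M <= N)%N -> `|a M| <= 'C(M, K.+1)%:R * B.
  move=> MN; rewrite aN a0// sub0r normrN.
  apply: (le_trans (ler_norm_sum _ _ _)).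
  elim: M MN => [|M IHM] MN; first by rewrite big_ord0 bin0n mul0r.
  rewrite big_ord_recr/= binS addnC natrD mulrDl addrC [leRHS]addrC [leLHS]addrC.
  by apply: lerD; [exact: IHM (ltnW MN)|exact: gB].
exact: CN.
Qed.

(** The identity is the sum of the shift and the difference operator. Its n-th power expands
    [dseq j a i] into nonnegative terms, of which the one with [k] differences is kept. This is the
    discrete form of (-1)^k g^(k)(x) y^k / k! <= g(x - y). *)
Lemma completely_monotone_bound a n k i : (forall k i, 0 <= dseq k a i) ->
  forall j, 'C(n, k)%:R * dseq (j + k) a (i + n) <= dseq j a i.
Proof.
move=> a0; elim: n k i => [|n IH] k i j.
  case: k => [|k]; first by rewrite bin0 mul1r !addn0.
  by rewrite bin0n mul0r a0.
have split_ : dseq j a i = dseq j a i.+1 + dseq j.+1 a i by rewrite /= addrC subrK.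
case: k => [|k].
  rewrite bin0 mul1r addn0 split_.
  have := IH 0%N i.+1 j; rewrite bin0 mul1r addn0 addSnnS.
  by move/le_trans; apply; rewrite lerDl a0.
rewrite binS natrD mulrDl split_; apply: lerD.
  by have := IH k.+1 i.+1 j; rewrite addSnnS.
have := IH k i j.+1; rewrite addSnnS; apply: le_trans.
rewrite ler_wpM2l// [(i + n.+1)%N]addnS.
have -> : dseq (j + k.+1) a (i + n) = dseq (j + k.+1) a (i + n).+1 + dseq (j + k.+1).+1 a (i + n).
  by rewrite /= addrC subrK.
by rewrite lerDl a0.
Qed.

(** In Vandermonde's sum, only the choices with exactly one element in the new block of size [q] are
    kept. *)
Lemma bin_ge_exp q k : (q ^ k <= 'C(q * k, k))%N.
Proof.
elim: k => [|k IH]; first by rewrite expn0 muln0 bin0.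
rewrite mulnS -binomial.Vandermonde expnS.
have k1 : (1 < k.+2)%N by [].
rewrite (bigD1 (Ordinal k1))//= bin1 subSS subn0.
by rewrite (leq_trans _ (leq_addr _ _))// leq_mul2l IH orbT.
Qed.

Lemma bin_le_exp n k : ('C(n, k) <= 2 ^ n)%N.
Proof.
elim: n k => [|n IH] [|k]; rewrite ?bin0 ?expn_gt0// binS expnS mul2n -addnn.
by rewrite leq_add.
Qed.

Section Step.
(** In the application [m t] is (y(0), y(t)) and [f] is a bounded functional along [y]. Even
    differences of [m] are squared norms, hence the even orders and the arguments [2 * s]. *)
Variables (f m : R -> R) (B : R).
Hypothesis B0 : 0 <= B.
Hypothesis m_ge0 : forall h k s, 0 < h -> 0 <= s -> 0 <= dif h k.*2 m (2 * s).
Hypothesis m_anti : forall h k s t, 0 < h -> 0 <= s -> s <= t ->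
  dif h k.*2 m (2 * t) <= dif h k.*2 m (2 * s).
Hypothesis f_bound : forall h k s, 0 < h -> 0 <= s ->
  dif h k f s ^+ 2 <= B * dif h k.*2 m (2 * s).

(** There are 16 K steps of length d / (2K) from 2 d to 10 d, and C(16K, 2K) >= 8^(2K) = 64^K. Odd
    differences are nonnegative because [m_anti] makes the even ones decrease. *)
Lemma dif_even_bound d K : 0 < d -> (0 < K)%N ->
  dif (d / K.*2%:R) K.*2 m (2 * (5 * d)) <= m (2 * d) / 64 ^+ K.
Proof.
move=> d0 K0; have K20 : 0 < K.*2%:R :> R by rewrite ltr0n double_gt0.
set h := d / _; have h0 : 0 < h by rewrite divr_gt0.
pose a j := m (2 * d + j%:R * h).
have a0 k i : 0 <= dseq k a i.
  have even k' i' : 0 <= dseq k'.*2 a i' /\ dseq k'.*2 a i'.+1 <= dseq k'.*2 a i'.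
    have h2 : 0 <= i'%:R * h by rewrite mulr_ge0// ltW.
    have e1 : 2 * d + i'%:R * h = 2 * (d + i'%:R * h / 2) by field.
    have e2 : 2 * d + i'.+1%:R * h = 2 * (d + i'.+1%:R * h / 2) by field.
    rewrite /a -!dif_dseq e1 e2; split.
      by apply: m_ge0 => //; rewrite addr_ge0 ?(ltW d0)// divr_ge0.
    apply: m_anti => //; first by rewrite addr_ge0 ?(ltW d0)// divr_ge0.
    by rewrite lerD2l ler_pM2r// ler_pM2r// ler_nat.
  rewrite -(odd_double_half k); case: (odd k) => /=.
    by rewrite ?add1n /= subr_ge0; have [] := even k./2 i.
  by rewrite ?add0n; have [] := even k./2 i.
have e10 : 2 * d + (8 * K.*2)%:R * h = 2 * (5 * d).
  by rewrite /h natrM; field; rewrite gt_eqF.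
have H : 'C(8 * K.*2, K.*2)%:R * dif h K.*2 m (2 * (5 * d)) <= m (2 * d).
  have := @completely_monotone_bound a (8 * K.*2) K.*2 0 a0 0%N.
  rewrite !add0n => H; rewrite -e10 dif_dseq.
  by apply: (le_trans H); rewrite /= /a mul0r addr0.
have C8 : 64 ^+ K <= 'C(8 * K.*2, K.*2)%:R :> R.
  have -> : (64 : R) ^+ K = (8 ^ K.*2)%:R.
    by rewrite -mul2n expnM natrX; congr (_ ^+ _); rewrite natrX; ring.
  by rewrite ler_nat bin_ge_exp.
rewrite ler_pdivlMr ?exprn_gt0// mulrC.
apply: le_trans H; rewrite ler_wpM2r//.
by apply: m_ge0 => //; rewrite mulr_ge0// ltW.
Qed.

(** Among the nodes 5 d + j d / (2K), the first K lie where [f] vanishes and the node 2K is 6 d.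
    Newton's formula costs C(2K, K) <= 4^K, hence 16^K after squaring, against the gain 64^K of
    [dif_even_bound]. *)
Lemma continuation_step d : 0 < d -> (forall s, 0 <= s -> s < 5 * d + d / 2 -> f s = 0) ->
  f (6 * d) = 0.
Proof.
move=> d0 f0.
have bound K : (0 < K)%N -> f (6 * d) ^+ 2 <= B * m (2 * d) / 4 ^+ K.
  move=> K0; have K20 : 0 < K.*2%:R :> R by rewrite ltr0n double_gt0.
  set h := d / K.*2%:R; have h0 : 0 < h by rewrite divr_gt0.
  pose a j := f (5 * d + j%:R * h).
  have m0 : 0 <= m (2 * d) by have := @m_ge0 1 0%N d ltr01 (ltW d0).
  pose b := Num.sqrt (B * (m (2 * d) / 64 ^+ K)).
  have bb : 0 <= B * (m (2 * d) / 64 ^+ K) by rewrite mulr_ge0// divr_ge0// exprn_ge0.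
  have := @newton_bound K a b K.*2 _ _.
  have e6 : a K.*2 = f (6 * d) by rewrite /a /h; congr f; field; rewrite gt_eqF.
  rewrite e6 => H.
  have {}H : `|f (6 * d)| <= 'C(K.*2, K)%:R * b.
    apply: H => j jK.
      rewrite -dif_dseq -[`|_|]ger0_norm// -sqrtr_sqr ler_wsqrtr// real_normK ?num_real//.
      have d5 : 0 <= 5 * d by rewrite mulr_ge0// ltW.
      have jh : 0 <= j%:R * h by rewrite mulr_ge0// ltW.
      apply: (le_trans (f_bound K h0 (addr_ge0 d5 jh))).
      rewrite ler_wpM2l//; apply: le_trans (dif_even_bound d0 K0).
      by apply: m_anti => //; rewrite lerDl.
    apply: f0; first by rewrite addr_ge0 ?mulr_ge0 ?(ltW d0) ?(ltW h0).
    rewrite ltrD2l; have -> : d / 2 = K%:R * h.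
      by rewrite /h -mul2n natrM; field; rewrite pnatr_eq0 -lt0n.
    by rewrite ltr_pM2r// ltr_nat.
  have {}H : `|f (6 * d)| <= 4 ^+ K * b.
    apply: (le_trans H); rewrite ler_wpM2r ?sqrtr_ge0//.
    have -> : (4 : R) ^+ K = (2 ^ K.*2)%:R.
      by rewrite -mul2n expnM natrX; congr (_ ^+ _); rewrite natrX; ring.
    by rewrite ler_nat bin_le_exp.
  rewrite -[f _ ^+ 2]real_normK ?num_real//.
  apply: (@le_trans _ _ ((4 ^+ K * b) ^+ 2)).
    by rewrite lerXn2r ?nnegrE// mulr_ge0 ?sqrtr_ge0// exprn_ge0.
  rewrite exprMn sqr_sqrtr// -exprM mulnC exprM.
  have -> : (64 : R) ^+ K = (4 ^+ 2) ^+ K * 4 ^+ K by rewrite -exprMn; congr (_ ^+ _); ring.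
  rewrite le_eqVlt; apply/orP; left; apply/eqP; field.
  by rewrite !expf_neq0.
have f2 : f (6 * d) ^+ 2 <= 0.
  apply/ler_addgt0Pr => e e0; rewrite add0r.
  have c4 : `|4^-1| < 1 :> R by rewrite ger0_norm ?invf_lt1 ?invr_ge0// ltr1n.
  have /cvgrPdist_le := @cvg_expr R 4^-1 c4.
  set C := B * m (2 * d).
  have C0 : 0 <= C by rewrite mulr_ge0//; have := @m_ge0 1 0%N d ltr01 (ltW d0).
  have eC : 0 < e / (C + 1) by rewrite divr_gt0// ltr_wpDl.
  move=> /(_ _ eC)[N _ HN].
  have := HN N.+1 (leqnSn N); rewrite sub0r normrN ger0_norm ?exprn_ge0 ?invr_ge0// => h.
  apply: (le_trans (bound N.+1 isT)); rewrite -/C -exprVn.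
  apply: (le_trans (ler_wpM2l C0 h)).
  by rewrite mulrA ler_pdivrMr ?ltr_wpDl// [C * e]mulrC ler_pM2l// lerDl.
by apply/eqP; rewrite -sqrf_eq0 eq_le f2 sqr_ge0.
Qed.

(** Each step enlarges the interval by the factor 6 / (5 + 1/2) = 12/11. *)
Lemma continuation T : 0 < T -> (forall s, 0 <= s -> s < T -> f s = 0) ->
  forall s, 0 <= s -> f s = 0.
Proof.
move=> T0 f0.
have step n s : 0 <= s -> s < T * (12 / 11) ^+ n -> f s = 0.
  elim: n s => [|n IH] s s0; first by rewrite expr0 mulr1; exact: f0.
  rewrite exprS => sT.
  have [->|sn0] := eqVneq s 0; first by apply: f0.
  have sp : 0 < s / 6 by rewrite divr_gt0// lt_neqAle eq_sym sn0.
  have -> : s = 6 * (s / 6) by field.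
  apply: continuation_step => // t t0 ts; apply: IH => //.
  by apply: (lt_le_trans ts); lra.
move=> s s0.
have [n ns] : exists n : nat, s < T * (12 / 11) ^+ n.
  pose n := (Num.truncn (11 * s / T)).+1; exists n.
  have h : 11 * s / T < n%:R := truncnS_gt _.
  have bern k : 1 + k%:R / 11 <= (12 / 11) ^+ k :> R.
    elim: k => [|k IH]; first by rewrite mul0r addr0 expr0.
    rewrite exprS -natr1.
    have c0 : 0 <= 12 / 11 :> R by rewrite divr_ge0.
    by apply: (le_trans _ (ler_wpM2l c0 IH)); have := ler0n R k; lra.
  apply: (@lt_le_trans _ _ (T * (1 + n%:R / 11))); last by rewrite ler_pM2l// bern.
  move: h; rewrite ltr_pdivrMr// => h; lra.
exact: step ns.
Qed.

End Step.
End Continuation.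

(** * The L^2 pairing along the flow *)

Section InnerProduct.
Context (R : realType).
Implicit Types (f g h w : 'I_2 -> R -> R) (x s t r T c : R) (i j : 'I_2) (p : 'I_2 -> 'I_2 -> R -> R) (k n : nat).

Definition ip f g : R := Int 0 1 (fun x => \sum_i f i x * g i x).

Lemma ipC f g : ip f g = ip g f.
Proof. by apply: eq_Int => x _ _; apply: eq_bigr => i _; rewrite mulrC. Qed.

Lemma eq_ip f f' g g' : (forall i x, 0 <= x -> x <= 1 -> f i x = f' i x) ->
  (forall i x, 0 <= x -> x <= 1 -> g i x = g' i x) -> ip f g = ip f' g'.
Proof.
by move=> ff gg; apply: eq_Int => x x0 x1; apply: eq_bigr => i _; rewrite ff// gg.
Qed.

Lemma ip_ge0 f : 0 <= ip f f.
Proof. by apply: Int_ge0 => x _ _; apply: sumr_ge0 => i _; rewrite -expr2 sqr_ge0. Qed.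

Lemma ipBl f g h : (forall i, continuous (f i)) -> (forall i, continuous (g i)) ->
  (forall i, continuous (h i)) -> ip (fun i x => f i x - g i x) h = ip f h - ip g h.
Proof.
move=> cf cg ch; rewrite /ip -IntB; [|by cts..].
by apply: eq_Int => x _ _; rewrite -sumrB; apply: eq_bigr => i _; rewrite mulrBl.
Qed.

Lemma ipDl f g h : (forall i, continuous (f i)) -> (forall i, continuous (g i)) ->
  (forall i, continuous (h i)) -> ip (fun i x => f i x + g i x) h = ip f h + ip g h.
Proof.
move=> cf cg ch; rewrite /ip -IntD; [|by cts..].
by apply: eq_Int => x _ _; rewrite -big_split; apply: eq_bigr => i _; rewrite mulrDl.
Qed.

Lemma ipZl c f h : (forall i, continuous (f i)) -> (forall i, continuous (h i)) ->
  ip (fun i x => c * f i x) h = c * ip f h.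
Proof.
move=> cf ch; rewrite /ip -IntZ; [|by cts..].
by apply: eq_Int => x _ _; rewrite mulr_sumr; apply: eq_bigr => i _; rewrite mulrA.
Qed.

Lemma ip_sub2 t f g : (forall i, continuous (f i)) -> (forall i, continuous (g i)) ->
  ip (fun i x => f i x - t * g i x) (fun i x => f i x - t * g i x) =
  ip f f - 2 * t * ip f g + t ^+ 2 * ip g g.
Proof.
move=> cf cg.
rewrite ipBl; [|by move=> i; cts..].
rewrite (ipC f) ipBl; [|by move=> i; cts..].
rewrite ipZl; [|by move=> i; cts..].
rewrite (ipC (fun i x => t * g i x)) ipBl; [|by move=> i; cts..].
rewrite (ipC f (fun i x => t * g i x)) !ipZl; [|by move=> i; cts..].
by rewrite (ipC g f) (ipC g (fun i x => t * g i x)) ipZl//; ring.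
Qed.

Lemma ip_CauchySchwarz f g : (forall i, continuous (f i)) -> (forall i, continuous (g i)) ->
  ip f g ^+ 2 <= ip f f * ip g g.
Proof.
move=> cf cg; apply: discriminant_le => [|t]; first exact: ip_ge0.
by rewrite -ip_sub2//; exact: ip_ge0.
Qed.

Lemma continuous_interior (f : R -> R) x : continuous f ->
  (forall y, 0 < y -> y < 1 -> f y = 0) -> 0 <= x -> x <= 1 -> f x = 0.
Proof.
move=> cf f0 x0 x1; apply/eqP; apply: contraT => fx.
have nf : 0 < `|f x| by rewrite normr_gt0.
have /cvgrPdist_lt /(_ _ nf) cfx := cf x.
have [d /= d0 Hd] := (nbhs_ballP _ _).1 cfx.
pose e := Num.min (d / 2) (1 / 4).
have e0 : 0 < e by rewrite /e lt_min !divr_gt0.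
have ed : e < d by rewrite /e gt_min ltr_pdivrMr// ltr_pMr// ltr1n.
have e4 : e <= 1 / 4 by rewrite /e ge_min lexx orbT.
move: e e0 ed e4 => e e0 ed e4.
have [xh|xh] := leP x (1 / 2).
  have := Hd (x + e); rewrite /ball/= opprD addrA subrr sub0r normrN gtr0_norm// => /(_ ed).
  have h1 : 0 < x + e by exact: ltr_wpDl.
  have h2 : x + e < 1 by apply: le_lt_trans (lerD xh e4) _; lra.
  by rewrite (f0 (x + e))// subr0 ltxx.
have := Hd (x - e); rewrite /ball/= subKr gtr0_norm// => /(_ ed).
have h1 : 0 < x - e by rewrite subr_gt0; apply: le_lt_trans e4 _; apply: lt_trans xh; lra.
have h2 : x - e < 1 by rewrite ltrBlDr ltr_pwDr.
by rewrite (f0 (x - e))// subr0 ltxx.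
Qed.

Lemma ip_eq0 f i x : (forall i, continuous (f i)) -> ip f f = 0 -> 0 <= x -> x <= 1 -> f i x = 0.
Proof.
move=> cf f0; apply: continuous_interior => // z z0 z1.
have cs : continuous (fun x => \sum_i f i x * f i x) by cts.
have f00 y : 0 <= y -> y <= 1 -> 0 <= \sum_i f i y * f i y.
  by move=> _ _; apply: sumr_ge0 => j _; rewrite -expr2 sqr_ge0.
have := Int_eq0_ge0 cs f00 f0 z0 z1.
move/eqP; rewrite psumr_eq0 => [/allP/(_ i)|j _]; last by rewrite -expr2 sqr_ge0.
by rewrite mem_index_enum => /(_ isT) /=; rewrite mulf_eq0 orbb => /eqP.
Qed.

Lemma ip_parts f fx fxx g gx : (forall i, continuous (f i)) -> (forall i, continuous (fx i)) ->
  (forall i, continuous (fxx i)) -> (forall i, continuous (g i)) -> (forall i, continuous (gx i)) ->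
  (forall i x, 0 < x -> x < 1 -> Der (fx i) x (fxx i x)) ->
  (forall i x, 0 < x -> x < 1 -> Der (g i) x (gx i x)) ->
  (forall i, fx i 0 = 0 /\ fx i 1 = 0) -> ip fxx g = - ip fx gx.
Proof.
move=> cf cfx cfxx cg cgx dfx dg f01.
apply/eqP; rewrite -addr_eq0 /ip -IntD; [|by cts..].
rewrite (@FTC2 R (fun x => \sum_i fx i x * g i x)); [|exact: ler01|by cts|by cts|].
  by apply/eqP; rewrite !big1 ?subrr// => i _; have [e0 e1] := f01 i; rewrite ?e0 ?e1 mul0r.
move=> x x0 x1.
have D1 i : Der (fx i) x (fxx i x) by exact: dfx.
have D2 i : Der (g i) x (gx i x) by exact: dg.
by der; rewrite -big_split.
Qed.

Definition mulp p f : 'I_2 -> R -> R := fun i x => \sum_j p i j x * f j x.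

Lemma ip_mulp p f g : (forall i j x, 0 <= x -> x <= 1 -> p i j x = p j i x) -> ip (mulp p f) g = ip f (mulp p g).
Proof.
move=> sp; apply: eq_Int => x x0 x1; rewrite /mulp.
under eq_bigr do rewrite mulr_suml.
under [RHS]eq_bigr do rewrite mulr_sumr.
rewrite exchange_big/=; apply: eq_bigr => i _; apply: eq_bigr => j _.
by rewrite (sp j i)//; ring.
Qed.

(** A solution for times s > - c with Neumann conditions at both ends. A positive [c] makes time 0
    interior; a negative one occurs for solutions considered after a positive time only. *)
Definition gsol p c (y yt yx yxx : 'I_2 -> R -> R -> R) : Prop :=
  [/\ [/\ forall i, continuous (fun p : R * R => y i p.1 p.2),
         forall i, continuous (fun p : R * R => yt i p.1 p.2),
         forall i, continuous (fun p : R * R => yx i p.1 p.2) &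
         forall i, continuous (fun p : R * R => yxx i p.1 p.2)],
    forall i x s, 0 <= x -> x <= 1 -> - c < s -> Der (y i x) s (yt i x s),
    forall i x s, 0 < x -> x < 1 -> - c < s ->
      [/\ Der (y i ^~ s) x (yx i x s), Der (yx i ^~ s) x (yxx i x s) &
        yt i x s = yxx i x s - \sum_j p i j x * y j x s] &
    forall i s, - c < s -> yx i 0 s = 0 /\ yx i 1 s = 0].

Lemma gsol_sub_shift p c y yt yx yxx d : 0 <= d -> gsol p c y yt yx yxx ->
  gsol p c (fun i x s => y i x s - y i x (s + d)) (fun i x s => yt i x s - yt i x (s + d))
    (fun i x s => yx i x s - yx i x (s + d)) (fun i x s => yxx i x s - yxx i x (s + d)).
Proof.
move=> d0 [[cy cyt cyx cyxx] Dt Dx yx0].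
have sh s : - c < s -> - c < s + d by move=> cs; apply: (lt_le_trans cs); rewrite lerDl.
split; first by split=> i; cts.
- move=> i x s x0 x1 cs; apply: DerB; first exact: Dt.
  have D : Der (fun s => s + d) s (1 + 0) := DerD (Der_id s) (Der_cst d s).
  by have := Der_comp (f := y i x) (g := fun s => s + d) (Dt i x _ x0 x1 (sh _ cs)) D; rewrite addr0 mulr1.
- move=> i x s x0 x1 cs; have [d1 d2 e1] := Dx i x s x0 x1 cs; have [d3 d4 e2] := Dx i x _ x0 x1 (sh _ cs).
  split; [exact: DerB|exact: DerB|].
  rewrite e1 e2; have -> : \sum_j p i j x * (y j x s - y j x (s + d)) =
    \sum_j p i j x * y j x s - \sum_j p i j x * y j x (s + d).
    by rewrite -sumrB; apply: eq_bigr => j _; rewrite mulrBr.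
  by ring.
- by move=> i s cs; have [-> ->] := yx0 i s cs; have [-> ->] := yx0 i _ (sh _ cs); rewrite subrr.
Qed.

Section Evolution.
Variables (p : 'I_2 -> 'I_2 -> R -> R) (c : R).
Hypothesis c0 : 0 < c.
Hypothesis cp : forall i j, continuous (p i j).
Hypothesis sp : forall i j x, 0 <= x -> x <= 1 -> p i j x = p j i x.
Hypothesis pp : forall (v : 'I_2 -> R) x, 0 <= x -> x <= 1 -> 0 <= \sum_i v i * \sum_j p i j x * v j.

Lemma ip_mulp_ge0 f : 0 <= ip f (mulp p f).
Proof. by apply: Int_ge0 => x x0 x1; apply: pp. Qed.

Lemma continuous_mulp f : (forall i, continuous (f i)) -> forall i, continuous (mulp p f i).
Proof. by move=> cf i; rewrite /mulp; cts. Qed.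

Variables (y yt yx yxx : 'I_2 -> R -> R -> R).
Hypothesis hy : gsol p c y yt yx yxx.

Let cs (u : 'I_2 -> R -> R -> R) s : (forall i, continuous (fun p : R * R => u i p.1 p.2)) ->
  forall i, continuous (u i ^~ s).
Proof. by move=> cu i; cts. Qed.

Lemma ip_yt w s : - c < s -> (forall i, continuous (w i)) ->
  ip (fun i x => yt i x s) w = ip (fun i x => yxx i x s) w - ip (mulp p (fun i x => y i x s)) w.
Proof.
move=> s0 cw; have [[cy cyt cyx cyxx] Dt Dx yx0] := hy.
rewrite -ipBl; [|exact: cs|by apply: continuous_mulp; exact: cs|by []].
apply: eq_Int => x x0 x1.
have H i : yt i x s = yxx i x s - mulp p (fun i x => y i x s) i x.
  apply/eqP; rewrite -subr_eq0; apply/eqP.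
  have cm := continuous_mulp (@cs _ s cy); have cyts := @cs _ s cyt; have cyxxs := @cs _ s cyxx.
  pose F x := yt i x s - (yxx i x s - mulp p (fun i x => y i x s) i x).
  apply: (@continuous_interior F) => //; first by rewrite /F; cts.
  by move=> z z0 z1; rewrite /F; have [_ _ ->] := Dx i z s z0 z1 s0; rewrite subrr.
by apply: eq_bigr => i _; rewrite H.
Qed.

Lemma ip_yt_sym s r : - c < s -> - c < r ->
  ip (fun i x => yt i x s) (fun i x => y i x r) = ip (fun i x => y i x s) (fun i x => yt i x r).
Proof.
move=> s0 r0; have [[cy cyt cyx cyxx] Dt Dx yx0] := hy.
rewrite ip_yt//; last exact: cs.
rewrite [RHS]ipC ip_yt//; last exact: cs.
rewrite (ip_mulp _ _ sp) [in RHS]ipC; congr (_ - _); last by rewrite ipC.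
have G a b : - c < a -> - c < b -> ip (fun i x => yxx i x a) (fun i x => y i x b) = - ip (fun i x => yx i x a) (fun i x => yx i x b).
  move=> a0 b0; apply: (@ip_parts (fun i x => y i x a) (fun i x => yx i x a)); try exact: cs.
  - by move=> i x x0 x1; have [] := Dx i x a x0 x1 a0.
  - by move=> i x x0 x1; have [] := Dx i x b x0 x1 b0.
  - by move=> i; exact: yx0.
by rewrite G// [in RHS]ipC G// ipC.
Qed.

Definition msol r := ip (fun i x => y i x 0) (fun i x => y i x r).

(** By symmetry of the operator, (y(t), y(s + r - t)) has zero derivative in t. *)
Lemma ip_sum s r : 0 <= s -> 0 <= r -> ip (fun i x => y i x s) (fun i x => y i x r) = msol (s + r).
Proof.
move=> s0 r0; have [[cy cyt cyx cyxx] Dt Dx yx0] := hy.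
pose F t := ip (fun i x => y i x t) (fun i x => y i x (s + r - t)).
have -> : ip (fun i x => y i x s) (fun i x => y i x r) = F s by rewrite /F addrAC subrr add0r.
have -> : msol (s + r) = F 0 by rewrite /F subr0.
have c0' := c0.
apply: eq_of_Der0 => //.
  by apply: (@continuous_Int_slice R (fun x t => \sum_i y i x t * y i x (s + r - t))); cts.
move=> t t0 ts.
have -> : (0 : R) = Int 0 1 (fun x => \sum_i (yt i x t * y i x (s + r - t) - y i x t * yt i x (s + r - t))).
  have E := @ip_yt_sym t (s + r - t) ltac:(lra) ltac:(lra).
  have cyt' := @cs _ t cyt; have cy' := @cs _ t cy.
  have cyt2 := @cs _ (s + r - t) cyt; have cy2 := @cs _ (s + r - t) cy.
  transitivity (ip (fun i x => yt i x t) (fun i x => y i x (s + r - t)) -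
    ip (fun i x => y i x t) (fun i x => yt i x (s + r - t))); first by rewrite E subrr.
  rewrite /ip -IntB; [|by cts..].
  by apply: eq_Int => x _ _; rewrite -sumrB.
apply: (@Der_Int R (fun x t => \sum_i y i x t * y i x (s + r - t))
  (fun x t => \sum_i (yt i x t * y i x (s + r - t) - y i x t * yt i x (s + r - t))) 0 1 0 s) => //; [by cts|by cts|].
move=> x u x0 x1 u0 us.
have D1 i : Der (y i x) u (yt i x u) by apply: Dt => //; lra.
have D0 : Der (fun u => s + r - u) u (0 - 1) := DerB (Der_cst _ _) (Der_id _).
have D2 i : Der (fun u => y i x (s + r - u)) u (yt i x (s + r - u) * (0 - 1)).
  by apply: (Der_comp (f := y i x) (g := fun u => s + r - u) _ D0); apply: Dt => //; lra.
by der; apply: eq_bigr => i _; ring.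
Qed.

(** The derivative of the squared norm is -2 times the sum of the squared norm of y_x and of the
    nonnegative form of [p]. *)
Lemma norm_anti s r : 0 <= s -> s <= r ->
  ip (fun i x => y i x r) (fun i x => y i x r) <= ip (fun i x => y i x s) (fun i x => y i x s).
Proof.
move=> s0 sr; have [[cy cyt cyx cyxx] Dt Dx yx0] := hy.
have c0' := c0.
apply: (@le_of_Der_le0 R (fun t => ip (fun i x => y i x t) (fun i x => y i x t))
  (fun t => 2 * ip (fun i x => yt i x t) (fun i x => y i x t))) => //.
- by apply: (@continuous_Int_slice R (fun x t => \sum_i y i x t * y i x t)); cts.
- move=> t t0 tr; have cyt' := @cs _ t cyt; have cy' := @cs _ t cy.
  rewrite /ip -IntZ; [|by cts..].
  apply: (@Der_Int R (fun x t => \sum_i y i x t * y i x t)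
    (fun x t => 2 * \sum_i (yt i x t * y i x t)) 0 1 s r) => //; [by cts|by cts|].
  move=> x u x0 x1 u0 us.
  have D1 i : Der (y i x) u (yt i x u) by apply: Dt => //; lra.
  by der; rewrite mulr_sumr; apply: eq_bigr => i _; ring.
- move=> t t0 tr; have ct : - c < t by lra.
  rewrite ip_yt//; last exact: cs.
  rewrite (@ip_parts (fun i x => y i x t) (fun i x => yx i x t) _ _ (fun i x => yx i x t)); try exact: cs.
  + have := ip_ge0 (fun i x => yx i x t).
    have := ip_mulp_ge0 (fun i x => y i x t); rewrite ipC; lra.
  + by move=> i x x0 x1; have [] := Dx i x t x0 x1 ct.
  + by move=> i x x0 x1; have [] := Dx i x t x0 x1 ct.
  + by move=> i; exact: yx0.
Qed.

End Evolution.

End InnerProduct.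

(** * Continuation of functionals along the flow *)

Section FunctionalContinuation.
Context (R : realType).
Implicit Types (f g w : 'I_2 -> R -> R) (x s t r T c h B : R) (i j : 'I_2) (k l n : nat).
Variables (p : 'I_2 -> 'I_2 -> R -> R) (c : R).
Hypothesis c0 : 0 < c.
Hypothesis cp : forall i j, continuous (p i j).
Hypothesis sp : forall i j x, 0 <= x -> x <= 1 -> p i j x = p j i x.
Hypothesis pp : forall (v : 'I_2 -> R) x, 0 <= x -> x <= 1 -> 0 <= \sum_i v i * \sum_j p i j x * v j.
Variables (y yt yx yxx : 'I_2 -> R -> R -> R).
Hypothesis hy : gsol p c y yt yx yxx.

Let dify h k (u : 'I_2 -> R -> R -> R) i x s := dif h k (u i x) s.

Lemma gsol_dif h k : 0 <= h ->
  gsol p c (dify h k y) (dify h k yt) (dify h k yx) (dify h k yxx).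
Proof.
move=> h0; elim: k => [|k IH]; first exact: hy.
exact: gsol_sub_shift h0 IH.
Qed.

Let cdif h k s : 0 <= h -> forall i, continuous (fun x => dify h k y i x s).
Proof. by move=> h0 i; have [[cy _ _ _] _ _ _] := gsol_dif k h0; cts. Qed.

Lemma ip_dif h k l s r : 0 <= h -> 0 <= s -> 0 <= r ->
  ip (fun i x => dify h k y i x s) (fun i x => dify h l y i x r) = dif h (k + l) (msol y) (s + r).
Proof.
move=> h0; elim: k s r => [|k IH] s r s0 r0.
  elim: l r r0 => [|l IHl] r r0.
    by rewrite /dify /=; exact: (ip_sum c0 cp sp hy).
  rewrite [LHS]ipC [LHS]ipBl; [|exact: cdif..].
  by rewrite ipC IHl// [X in _ - X]ipC IHl ?addr_ge0// addrA.
rewrite [LHS]ipBl; [|exact: cdif..].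
by rewrite !IH ?addr_ge0// addSn /= addrAC.
Qed.

(* By symmetry of the flow the differences of [y] have squared norm equal to an even difference of
   [msol], so [continuation] applies to [L] along the flow: a quantitative form of analyticity. *)
Lemma functional_continuation (L : ('I_2 -> R -> R) -> R) B T : 0 <= B ->
  (forall f g, (forall i, continuous (f i)) -> (forall i, continuous (g i)) ->
    L (fun i x => f i x - g i x) = L f - L g) ->
  (forall f, (forall i, continuous (f i)) -> L f ^+ 2 <= B * ip f f) ->
  0 < T -> (forall s, 0 <= s -> s < T -> L (fun i x => y i x s) = 0) ->
  forall s, 0 <= s -> L (fun i x => y i x s) = 0.
Proof.
move=> B0 LB Lb T0 L0.
have nrm h k s : 0 <= h -> 0 <= s -> dif h k.*2 (msol y) (2 * s) =
    ip (fun i x => dify h k y i x s) (fun i x => dify h k y i x s).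
  by move=> h0 s0; rewrite ip_dif// addnn; congr (dif _ _ _ _); ring.
have Ldif h k s : 0 <= h -> dif h k (fun s => L (fun i x => y i x s)) s = L (fun i x => dify h k y i x s).
  move=> h0; elim: k s => [//|k IH] s /=.
  by rewrite !IH -LB//; exact: cdif.
apply: (@continuation R _ (msol y) B B0 _ _ _ T T0 L0).
- by move=> h k s h0 s0; rewrite nrm ?(ltW h0)//; exact: ip_ge0.
- move=> h k s t h0 s0 st; have t0 : 0 <= t by exact: le_trans st.
  rewrite !nrm ?(ltW h0)//.
  exact: (norm_anti c0 cp pp (gsol_dif k (ltW h0)) s0 st).
- move=> h k s h0 s0; rewrite nrm ?(ltW h0)// Ldif ?(ltW h0)//.
  by apply: Lb; apply: cdif; exact: ltW.
Qed.

End FunctionalContinuation.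

(** * Limits along a free ultrafilter *)

Section UltraLimits.
Context (R : realType).
Implicit Types (a : nat -> R) (f : nat -> R -> R) (M x z e : R) (n : nat).

(* Limits along a free ultrafilter replace the extraction of convergent subsequences. *)
Lemma ultra_nat : exists U : set_system nat,
  UltraFilter U /\ (forall A : set nat, (\forall n \near \oo, A n) -> U A).
Proof.
have [U [UU sU]] := @ultraFilterLemma nat \oo _.
by exists U; split=> // A; exact: sU.
Qed.

Variable U : set_system nat.
Hypothesis UU : UltraFilter U.

Lemma ultra_cvg a M : (forall n, `|a n| <= M) -> exists l : R, a n @[n --> U] --> l.
Proof.
move=> aM.
have aU : (a @ U) [set` `[- M, M]].
  by apply: (@filterE nat U) => n /=; rewrite in_itv/= -ler_norml; exact: aM.
have [l [_ cl]] := @segment_compact R (- M) M (a @ U) _ aU.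
exists l => B Bl /=.
have [//|nB] := in_ultra_setVsetC (a @^-1` B) UU.
have nB' : (a @ U) (~` B) by exact: nB.
by have [z [/= nz /nz]] := cl _ _ nB' Bl.
Qed.

(** The Arzela-Ascoli theorem: pointwise limits exist along the ultrafilter, equicontinuity passes
    to them, and compactness of [0, 1] makes the convergence uniform. *)
Lemma ultra_unif_cvg f M : (forall n x, `|f n x| <= M) ->
  (forall e, 0 < e -> exists2 d, 0 < d & forall n x z, `|x - z| < d -> `|f n x - f n z| <= e) ->
  exists2 h : R -> R, continuous h &
    forall e, 0 < e -> \forall n \near U, forall x, 0 <= x -> x <= 1 -> `|f n x - h x| <= e.
Proof.
move=> fM feq.
have /choice[h hE] x : exists l : R, f n x @[n --> U] --> l by apply: (@ultra_cvg _ M) => n; exact: fM.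
have heq e x z : (forall n, `|f n x - f n z| <= e) -> `|h x - h z| <= e.
  move=> fe.
  have C : `|f n x - f n z| @[n --> U] --> `|h x - h z|.
    by apply: cvg_norm; apply: cvgB; exact: hE.
  by apply: (cvgr_to_le C); apply: filterE.
exists h.
  move=> x; apply/cvgrPdist_le => e e0; have [d d0 fd] := feq e e0.
  apply/nbhs_ballP; exists d => //= z; rewrite /ball/= => xz.
  by apply: heq => n; exact: fd.
move=> e e0.
have := @segment_compact R 0 1.
move/compact_near_coveringP => /(_ nat U (fun n x => `|f n x - h x| <= e) _) H.
have {}H : \forall n \near U, [set` `[0, 1]] `<=` (fun x => `|f n x - h x| <= e).
  apply: H => x _.
  have e3 : 0 < e / 3 by rewrite divr_gt0.
  have [d d0 fd] := feq _ e3.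
  have /cvgrPdist_le /(_ _ e3) C := hE x.
  exists (ball x d, [set n | `|h x - f n x| <= e / 3]) => /=.
    by split=> //; exact: nbhsx_ballx.
  move=> [z n] /= [xz hn].
  have fz m : `|f m z - f m x| <= e / 3 by rewrite distrC; apply: fd.
  have hz : `|h x - h z| <= e / 3 by apply: heq => m; rewrite distrC.
  have -> : f n z - h z = (f n z - f n x) - (h x - f n x) + (h x - h z) by ring.
  apply: (le_trans (ler_normD _ _)); rewrite (_ : e = e / 3 + e / 3 + e / 3); last by field.
  by apply: lerD => //; apply: (le_trans (ler_normB _ _)); exact: lerD.
by apply: filterS H => n Hn x x0 x1; apply: Hn; rewrite /= in_itv/= x0.
Qed.

End UltraLimits.

(** * The Green operator *)

Section GreenRelation.
Context (R : realType).
Implicit Types (f g h w v fx gx : 'I_2 -> R -> R) (x y s t : R) (i j : 'I_2) (p : 'I_2 -> 'I_2 -> R -> R).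

(** [f] solves - f'' + p f = w with Neumann conditions. This is the graph of the Green operator;
    existence is proved only later, for suitably shifted potentials. *)
Definition green p w f fx : Prop :=
  [/\ forall i, continuous (f i), forall i, continuous (fx i),
    forall i x, 0 < x -> x < 1 -> Der (f i) x (fx i x),
    forall i x, 0 < x -> x < 1 -> Der (fx i) x (mulp p f i x - w i x) &
    forall i, fx i 0 = 0 /\ fx i 1 = 0].

Lemma green_sub p w w' f f' fx fx' : green p w f fx -> green p w' f' fx' ->
  green p (fun i x => w i x - w' i x) (fun i x => f i x - f' i x) (fun i x => fx i x - fx' i x).
Proof.
move=> [cf cfx df dfx f0] [cf' cfx' df' dfx' f0']; split; [by move=> i; cts|by move=> i; cts|..].
- by move=> i x x0 x1; apply: DerB; [exact: df|exact: df'].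
- move=> i x x0 x1; apply: (Der_eq (DerB (dfx i x x0 x1) (dfx' i x x0 x1))).
  have -> : mulp p (fun i x => f i x - f' i x) i x = mulp p f i x - mulp p f' i x.
    by rewrite /mulp -sumrB; apply: eq_bigr => j _; rewrite mulrBr.
  by ring.
- by move=> i; have [-> ->] := f0 i; have [-> ->] := f0' i; rewrite subrr.
Qed.

Variable p : 'I_2 -> 'I_2 -> R -> R.
Hypothesis cp : forall i j, continuous (p i j).

Lemma green_weak w f fx g gx : (forall i, continuous (w i)) -> green p w f fx ->
  (forall i, continuous (g i)) -> (forall i, continuous (gx i)) ->
  (forall i x, 0 < x -> x < 1 -> Der (g i) x (gx i x)) ->
  ip w g = ip fx gx + ip (mulp p f) g.
Proof.
move=> cw [cf cfx df dfx f0] cg cgx dg.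
have cm := continuous_mulp cp cf.
have cfxx i : continuous (fun x => mulp p f i x - w i x) by cts.
have := @ip_parts _ f fx (fun i x => mulp p f i x - w i x) g gx cf cfx cfxx cg cgx dfx dg f0.
by rewrite ipBl// => H; lra.
Qed.

Lemma green_sym w f fx v g gx : (forall i j x, 0 <= x -> x <= 1 -> p i j x = p j i x) ->
  (forall i, continuous (w i)) -> (forall i, continuous (v i)) ->
  green p w f fx -> green p v g gx -> ip w g = ip f v.
Proof.
move=> sp cw cv gf gg; have [cf cfx df _ _] := gf; have [cg cgx dg _ _] := gg.
rewrite (green_weak cw gf cg cgx dg) [RHS]ipC (green_weak cv gg cf cfx df).
by rewrite (ip_mulp _ _ sp) (ipC fx) (ipC f).
Qed.

Variable k : R.
Hypothesis k1 : 1 <= k.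
Hypothesis coer : forall (u : 'I_2 -> R) x, 0 <= x -> x <= 1 ->
  k * \sum_i u i * u i <= \sum_i u i * \sum_j p i j x * u j.

Lemma green_energy w f fx : (forall i, continuous (w i)) -> green p w f fx ->
  k * ip f f + ip fx fx <= ip w f.
Proof.
move=> cw gf; have [cf cfx df _ _] := gf.
rewrite (green_weak cw gf cf cfx df) addrC lerD2l ipC /ip -IntZ; last by cts.
have cm := continuous_mulp cp cf.
by apply: le_Int => [| |x x0 x1]; [cts|cts|exact: coer].
Qed.

(** X, Y and W are the squared norms of f, f' and w, and Z is (w, f): the algebra that turns the
    energy inequality into bounds on f and f'. *)
Lemma energy_algebra (X Y Z W : R) : 0 <= X -> 0 <= Y -> 0 <= W -> k * X + Y <= Z -> Z ^+ 2 <= W * X ->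
  k ^+ 2 * X <= W /\ Y <= W.
Proof.
move=> X0 Y0 W0 E CS.
have k0 : 0 <= k by apply: le_trans k1.
have kX : 0 <= k * X by exact: mulr_ge0.
have Z0 : 0 <= Z by lra.
have H1 : (k * X) ^+ 2 <= Z ^+ 2 by rewrite lerXn2r ?nnegrE//; lra.
have H2 : Y ^+ 2 <= Z ^+ 2 by rewrite lerXn2r ?nnegrE//; lra.
have A : k ^+ 2 * X <= W.
  have [->|Xn] := eqVneq X 0; first by rewrite mulr0.
  have Xp : 0 < X by rewrite lt_neqAle eq_sym Xn.
  rewrite -(ler_pM2r Xp); apply: (le_trans _ CS); apply: (le_trans _ H1).
  by rewrite exprMn expr2 mulrA.
split=> //.
have XW : X <= W.
  by apply: (le_trans _ A); rewrite ler_peMl// expr_ge1.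
have : Y ^+ 2 <= W ^+ 2.
  by apply: (le_trans H2); apply: (le_trans CS); rewrite [W ^+ 2]expr2 ler_wpM2l.
by rewrite ler_pXn2r// nnegrE.
Qed.

Lemma green_bound w f fx : (forall i, continuous (w i)) -> green p w f fx ->
  k ^+ 2 * ip f f <= ip w w /\ ip fx fx <= ip w w.
Proof.
move=> cw gf; have [cf _ _ _ _] := gf.
apply: (energy_algebra (ip_ge0 f) (ip_ge0 fx) (ip_ge0 w) (green_energy cw gf)).
exact: ip_CauchySchwarz.
Qed.

Lemma Int_sqr_le_ip f i a b : 0 <= a -> a <= b -> b <= 1 -> (forall i, continuous (f i)) ->
  Int a b (fun x => f i x ^+ 2) <= ip f f.
Proof.
move=> a0 ab b1 cf.
have cs : continuous (fun x => \sum_i f i x * f i x) by cts.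
have s0 x : 0 <= \sum_i f i x * f i x by apply: sumr_ge0 => j _; rewrite -expr2 sqr_ge0.
rewrite /ip (Int_cat cs a0 (le_trans ab b1)) (Int_cat cs ab b1).
apply: (@le_trans _ _ (Int a b (fun x => \sum_i f i x * f i x))).
  apply: le_Int => [| |x _ _]; [by cts|exact: cs|].
  by rewrite (bigD1 i)//= expr2 lerDl; apply: sumr_ge0 => j _; rewrite -expr2 sqr_ge0.
have h1 : 0 <= Int 0 a (fun x => \sum_i f i x * f i x) by exact: Int_ge0.
have h2 : 0 <= Int b 1 (fun x => \sum_i f i x * f i x) by exact: Int_ge0.
lra.
Qed.

(** The derivative is bounded in L^2 by [w], and Cauchy-Schwarz on [x, y] gives Hoelder continuity
    of exponent 1/2: the equicontinuity behind the compactness of the Green operator. *)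
Lemma green_holder w f fx i x y : (forall i, continuous (w i)) -> green p w f fx ->
  0 <= x -> x <= y -> y <= 1 -> (f i y - f i x) ^+ 2 <= (y - x) * ip w w.
Proof.
move=> cw gf x0 xy y1; have [cf cfx df _ _] := gf.
have [_ B] := green_bound cw gf.
rewrite -(@FTC2 R (f i) (fx i) x y xy (cf i) (cfx i)); last first.
  by move=> z xz zy; apply: df; [exact: le_lt_trans xz|exact: lt_le_trans y1].
have c1 : continuous (fun _ : R => 1 : R) by cts.
have := @Int_CauchySchwarz R x y (fun=> 1) (fx i) c1 (cfx i).
have -> : Int x y (fun z => 1 * fx i z) = Int x y (fx i) by apply: eq_Int => z _ _; rewrite mul1r.
move/le_trans; apply.
have -> : Int x y (fun=> 1 ^+ 2) = y - x by rewrite expr1n Int_cst// mul1r.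
rewrite ler_wpM2l ?subr_ge0//; apply: le_trans B.
exact: Int_sqr_le_ip.
Qed.

(** The value at [x] is compared with the value at y by [green_holder], and the result is averaged
    over y. *)
Lemma green_sup w f fx i x : (forall i, continuous (w i)) -> green p w f fx ->
  0 <= x -> x <= 1 -> f i x ^+ 2 <= 4 * ip w w.
Proof.
move=> cw gf x0 x1; have [cf cfx df _ _] := gf.
have [A _] := green_bound cw gf.
have A' : ip f f <= ip w w.
  by apply: (le_trans _ A); rewrite ler_peMl ?ip_ge0// expr_ge1// (le_trans ler01).
have H y : 0 <= y -> y <= 1 -> f i x ^+ 2 <= 2 * f i y ^+ 2 + 2 * ip w w.
  move=> y0 y1.
  have D : (f i x - f i y) ^+ 2 <= ip w w.
    have [xy|yx] := leP x y.
      rewrite -sqrrN opprB; apply: (le_trans (green_holder i cw gf x0 xy y1)).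
      by rewrite ler_piMl ?ip_ge0//; lra.
    apply: (le_trans (green_holder i cw gf y0 (ltW yx) x1)).
    by rewrite ler_piMl ?ip_ge0//; lra.
  rewrite -subr_ge0; have -> : 2 * f i y ^+ 2 + 2 * ip w w - f i x ^+ 2 =
    2 * (ip w w - (f i x - f i y) ^+ 2) + (f i x - 2 * f i y) ^+ 2 by ring.
  by rewrite addr_ge0 ?sqr_ge0// mulr_ge0// subr_ge0.
have -> : f i x ^+ 2 = Int 0 1 (fun=> f i x ^+ 2) by rewrite Int_cst// subr0 mulr1.
apply: (@le_trans _ _ (Int 0 1 (fun y => 2 * f i y ^+ 2 + 2 * ip w w))).
  by apply: le_Int => //; cts.
rewrite IntD; [|by cts..].
rewrite IntZ; last by cts.
rewrite Int_cst// subr0 mulr1.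
have := @Int_sqr_le_ip f i 0 1 (lexx 0) ler01 (lexx 1) cf; lra.
Qed.

End GreenRelation.

(** * Explicit Green function for a constant scalar potential *)

Section ScalarGreen.
Context (R : realType).
Implicit Types (x y : R).
Variables (m : R) (w : R -> R).
Hypothesis m0 : 0 < m.
Hypothesis cw : continuous w.

(** Variation of constants: the kernel is cosh (m (1 - x)) cosh (m y) / (m sinh m) for y <= x, and
    symmetric. In the proof [ch] and [sh] are twice the hyperbolic functions, and [shE] is their
    addition formula, i.e. the Wronskian. *)
Lemma scalar_green : exists f fx : R -> R,
  [/\ continuous f /\ continuous fx, forall x, 0 < x -> x < 1 -> Der f x (fx x),
    forall x, 0 < x -> x < 1 -> Der fx x (m ^+ 2 * f x - w x) & fx 0 = 0 /\ fx 1 = 0].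
Proof.
pose ch x := expR (m * x) + expR (- (m * x)).
pose sh x := expR (m * x) - expR (- (m * x)).
have m0' := m0.
have cch : continuous ch by rewrite /ch; cts.
have csh : continuous sh by rewrite /sh; cts.
have dch x : Der ch x (m * sh x) by rewrite /ch /sh; der; ring.
have dsh x : Der sh x (m * ch x) by rewrite /ch /sh; der; ring.
have d1 x : Der (fun x => 1 - x) x (0 - 1) := DerB (Der_cst _ _) (Der_id _).
have dch1 x : Der (fun x => ch (1 - x)) x (m * sh (1 - x) * (0 - 1)).
  exact: (Der_comp (f := ch) (g := fun x => 1 - x) (dch _) (d1 x)).
have dsh1 x : Der (fun x => sh (1 - x)) x (m * ch (1 - x) * (0 - 1)).
  exact: (Der_comp (f := sh) (g := fun x => 1 - x) (dsh _) (d1 x)).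
have sh0 : sh 0 = 0 by rewrite /sh mulr0 oppr0 subrr.
have sh1 : 0 < sh 1 by rewrite subr_gt0 ltr_expR mulr1 gtrN.
have shE x : sh (1 - x) * ch x + sh x * ch (1 - x) = 2 * sh 1.
  rewrite /sh /ch.
  have -> : m * (1 - x) = m * 1 - m * x by ring.
  rewrite opprB !expRD !expRN.
  by field; rewrite !gt_eqF ?expR_gt0.
clearbody ch sh.
have c1w : continuous (fun y => ch y * w y) by have cw' := cw; cts.
have c2w : continuous (fun y => ch (1 - y) * w y) by have cw' := cw; cts.
pose A x := Int 0 x (fun y => ch y * w y).
pose B x := Int 0 x (fun y => ch (1 - y) * w y).
have cA : continuous A by exact: continuous_Int.
have cB : continuous B by exact: continuous_Int.
have dA x : 0 < x -> Der A x (ch x * w x) by move=> x0; exact: FTC1.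
have dB x : 0 < x -> Der B x (ch (1 - x) * w x) by move=> x0; exact: (FTC1 c2w).
have A0 : A 0 = 0 by exact: Int_eq0.
clearbody A B.
exists (fun x => (ch (1 - x) * A x + ch x * (B 1 - B x)) * (2 * m * sh 1)^-1).
exists (fun x => (sh x * (B 1 - B x) - sh (1 - x) * A x) * (2 * sh 1)^-1).
have s1 : sh 1 != 0 by rewrite gt_eqF.
have m1 : m != 0 by rewrite gt_eqF.
split; [by split; cts| | |].
- move=> x x0 x1; have DA := dA x x0; have DB := dB x x0.
  have D1 := dch1 x; have D2 := dch x.
  by der; field; rewrite m1 s1.
- move=> x x0 x1; have DA := dA x x0; have DB := dB x x0.
  have D1 := dsh1 x; have D2 := dsh x.
  have wE : w x = (sh (1 - x) * ch x + sh x * ch (1 - x)) * w x / (2 * sh 1).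
    by rewrite shE mulrC mulKf// mulf_neq0// pnatr_eq0.
  der; rewrite [X in _ = _ - X]wE.
  by field; rewrite m1 s1.
- by rewrite A0 !subrr sh0 !(mul0r, mulr0, subrr).
Qed.

End ScalarGreen.

(** * Compactness of the Green operator *)

Section GreenExistence.
Context (R : realType).
Implicit Types (f g h w v fx gx : 'I_2 -> R -> R) (x y s t e : R) (i j : 'I_2) (p : 'I_2 -> 'I_2 -> R -> R).

Lemma clamp_lip a b x y : `|clamp a b x - clamp a b y| <= `|x - y|.
Proof.
wlog xy : x y / x <= y => [H|].
  by have [/H//|/ltW/H] := leP x y; rewrite distrC (distrC y).
rewrite distrC (distrC x) [leRHS]ger0_norm ?subr_ge0// /clamp ler_norml.
case: (leP b x) => bx; case: (leP b y) => by'.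
- case: (leP a b) => ab; lra.
- lra.
- case: (leP a b) => ab; case: (leP a x) => ax; lra.
- case: (leP a x) => ax; case: (leP a y) => ay; lra.
Qed.

Lemma le_sqr_norm (a e : R) : 0 <= e -> a ^+ 2 <= e ^+ 2 -> `|a| <= e.
Proof. by move=> e0; rewrite -[a ^+ 2]real_normK ?num_real// ler_pXn2r ?nnegrE. Qed.

(** Bounded sources give solutions that are uniformly bounded and equi-Hoelder on [0, 1]; clamping
    the variable puts them in the form required by [ultra_unif_cvg]. *)
Lemma ultra_green p k (U : set_system nat) (w f fx : nat -> 'I_2 -> R -> R) M : UltraFilter U ->
  (forall i j, continuous (p i j)) -> 1 <= k ->
  (forall (u : 'I_2 -> R) x, 0 <= x -> x <= 1 -> k * \sum_i u i * u i <= \sum_i u i * \sum_j p i j x * u j) ->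
  (forall n i, continuous (w n i)) -> (forall n, green p (w n) (f n) (fx n)) ->
  (forall n, ip (w n) (w n) <= M) ->
  exists h, (forall i, continuous (h i)) /\
    forall e, 0 < e -> \forall n \near U, forall i x, 0 <= x -> x <= 1 -> `|f n i x - h i x| <= e.
Proof.
move=> UU cp k1 coer cw gf wM.
have M0 : 0 <= M := le_trans (ip_ge0 _) (wM 0%N).
have H i : exists hi : R -> R, continuous hi /\ forall e, 0 < e ->
    \forall n \near U, forall x, 0 <= x -> x <= 1 -> `|f n i x - hi x| <= e.
  have c01 x : 0 <= clamp (0 : R) 1 x /\ clamp (0 : R) 1 x <= 1 by rewrite clamp_ge clamp_le.
  have [||h ch hE] := @ultra_unif_cvg R U UU (fun n x => f n i (clamp 0 1 x)) (4 * M + 1).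
  - move=> n x; have [x0 x1] := c01 x.
    apply: le_sqr_norm; first by rewrite addr_ge0 ?mulr_ge0.
    apply: (le_trans (green_sup cp k1 coer i (cw n) (gf n) x0 x1)).
    have h1 := wM n; have h2 : 0 <= M * M by rewrite mulr_ge0.
    by rewrite sqrrD expr1n mulr1 exprMn expr2; lra.
  - move=> e e0; have M1 : 0 < M + 1 by rewrite ltr_wpDl.
    exists (e ^+ 2 / (M + 1)); first by apply: divr_gt0 => //; exact: exprn_gt0.
    move=> n x z; rewrite ltr_pdivlMr// => xz.
    apply: le_sqr_norm; first exact: ltW.
    have [x0 x1] := c01 x; have [z0 z1] := c01 z.
    have L := clamp_lip 0 1 x z.
    have D : (f n i (clamp 0 1 x) - f n i (clamp 0 1 z)) ^+ 2 <= `|clamp 0 1 x - clamp 0 1 z| * ip (w n) (w n).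
      have [zx|xz'] := leP (clamp 0 1 z) (clamp 0 1 x).
        by rewrite ger0_norm ?subr_ge0//; exact: (green_holder cp k1 coer i (cw n) (gf n)).
      have := green_holder cp k1 coer i (cw n) (gf n) x0 (ltW xz') z1.
      have zx0 : 0 <= clamp 0 1 z - clamp 0 1 x by rewrite subr_ge0 ltW.
      by rewrite distrC (ger0_norm zx0) -sqrrN opprB.
    apply: (le_trans D); apply: (le_trans _ (ltW xz)).
    apply: ler_pM => //; first exact: ip_ge0.
    by apply: (le_trans (wM n)); rewrite lerDl.
  exists h; split=> // e e0; apply: filterS (hE e e0) => n Hn x x0 x1.
  by have := Hn x x0 x1; rewrite clamp_id.
have /choice[h hE] := H.
exists h; split=> [i|e e0]; first by have [] := hE i.
have H0 := (hE ord0).2 e e0; have H1 := (hE (lift ord0 ord0)).2 e e0.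
apply: filterS (filterI H0 H1) => n [h0 h1] i x x0 x1.
by case: (unliftP ord0 i) => [j ->|->]; [rewrite (ord1 j); exact: h1|exact: h0].
Qed.

Lemma ip_sub_le f g : (forall i, continuous (f i)) -> (forall i, continuous (g i)) ->
  ip (fun i x => f i x - g i x) (fun i x => f i x - g i x) <= 2 * ip f f + 2 * ip g g.
Proof.
move=> cf cg.
have := ip_sub2 1 cf cg; have := ip_ge0 (fun i x => f i x - -1 * g i x).
rewrite (ip_sub2 (-1) cf cg) => H.
have -> : (fun i x => f i x - 1 * g i x) = (fun i x => f i x - g i x) by apply/funext => i; apply/funext => x; rewrite mul1r.
by move=> ->; move: H; lra.
Qed.

Lemma ip_unif e f : 0 <= e -> (forall i, continuous (f i)) ->
  (forall i x, 0 <= x -> x <= 1 -> `|f i x| <= e) -> ip f f <= 2 * e ^+ 2.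
Proof.
move=> e0 cf fe; rewrite /ip.
apply: (@le_trans _ _ (Int 0 1 (fun=> 2 * e ^+ 2))); last by rewrite Int_cst// subr0 mulr1.
apply: le_Int => [| |x x0 x1]; [by cts|by cts|].
rewrite (_ : 2 * e ^+ 2 = \sum_(i < 2) e ^+ 2); last by rewrite sumr_const card_ord mulr_natl.
apply: ler_sum => i _; rewrite -expr2 -[f i x ^+ 2]real_normK ?num_real//.
by rewrite ler_pXn2r ?nnegrE// fe.
Qed.

Lemma ip_mulp_le q b f : (forall i j x, `|q i j x| <= b) -> (forall i j, continuous (q i j)) ->
  (forall i, continuous (f i)) -> ip (mulp q f) (mulp q f) <= 4 * b ^+ 2 * ip f f.
Proof.
move=> qb cq cf; have cm := continuous_mulp cq cf.
rewrite /ip -IntZ; last by cts.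
apply: le_Int => [| |x x0 x1]; [by cts|by cts|].
have := @sum_sq_mulmx R (fun i j => q i j x) (fun j => f j x) b (fun i j => qb i j x).
by under eq_bigr do rewrite expr2; under [in leRHS]eq_bigr do rewrite expr2.
Qed.

Lemma mulpB q f g i x : mulp q (fun i x => f i x - g i x) i x = mulp q f i x - mulp q g i x.
Proof. by rewrite /mulp -sumrB; apply: eq_bigr => j _; rewrite mulrBr. Qed.

Definition shiftp (q : 'I_2 -> 'I_2 -> R -> R) (K : R) i j x : R := q i j x + K * (i == j)%:R.

Lemma mulp_shiftp q K f i x : mulp (shiftp q K) f i x = mulp q f i x + K * f i x.
Proof.
rewrite /mulp /shiftp; under eq_bigr do rewrite mulrDl.
rewrite big_split/=; congr (_ + _).
rewrite (bigD1 i)//= eqxx mulr1 big1 ?addr0// => j /negbTE ij.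
by rewrite eq_sym ij mulr0 mul0r.
Qed.

End GreenExistence.

(** * Existence of Green solutions for a bounded potential *)

Section GreenIteration.
Context (R : realType).
Implicit Types (f g h w v fx gx : 'I_2 -> R -> R) (x y s t e : R) (i j : 'I_2) (p : 'I_2 -> 'I_2 -> R -> R).

Lemma scalar_green2 (m : R) w : 0 < m -> (forall i, continuous (w i)) ->
  exists F : ('I_2 -> R -> R) * ('I_2 -> R -> R), green (shiftp (fun _ _ _ => 0) (m ^+ 2)) w F.1 F.2.
Proof.
move=> m0 cw.
have /choice[F HF] i : exists F : (R -> R) * (R -> R),
  [/\ continuous F.1 /\ continuous F.2, forall x, 0 < x -> x < 1 -> Der F.1 x (F.2 x),
    forall x, 0 < x -> x < 1 -> Der F.2 x (m ^+ 2 * F.1 x - w i x) & F.2 0 = 0 /\ F.2 1 = 0].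
  by have [f [fx H]] := scalar_green m0 (cw i); exists (f, fx).
exists (fun i => (F i).1, fun i => (F i).2); split=> /=.
- by move=> i; have [[]] := HF i.
- by move=> i; have [[]] := HF i.
- by move=> i; have [] := HF i.
- move=> i x x0 x1; rewrite mulp_shiftp {1}/mulp big1 ?add0r => [|j _]; last by rewrite mul0r.
  by have [_ _ + _] := HF i; apply.
- by move=> i; have [] := HF i.
Qed.

Lemma shiftp_coercive q (b K : R) (u : 'I_2 -> R) x : (forall i j, `|q i j x| <= b) ->
  (K - 2 * b) * \sum_i u i * u i <= \sum_i u i * \sum_j shiftp q K i j x * u j.
Proof.
move=> qb.
have b0 : 0 <= b := le_trans (normr_ge0 _) (qb ord0 ord0).
have -> : \sum_i u i * \sum_j shiftp q K i j x * u j = \sum_i u i * \sum_j q i j x * u j + K * \sum_i u i * u i.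
  rewrite mulr_sumr -big_split/=; apply: eq_bigr => i _.
  have := mulp_shiftp q K (fun i _ => u i) i x; rewrite /mulp => ->; ring.
rewrite mulrBl [leLHS]addrC lerD2r.
rewrite !big_ord_recl !big_ord0 !addr0.
have B i j (s t : R) : - (b * (s * s + t * t) / 2) <= s * (q i j x * t).
  have : `|s * (q i j x * t)| <= b * (s * s + t * t) / 2.
    rewrite mulrCA normrM normrM.
    apply: (@le_trans _ _ (b * (`|s| * `|t|))); first by rewrite ler_wpM2r ?mulr_ge0.
    rewrite -mulrA ler_wpM2l// -!expr2 -(real_normK (num_real s)) -(real_normK (num_real t)).
    by have := sqr_ge0 (`|s| - `|t|); rewrite sqrrB; lra.
  by rewrite ler_norml => /andP[].
set o := ord0; set l := lift _ _.
have := B o o (u o) (u o); have := B o l (u o) (u l); have := B l o (u l) (u o); have := B l l (u l) (u l).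
rewrite !mulrDr -!mulrA; set q1 := q _ _ _; set q2 := q _ _ _; set q3 := q _ _ _; set q4 := q _ _ _.
lra.
Qed.

(** The shift K = (4 b + 1)^2 is a square because [scalar_green] inverts - f'' + m^2 f. For squared
    norms the iteration contracts by 4 b^2 / K^2 <= 1/2, and 1 + 8 b^2 <= K^2 keeps the iterates in
    the ball of [iter_bound1]. *)
Lemma iter_const (b : R) : 0 <= b -> 1 + 8 * b ^+ 2 <= (4 * b + 1) ^+ 2 ^+ 2.
Proof.
move=> b0; have b2 : 0 <= b ^+ 2 by exact: sqr_ge0.
have h : 1 + 8 * b ^+ 2 <= (4 * b + 1) ^+ 2.
  have -> : (4 * b + 1) ^+ 2 = 1 + 8 * b ^+ 2 + 8 * (b ^+ 2 + b) by ring.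
  by rewrite lerDl mulr_ge0// addr_ge0.
apply: (le_trans h); rewrite expr2 ler_peMl//.
  by apply: le_trans h; rewrite addr_ge0// mulr_ge0.
by apply: le_trans h; rewrite lerDl mulr_ge0.
Qed.

Lemma iter_bound1 (b W X Y : R) : 0 <= b -> 0 <= W -> X <= 4 * W -> (4 * b + 1) ^+ 2 ^+ 2 * Y <= 2 * W + 2 * (4 * b ^+ 2 * X) -> Y <= 4 * W.
Proof.
move=> b0 W0 XW H.
have b2 : 0 <= b ^+ 2 by exact: sqr_ge0.
have K1 := iter_const b0.
have K0 : 0 < (4 * b + 1) ^+ 2 ^+ 2 by apply: lt_le_trans K1; rewrite ltr_pwDl// mulr_ge0.
rewrite -(ler_pM2l K0); apply: (le_trans H).
apply: (le_trans _ (ler_wpM2r _ K1)); last by rewrite mulr_ge0.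
have := ler_wpM2l b2 XW; lra.
Qed.

Lemma iter_bound2 (b X Y : R) : 0 <= b -> 0 <= X -> (4 * b + 1) ^+ 2 ^+ 2 * Y <= 4 * b ^+ 2 * X -> Y <= X / 2.
Proof.
move=> b0 X0 H.
have b2 : 0 <= b ^+ 2 by exact: sqr_ge0.
have K1 := iter_const b0.
have K0 : 0 < (4 * b + 1) ^+ 2 ^+ 2 by apply: lt_le_trans K1; rewrite ltr_pwDl// mulr_ge0.
rewrite -(ler_pM2l K0); apply: (le_trans H).
have h : 0 <= X / 2 by rewrite divr_ge0.
by apply: (le_trans _ (ler_wpM2r h K1)); lra.
Qed.

Section Iteration.
Variables (q : 'I_2 -> 'I_2 -> R -> R) (b : R) (w : 'I_2 -> R -> R).
Hypothesis b0 : 0 <= b.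
Hypothesis cq : forall i j, continuous (q i j).
Hypothesis qb : forall i j x, `|q i j x| <= b.
Hypothesis cw : forall i, continuous (w i).

Let p0 : 'I_2 -> 'I_2 -> R -> R := shiftp (fun _ _ _ => 0) ((4 * b + 1) ^+ 2).

(* The fixed-point iteration f = G0 (w - q f), where G0 inverts - f'' + (4 b + 1)^2 f, contracts in L^2. *)
Lemma green_exists : exists f fx, green (shiftp q ((4 * b + 1) ^+ 2)) w f fx.
Proof.
have b0' := b0; have cw' := cw.
have m0 : 0 < 4 * b + 1 by rewrite ltr_wpDl// mulr_ge0.
have K1 : 1 <= (4 * b + 1) ^+ 2.
  by have := sqr_ge0 b; rewrite sqrrD expr1n exprMn; lra.
have cp0 i j : continuous (p0 i j) by rewrite /p0 /shiftp; cts.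
have coer (u : 'I_2 -> R) x : 0 <= x -> x <= 1 ->
    (4 * b + 1) ^+ 2 * \sum_i u i * u i <= \sum_i u i * \sum_j p0 i j x * u j.
  move=> _ _; have := @shiftp_coercive (fun _ _ _ => 0) 0 ((4 * b + 1) ^+ 2) u x.
  by rewrite mulr0 subr0; apply=> i j; rewrite normr0.
have [G GE] : exists G : ('I_2 -> R -> R) -> ('I_2 -> R -> R) * ('I_2 -> R -> R),
    forall v, (forall i, continuous (v i)) -> green p0 v (G v).1 (G v).2.
  have H v : exists F : ('I_2 -> R -> R) * ('I_2 -> R -> R), (forall i, continuous (v i)) -> green p0 v F.1 F.2.
    have [cv|ncv] := pselect (forall i, continuous (v i)); last by exists (v, v).
    by have [F HF] := scalar_green2 m0 cv; exists F.
  by have /choice[G HG] := H; exists G.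
pose T f := fun i x => w i x - mulp q f i x.
pose f n := iter n (fun f => (G (T f)).1) (fun _ _ => 0).
have cT g : (forall i, continuous (g i)) -> forall i, continuous (T g i).
  by move=> cg i; have cm := continuous_mulp cq cg; rewrite /T; cts.
have cf n i : continuous (f n i).
  elim: n i => [|n IH] i; first by rewrite /f/=; cts.
  by have [H _ _ _ _] := GE _ (cT _ IH); exact: H.
have gf n : green p0 (T (f n)) (f n.+1) (G (T (f n))).2 := GE _ (cT _ (cf n)).
have bd v g gx := @green_bound R p0 cp0 _ K1 coer v g gx.
have W0 : 0 <= ip w w := ip_ge0 w.
have TM g : (forall i, continuous (g i)) -> ip (T g) (T g) <= 2 * ip w w + 2 * (4 * b ^+ 2 * ip g g).
  move=> cg; have cm := continuous_mulp cq cg.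
  apply: (le_trans (ip_sub_le cw cm)); rewrite lerD2l ler_pM2l//.
  exact: ip_mulp_le.
have X4 n : ip (f n) (f n) <= 4 * ip w w.
  elim: n => [|n IH].
    rewrite /f/= /ip (@eq_Int R 0 1 _ (fun=> 0)) ?Int_cst ?mul0r ?mulr_ge0// => x _ _.
    by rewrite big1// => i _; rewrite mul0r.
  apply: (iter_bound1 b0 W0 IH).
  by apply: le_trans (TM _ (cf n)); have [] := bd _ _ _ (cT _ (cf n)) (gf n).
have dif_bound g h gg hh ggx hhx : (forall i, continuous (g i)) -> (forall i, continuous (h i)) ->
    green p0 (T g) gg ggx -> green p0 (T h) hh hhx ->
    ip (fun i x => gg i x - hh i x) (fun i x => gg i x - hh i x) <=
    ip (fun i x => g i x - h i x) (fun i x => g i x - h i x) / 2.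
  move=> cg ch Gg Gh; have [cgg _ _ _ _] := Gg; have [chh _ _ _ _] := Gh.
  have cgh i : continuous (fun x => g i x - h i x) by cts.
  apply: (iter_bound2 b0 (ip_ge0 _)).
  have cTgh i : continuous (fun x => T g i x - T h i x).
    by have c1 := cT _ cg; have c2 := cT _ ch; cts.
  have [+ _] := bd _ _ _ cTgh (green_sub Gg Gh).
  move=> /le_trans; apply.
  apply: (le_trans _ (ip_mulp_le qb cq cgh)).
  rewrite le_eqVlt; apply/orP; left; apply/eqP.
  by apply: eq_Int => x _ _; apply: eq_bigr => i _; rewrite /T mulpB; ring.
pose d n := ip (fun i x => f n.+1 i x - f n i x) (fun i x => f n.+1 i x - f n i x).
have dS n : d n.+1 <= d n / 2 by exact: dif_bound (cf n.+1) (cf n) (gf n.+1) (gf n).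
have dn n : d n <= d 0%N / 2 ^+ n.
  elim: n => [|n IH]; first by rewrite expr0 divr1.
  by apply: (le_trans (dS n)); rewrite exprSr invfM mulrA ler_pM2r.
have dsmall e : 0 < e -> \forall n \near \oo, d n <= e.
  move=> e0.
  have c2 : `|2^-1| < 1 :> R by rewrite ger0_norm ?invf_lt1 ?invr_ge0// ltr1n.
  have d00 : 0 <= d 0%N := ip_ge0 _.
  have eC : 0 < e / (d 0%N + 1) by rewrite divr_gt0// ltr_wpDl.
  have /cvgrPdist_le /(_ _ eC) := @cvg_expr R 2^-1 c2.
  apply: filterS => n; rewrite sub0r normrN ger0_norm ?exprn_ge0 ?invr_ge0// => H.
  apply: (le_trans (dn n)); rewrite -exprVn.
  apply: (le_trans (ler_wpM2l d00 H)).
  by rewrite mulrA ler_pdivrMr ?ltr_wpDl// [_ * e]mulrC ler_pM2l// lerDl.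
have [U [UU sU]] := ultra_nat.
have PU : ProperFilter U by exact: ultra_proper.
have TB n : ip (T (f n)) (T (f n)) <= 2 * ip w w + 2 * (4 * b ^+ 2 * (4 * ip w w)).
  apply: (le_trans (TM _ (cf n))); rewrite lerD2l ler_pM2l// ler_wpM2l//.
  by rewrite mulr_ge0// sqr_ge0.
(* Compactness replaces completeness of L^2: [h] is the uniform limit of the iterates, and its image
   [P] under one more iteration is compared with it through the iterate [f n.+2]. Then [P = h] on
   [0, 1] and [P] is a solution. *)
have [h [ch hE]] := ultra_green UU cp0 K1 coer (fun n => cT _ (cf n)) gf TB.
have gP := GE _ (cT _ ch); set P := (G (T h)).1 in gP; set Px := (G (T h)).2 in gP.
have [cP cPx dP dPx P01] := gP.
have hP0 : ip (fun i x => h i x - P i x) (fun i x => h i x - P i x) <= 0.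
  apply/ler_addgt0Pr => e e0; rewrite add0r.
  pose e1 := Num.min 1 (e / 32).
  have e10 : 0 < e1 by rewrite lt_min ltr01 divr_gt0.
  have e11 : e1 <= 1 by rewrite ge_min lexx.
  have e12 : e1 <= e / 32 by rewrite ge_min lexx orbT.
  move: e1 e10 e11 e12 => e1 e10 e11 e12.
  have e8 : 0 < e / 16 by rewrite divr_gt0.
  have [n [/= Hn dn1]] := @filter_ex _ U PU _ (@filterI _ U _ _ _ (hE _ e10) (sU _ (dsmall _ e8))).
  have cd1 i : continuous (fun x => f n.+1 i x - h i x) by have c1 := cf n.+1; cts.
  have A : ip (fun i x => f n.+1 i x - h i x) (fun i x => f n.+1 i x - h i x) <= e / 16.
    apply: (le_trans (ip_unif (ltW e10) cd1 Hn)).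
    have : e1 ^+ 2 <= e1 by rewrite expr2 ler_piMl// ltW.
    by move: e12; lra.
  have B := dif_bound _ _ _ _ _ _ (cf n.+1) ch (gf n.+1) gP.
  have B' : ip (fun i x => f n.+2 i x - P i x) (fun i x => f n.+2 i x - P i x) <= e / 16.
    by apply: (le_trans B); apply: le_trans A; rewrite ler_pdivrMr// ler_peMr ?ip_ge0// ler1n.
  have {}dn1 : d n.+1 <= e / 16 by apply: (le_trans (dS n)); have : 0 <= d n := ip_ge0 _; lra.
  have c1 := cf n.+1; have c2 := cf n.+2.
  have C1 : ip (fun i x => f n.+2 i x - h i x) (fun i x => f n.+2 i x - h i x) <= e / 4.
    have -> : (fun i x => f n.+2 i x - h i x) = (fun i x => (f n.+2 i x - f n.+1 i x) - (h i x - f n.+1 i x)).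
      by apply/funext => i; apply/funext => x; ring.
    have cu i : continuous (fun x => f n.+2 i x - f n.+1 i x) by cts.
    have cv i : continuous (fun x => h i x - f n.+1 i x) by cts.
    apply: (le_trans (ip_sub_le cu cv)).
    have : ip (fun i x => h i x - f n.+1 i x) (fun i x => h i x - f n.+1 i x) <= e / 16.
      apply: le_trans A; rewrite le_eqVlt; apply/orP; left; apply/eqP.
      by apply: eq_Int => x _ _; apply: eq_bigr => i _; ring.
    by move: dn1; rewrite /d; lra.
  have -> : (fun i x => h i x - P i x) = (fun i x => (f n.+2 i x - P i x) - (f n.+2 i x - h i x)).
    by apply/funext => i; apply/funext => x; ring.
  have cu i : continuous (fun x => f n.+2 i x - P i x) by cts.
  have cv i : continuous (fun x => f n.+2 i x - h i x) by cts.
  apply: (le_trans (ip_sub_le cu cv)).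
  by move: B' C1; lra.
have hP i x : 0 <= x -> x <= 1 -> h i x = P i x.
  move=> x0 x1; apply/eqP; rewrite -subr_eq0; apply/eqP.
  have cd j : continuous (fun x => h j x - P j x) by cts.
  apply: (@ip_eq0 R (fun j x => h j x - P j x)) => //.
  by apply/eqP; rewrite eq_le hP0 ip_ge0.
exists P, Px; split=> // i x x0 x1.
apply: (Der_eq (dPx i x x0 x1)).
rewrite !mulp_shiftp [mulp (fun _ _ _ => 0) _ _ _]big1 ?add0r => [|j _]; last by rewrite mul0r.
rewrite /T; have -> : mulp q h i x = mulp q P i x.
  by apply: eq_bigr => j _; rewrite hP// ltW.
by ring.
Qed.

End Iteration.

End GreenIteration.

(** * Eigenvectors in invariant subspaces *)

Section GreenEigen.
Context (R : realType).
Implicit Types (f g h w v fx gx : 'I_2 -> R -> R) (x y s t e c : R) (i j : 'I_2).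

(** Arithmetic for [green_eigen]: F, q and K stand for the squared norm of G k_n, the pairing (k_n,
    G k_n) and the squared norm of k_n, and r is 1 / (n + 1), the distance to the supremum. *)
Lemma quad_le (mu F q K r : R) : F <= mu * q -> mu ^+ 2 * K <= mu ^+ 2 -> mu * r <= r ->
  mu ^+ 2 - mu * r <= mu * q -> F - 2 * (mu * q) + mu ^+ 2 * K <= r.
Proof. lra. Qed.

Lemma half_le (mu q r : R) : mu - r < q -> r <= mu ^+ 2 / 32 -> mu ^+ 2 <= mu -> 0 < mu -> mu / 2 <= q.
Proof. lra. Qed.

Lemma half_contra (mu F q K X r : R) : X <= 2 * r ^+ 2 -> F <= 2 * X -> q ^+ 2 <= K * F -> K * F <= F ->
  (mu / 2) ^+ 2 <= q ^+ 2 -> r ^+ 2 <= mu ^+ 2 / 32 -> 0 < mu ^+ 2 -> False.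
Proof. rewrite expr_div_n; lra. Qed.

Lemma sum_small (A B C D E F r e : R) : A <= 2 * r ^+ 2 -> B <= r -> C <= 2 * B + 2 * A -> D <= C ->
  E <= 2 * D + 2 * F -> F <= A -> r ^+ 2 <= r -> r <= e / 16 -> E <= e.
Proof. lra. Qed.

Lemma Der_uniq (f : R -> R) x l m : Der f x l -> Der f x m -> l = m.
Proof. by move=> d1 d2; rewrite -(@derive_val _ _ _ _ _ _ _ d1) (@derive_val _ _ _ _ _ _ _ d2). Qed.

Lemma ip_scale2 c f g : (forall i, continuous (f i)) -> (forall i, continuous (g i)) ->
  ip (fun i x => c * f i x) (fun i x => c * g i x) = c ^+ 2 * ip f g.
Proof.
move=> cf cg; rewrite ipZl//; last by move=> i; cts.
by rewrite ipC ipZl// expr2 mulrA (ipC g).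
Qed.

Lemma ip_scale c f : (forall i, continuous (f i)) ->
  ip (fun i x => c * f i x) (fun i x => c * f i x) = c ^+ 2 * ip f f.
Proof. by move=> cf; exact: ip_scale2. Qed.

Lemma green_scale p c w f fx : green p w f fx ->
  green p (fun i x => c * w i x) (fun i x => c * f i x) (fun i x => c * fx i x).
Proof.
move=> [cf cfx df dfx f0]; split; [by move=> i; cts|by move=> i; cts|..].
- by move=> i x x0 x1; have D := df i x x0 x1; der; ring.
- move=> i x x0 x1; have D := dfx i x x0 x1; der.
  have -> : mulp p (fun i x => c * f i x) i x = c * mulp p f i x.
    by rewrite /mulp mulr_sumr; apply: eq_bigr => j _; ring.
  by ring.
- by move=> i; have [-> ->] := f0 i; rewrite mulr0.
Qed.

Variable p : 'I_2 -> 'I_2 -> R -> R.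
Hypothesis cp : forall i j, continuous (p i j).
Hypothesis sp : forall i j x, 0 <= x -> x <= 1 -> p i j x = p j i x.
Hypothesis coer : forall (u : 'I_2 -> R) x, 0 <= x -> x <= 1 ->
  1 * \sum_i u i * u i <= \sum_i u i * \sum_j p i j x * u j.
Hypothesis green_ex : forall w, (forall i, continuous (w i)) -> exists f fx, green p w f fx.

(** If (w, G w) were 0, the energy inequality would give G w = 0, and then the equation would give w
    = 0. *)
Lemma green_form_gt0 w f fx : (forall i, continuous (w i)) -> green p w f fx -> 0 < ip w w -> 0 < ip w f.
Proof.
move=> cw gf w0; have [cf cfx df dfx _] := gf.
have E := green_energy cp coer cw gf.
have F0 := ip_ge0 f; have Fx0 := ip_ge0 fx.
rewrite lt_neqAle; apply/andP; split; last by lra.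
apply: contraTneq w0 => wf0; rewrite -leNgt.
have f00 : ip f f = 0 by lra.
have fz i x : 0 < x -> x < 1 -> f i x = 0 by move=> x0 x1; apply: (ip_eq0 _ cf f00); exact: ltW.
have fxz i x : 0 < x -> x < 1 -> fx i x = 0.
  move=> x0 x1; apply: (Der_uniq (df i x x0 x1)).
  by apply: (Der_local x0 x1 _ (Der_cst 0 x)) => y y0 y1; rewrite fz.
have wz i x : 0 < x -> x < 1 -> w i x = 0.
  move=> x0 x1.
  have : mulp p f i x - w i x = 0.
    apply: (Der_uniq (dfx i x x0 x1)).
    by apply: (Der_local x0 x1 _ (Der_cst 0 x)) => y y0 y1; rewrite fxz.
  by rewrite /mulp big1 ?sub0r => [/eqP|j _]; [rewrite oppr_eq0 => /eqP|rewrite fz// mulr0].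
have wz' i x : 0 <= x -> x <= 1 -> w i x = 0.
  by move=> x0 x1; apply: continuous_interior => // y y0 y1; exact: wz.
rewrite /ip (@eq_Int R 0 1 _ (fun=> 0)) ?Int_cst ?mul0r// => x x0 x1.
by rewrite big1// => i _; rewrite wz' // mul0r.
Qed.

(** The form (G k, l) is symmetric by [green_sym] and nonnegative by the energy inequality. *)
Lemma green_form_CauchySchwarz k f fx l g gx : (forall i, continuous (k i)) -> (forall i, continuous (l i)) ->
  green p k f fx -> green p l g gx -> ip f l ^+ 2 <= ip k f * ip l g.
Proof.
move=> ck cl gf gg; have [cf _ _ _ _] := gf; have [cg _ _ _ _] := gg.
have pos w u ux : (forall i, continuous (w i)) -> green p w u ux -> 0 <= ip w u.
  move=> cw gu; have := green_energy cp coer cw gu.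
  by have := ip_ge0 u; have := ip_ge0 ux; lra.
apply: discriminant_le => [|t]; first exact: pos cl gg.
have ckl i : continuous (fun x => k i x - t * l i x) by cts.
have ctl i : continuous (fun x => t * l i x) by cts.
have ctg i : continuous (fun x => t * g i x) by cts.
have cfg i : continuous (fun x => f i x - t * g i x) by cts.
have := pos _ _ _ ckl (green_sub gf (green_scale t gg)).
rewrite ipBl// ipZl// ![ip _ (fun i x => f i x - _)]ipC !ipBl// !ipZl//.
by rewrite (ipC f k) (ipC g k) (green_sym cp sp ck cl gf gg) (ipC g l); lra.
Qed.

(** [N] stands for a subspace invariant under the Green operator and closed under uniform limits; of
    linearity, only scaling is required. *)
Variable N : ('I_2 -> R -> R) -> Prop.
Hypothesis N_green : forall k f fx, (forall i, continuous (k i)) -> N k -> green p k f fx -> N f.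
Hypothesis N_scale : forall k c, (forall i, continuous (k i)) -> N k -> N (fun i x => c * k i x).
Hypothesis N_lim : forall h, (forall i, continuous (h i)) ->
  (forall e, 0 < e -> exists f, [/\ N f, forall i, continuous (f i) &
    forall i x, 0 <= x -> x <= 1 -> `|f i x - h i x| <= e]) -> N h.

Let val (r : R) := exists k f fx, [/\ forall i, continuous (k i), N k, green p k f fx, ip k k <= 1 & r = ip k f].

Lemma green_form_le (mu : R) k f fx : 0 < mu -> (forall r, val r -> r <= mu) ->
  (forall i, continuous (k i)) -> N k -> green p k f fx -> ip k f <= mu * ip k k.
Proof.
move=> mu0 valmu ck Nk gf; have [cf _ _ _ _] := gf.
have [k0|kn] := eqVneq (ip k k) 0.
  have := ip_CauchySchwarz ck cf; rewrite k0 mul0r mulr0 => H.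
  have : ip k f ^+ 2 == 0 by rewrite eq_le H sqr_ge0.
  by rewrite expf_eq0/= => /eqP ->.
have kp : 0 < ip k k by rewrite lt_neqAle eq_sym kn ip_ge0.
pose c := (Num.sqrt (ip k k))^-1.
have c2 : c ^+ 2 = (ip k k)^-1 by rewrite /c exprVn sqr_sqrtr ?ip_ge0.
have cck i : continuous (fun x => c * k i x) by cts.
have ccf i : continuous (fun x => c * f i x) by cts.
have := valmu (c ^+ 2 * ip k f).
rewrite c2 mulrC ler_pdivrMr//; apply.
exists (fun i x => c * k i x), (fun i x => c * f i x), (fun i x => c * fx i x).
split=> //; first exact: N_scale.
- exact: green_scale.
- by rewrite ip_scale// c2 mulVf.
- by rewrite ip_scale2// c2 mulrC.
Qed.

(* A maximizing sequence of (G k, k) on the unit ball of N has G k_n - mu k_n -> 0, since G^2 <= mu G;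
   compactness of G turns it into an eigenvector. *)
Lemma green_eigen k : (forall i, continuous (k i)) -> N k -> 0 < ip k k ->
  exists f fx mu, [/\ 0 < mu, N f, 0 < ip f f & green p (fun i x => mu * f i x) f fx].
Proof.
move=> ck Nk k0.
have val_le1 r : val r -> r <= 1.
  move=> [l [f [fx [cl Nl gf l1 ->]]]]; have [cf _ _ _ _] := gf.
  have [F _] := green_bound cp (lexx 1) coer cl gf; rewrite expr1n mul1r in F.
  have CS := ip_CauchySchwarz cl cf.
  have : ip l f ^+ 2 <= 1 ^+ 2.
    apply: (le_trans CS); rewrite expr1n; apply: mulr_ile1; rewrite ?ip_ge0//; exact: le_trans F l1.
  by move/(le_sqr_norm ler01); apply: le_trans; exact: ler_norm.
have [f0 [f0x gf0]] := green_ex ck.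
have [cf0 _ _ _ _] := gf0.
pose c := (Num.sqrt (ip k k))^-1.
have c2 : c ^+ 2 = (ip k k)^-1 by rewrite /c exprVn sqr_sqrtr ?ip_ge0.
have c2p : 0 < c ^+ 2 by rewrite c2 invr_gt0.
have v0 : val (c ^+ 2 * ip k f0).
  have cck i : continuous (fun x => c * k i x) by cts.
  have ccf i : continuous (fun x => c * f0 i x) by cts.
  exists (fun i x => c * k i x), (fun i x => c * f0 i x), (fun i x => c * f0x i x).
  split=> //; first exact: N_scale.
  - exact: green_scale.
  - by rewrite ip_scale// c2 mulVf// gt_eqF.
  - by rewrite ip_scale2.
have vp : 0 < c ^+ 2 * ip k f0 by rewrite mulr_gt0//; exact: green_form_gt0 gf0 k0.
have hsup : has_sup val by split; [exists (c ^+ 2 * ip k f0)|exists 1 => r /val_le1].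
pose mu := sup val.
have valmu r : val r -> r <= mu by move=> vr; exact: (sup_upper_bound hsup).
have mu0 : 0 < mu by apply: (lt_le_trans vp); exact: valmu.
have mu1 : mu <= 1 by apply: ge_sup => [|r /val_le1//]; exists (c ^+ 2 * ip k f0).
have seq n : exists F : ('I_2 -> R -> R) * (('I_2 -> R -> R) * ('I_2 -> R -> R)),
  [/\ forall i, continuous (F.1 i), N F.1, green p F.1 F.2.1 F.2.2, ip F.1 F.1 <= 1 & mu - n.+1%:R^-1 < ip F.1 F.2.1].
  have n0 : 0 < n.+1%:R^-1 :> R by rewrite invr_gt0.
  have [r [l [f [fx [cl Nl gf l1 ->]]]] rmu] := sup_adherent n0 hsup.
  by exists (l, (f, fx)).
have /choice[F HF] := seq.
pose kn n := (F n).1; pose fn n := (F n).2.1; pose fxn n := (F n).2.2.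
have ckn n : forall i, continuous (kn n i) by have [] := HF n.
have Nkn n : N (kn n) by have [] := HF n.
have gfn n : green p (kn n) (fn n) (fxn n) by have [] := HF n.
have kn1 n : ip (kn n) (kn n) <= 1 by have [] := HF n.
have knmu n : mu - n.+1%:R^-1 < ip (kn n) (fn n) by have [] := HF n.
have cfn n : forall i, continuous (fn n i) by have [] := gfn n.
have Nfn n : N (fn n) := N_green (ckn n) (Nkn n) (gfn n).
clearbody kn fn fxn mu; clear HF F seq.
(* Cauchy-Schwarz for the form of G gives |G k|^4 <= (k, G k) (G k, G G k), and the last factor is
   at most mu |G k|^2 because G k belongs to [N]. *)
have fn2 n : ip (fn n) (fn n) <= mu * ip (kn n) (fn n).
  have [g [gx gg]] := green_ex (cfn n).
  have := green_form_CauchySchwarz (ckn n) (cfn n) (gfn n) gg.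
  have H := green_form_le mu0 valmu (cfn n) (Nfn n) gg.
  have q0 : 0 <= ip (kn n) (fn n).
    have := green_energy cp coer (ckn n) (gfn n).
    by have := ip_ge0 (fn n); have := ip_ge0 (fxn n); lra.
  move=> CS; have := le_trans CS (ler_wpM2l q0 H).
  have [->|fz] := eqVneq (ip (fn n) (fn n)) 0; first by rewrite mulr_ge0// ltW.
  have fp : 0 < ip (fn n) (fn n) by rewrite lt_neqAle eq_sym fz ip_ge0.
  by rewrite expr2 mulrA ler_pM2r// [_ * mu]mulrC.
have dn n : ip (fun i x => fn n i x - mu * kn n i x) (fun i x => fn n i x - mu * kn n i x) <= n.+1%:R^-1.
  rewrite ip_sub2// (ipC (fn n) (kn n)).
  have A := fn2 n; have B := knmu n.
  have C : mu ^+ 2 * ip (kn n) (kn n) <= mu ^+ 2 by rewrite ler_piMr// sqr_ge0.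
  have n0 : 0 <= n.+1%:R^-1 :> R by rewrite invr_ge0.
  have D : mu * n.+1%:R^-1 <= n.+1%:R^-1 by rewrite ler_piMl.
  have E := ler_wpM2l (ltW mu0) (ltW B); rewrite mulrBr -expr2 in E.
  move: A C D E; rewrite -(mulrA 2 mu).
  exact: quad_le.
have [U [UU sU]] := ultra_nat.
have PU : ProperFilter U by exact: ultra_proper.
have [h [ch hE]] := ultra_green UU cp (lexx 1) coer ckn gfn kn1.
have pick e : 0 < e -> exists n, n.+1%:R^-1 <= e /\ forall i x, 0 <= x -> x <= 1 -> `|fn n i x - h i x| <= e.
  move=> e0.
  have [n [/= Hn ne]] := @filter_ex _ U PU _ (@filterI _ U _ _ _ (hE _ e0) (sU _ (near_infty_natSinv_lt (PosNum e0)))).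
  by exists n; split=> //; exact: ltW.
have Nh : N h.
  by apply: N_lim => // e e0; have [n [_ Hn]] := pick e e0; exists (fn n).
have [H [Hx gH]] := green_ex ch; have [cH _ _ _ _] := gH.
have NH : N H := N_green ch Nh gH.
have close n i : continuous (fun x => fn n i x - h i x) by have c1 := cfn n; cts.
have hn0 : 0 < ip h h.
  (* If [h] were 0, G k_n would be uniformly small, whereas (k_n, G k_n) stays above mu / 2. With
     accuracy mu^2 / 32 the squared norm of G k_n falls below mu^2 / 4. *)
  rewrite lt_neqAle ip_ge0 andbT eq_sym; apply/eqP => h0.
  have m4 : 0 < mu ^+ 2 / 32 by rewrite divr_gt0// exprn_gt0.
  have m32 : mu ^+ 2 / 32 <= 1 by rewrite ler_pdivrMr// expr2; have := mulr_ile1 (ltW mu0) (ltW mu0) mu1 mu1; lra.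
  have [n [n1 Hn]] := pick _ m4.
  have A := ip_unif (ltW m4) (close n) Hn.
  have e2 : (mu ^+ 2 / 32) ^+ 2 <= mu ^+ 2 / 32 by rewrite [leLHS]expr2 ler_piMl// ltW.
  have nh i : continuous (fun x => -1 * h i x) by cts.
  have B := ip_sub_le (close n) nh.
  rewrite (_ : (fun i x => (fn n i x - h i x) - (-1 * h i x)) = fn n) in B; last first.
    by apply/funext => i; apply/funext => x; ring.
  rewrite ip_scale// h0 !mulr0 addr0 in B.
  have C := ip_CauchySchwarz (ckn n) (cfn n).
  have D : ip (kn n) (kn n) * ip (fn n) (fn n) <= ip (fn n) (fn n) by rewrite ler_piMl ?ip_ge0.
  have mm : mu ^+ 2 <= mu by rewrite expr2 ler_piMl// ltW.
  have E : mu / 2 <= ip (kn n) (fn n) by exact: half_le (knmu n) n1 mm mu0.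
  have G : (mu / 2) ^+ 2 <= ip (kn n) (fn n) ^+ 2.
    by rewrite ler_pXn2r ?nnegrE//; [exact: divr_ge0 (ltW mu0) _|apply: le_trans E; exact: divr_ge0 (ltW mu0) _].
  have P := exprn_gt0 2 mu0.
  exact: (half_contra A B C D G e2 P).
(* [h] is close to G k_n, hence to mu k_n. Applying G, which does not increase norms, [H] is close
   to mu G k_n, hence to mu h. *)
have HE : ip (fun i x => H i x - mu * h i x) (fun i x => H i x - mu * h i x) <= 0.
  apply/ler_addgt0Pr => e e0; rewrite add0r.
  pose e1 := Num.min 1 (e / 16).
  have e10 : 0 < e1 by rewrite lt_min ltr01 divr_gt0.
  have e11 : e1 <= 1 by rewrite ge_min lexx.
  have e12 : e1 <= e / 16 by rewrite ge_min lexx orbT.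
  move: e1 e10 e11 e12 => e1 e10 e11 e12.
  have [n [n1 Hn]] := pick _ e10.
  have cfn' := cfn n; have ckn' := ckn n.
  have A := ip_unif (ltW e10) (close n) Hn.
  have e2 : e1 ^+ 2 <= e1 by rewrite expr2 ler_piMl// ltW.
  have B := le_trans (dn n) n1.
  have cu i : continuous (fun x => fn n i x - mu * kn n i x) by cts.
  have C := ip_sub_le cu (close n).
  have Ch : (fun i x => (fn n i x - mu * kn n i x) - (fn n i x - h i x)) = fun i x => h i x - mu * kn n i x.
    by apply/funext => i; apply/funext => x; ring.
  rewrite Ch in C.
  have chk i : continuous (fun x => h i x - mu * kn n i x) by cts.
  have [D _] := green_bound cp (lexx 1) coer chk (green_sub gH (green_scale mu (gfn n))).
  rewrite expr1n mul1r in D.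
  have cHf i : continuous (fun x => H i x - mu * fn n i x) by cts.
  have cmf i : continuous (fun x => - mu * (fn n i x - h i x)) by cts.
  have E := ip_sub_le cHf cmf.
  have Eh : (fun i x => (H i x - mu * fn n i x) - (- mu * (fn n i x - h i x))) = fun i x => H i x - mu * h i x.
    by apply/funext => i; apply/funext => x; ring.
  rewrite Eh ip_scale// sqrrN in E.
  have mA : mu ^+ 2 * ip (fun i x => fn n i x - h i x) (fun i x => fn n i x - h i x) <= ip (fun i x => fn n i x - h i x) (fun i x => fn n i x - h i x).
    by rewrite ler_piMl ?ip_ge0// expr2 mulr_ile1// ltW.
  exact: (sum_small A B C D E mA e2 e12).
have HmE i x : 0 <= x -> x <= 1 -> h i x = mu^-1 * H i x.
  move=> x0 x1; have cd j : continuous (fun x => H j x - mu * h j x) by cts.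
  have := @ip_eq0 R (fun j x => H j x - mu * h j x) i x cd _ x0 x1.
  have -> : ip (fun j x => H j x - mu * h j x) (fun j x => H j x - mu * h j x) = 0 by apply/eqP; rewrite eq_le HE ip_ge0.
  by move=> /(_ erefl)/eqP; rewrite subr_eq0 => /eqP ->; rewrite mulKf// gt_eqF.
(* The vector returned is [H = G h], which comes with its derivatives; [h] is only a continuous
   limit, equal to mu^-1 H on [0, 1]. *)
exists H, Hx, mu^-1; split=> //; first by rewrite invr_gt0.
- have : ip h h = mu^-1 ^+ 2 * ip H H by rewrite -ip_scale//; apply: eq_ip => i x x0 x1; exact: HmE.
  by move=> E; move: hn0; rewrite E pmulr_rgt0// exprn_gt0// invr_gt0.
- have [? ? ? D ?] := gH; split=> // i x x0 x1.
  by have := D i x x0 x1; rewrite HmE// ltW.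
Qed.

End GreenEigen.

(** * Density of the flow *)

Section Flow.
Context (R : realType).
Implicit Types (f g h w v fx gx k : 'I_2 -> R -> R) (x s t e c B : R) (i j : 'I_2).

Lemma sub_half_le (a d e : R) : a <= e / 2 -> - (e / 2) <= d -> a - d <= e.
Proof. lra. Qed.

Lemma filter_cvg_unique (T : Type) (F : set_system T) (a : T -> R) (l1 l2 : R) : ProperFilter F ->
  a n @[n --> F] --> l1 -> a n @[n --> F] --> l2 -> l1 = l2.
Proof. by move=> FF; exact: norm_cvg_unique. Qed.

(** The equation gives h(s) = h(0) exp s, which is bounded only if h(0) = 0. *)
Lemma exp_bounded0 (h : R -> R) B : continuous h -> (forall s, 0 < s -> Der h s (h s)) ->
  (forall s, 0 <= s -> h s ^+ 2 <= B) -> forall s, 0 <= s -> h s = 0.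
Proof.
move=> ch dh hB.
pose g s := expR (- s) * h s.
have cg : continuous g by rewrite /g; cts.
have hE s : 0 <= s -> h s = h 0 * expR s.
  move=> s0; have : g s = g 0.
    apply: eq_of_Der0 => // t t0 ts; have D := dh t t0.
    by rewrite /g; der; ring.
  rewrite /g oppr0 expR0 mul1r => <-.
  by rewrite mulrAC -expRD addNr expR0 mul1r.
have h0 : h 0 = 0.
  apply/eqP; apply: contraT => hn.
  have hp : 0 < h 0 ^+ 2 by rewrite lt_neqAle sqr_ge0 andbT eq_sym expf_eq0.
  have B0 : 0 <= B := le_trans (sqr_ge0 _) (hB 0 (lexx 0)).
  have s0 : 0 <= B / h 0 ^+ 2 by rewrite divr_ge0// ltW.
  have := hB _ s0; rewrite hE// exprMn.
  have E : 1 + B / h 0 ^+ 2 <= expR (B / h 0 ^+ 2) := expR_ge1Dx _.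
  have E1 : 1 <= expR (B / h 0 ^+ 2) by apply: le_trans E; rewrite lerDl.
  have E2 : 1 + B / h 0 ^+ 2 <= expR (B / h 0 ^+ 2) ^+ 2.
    by apply: (le_trans E); rewrite expr2 ler_peMl// ltW ?expR_gt0.
  have := ler_wpM2l (ltW hp) E2.
  rewrite mulrDr mulr1 mulrC divfK ?gt_eqF// => H1 H2.
  have := le_trans H1 H2; rewrite gerDr => H3.
  by have := lt_le_trans hp H3; rewrite ltxx.
by move=> s s0; rewrite hE// h0 mul0r.
Qed.

Variables (q : 'I_2 -> 'I_2 -> R -> R) (b c : R).
Hypothesis c0 : 0 < c.
Hypothesis cq : forall i j, continuous (q i j).
Hypothesis qb : forall i j x, `|q i j x| <= b.
Hypothesis sq : forall i j x, 0 <= x -> x <= 1 -> q i j x = q j i x.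

(** Two shifts of the potential: the flow uses [p1], whose form is nonnegative, so that norms
    decrease; the Green operator is that of [p], larger by the identity and hence coercive with
    constant 1. [K] is the shift of [green_exists]. *)
Let K := (4 * b + 1) ^+ 2.
Let p := shiftp q K.
Let p1 := shiftp q (K - 1).

Let b0 : 0 <= b. Proof. exact: le_trans (normr_ge0 _) (qb ord0 ord0 0). Qed.

Let cp i j : continuous (p i j). Proof. by have cq' := cq; rewrite /p /shiftp; cts. Qed.
Let cp1 i j : continuous (p1 i j). Proof. by have cq' := cq; rewrite /p1 /shiftp; cts. Qed.
Let sp i j x : 0 <= x -> x <= 1 -> p i j x = p j i x.
Proof. by move=> x0 x1; rewrite /p /shiftp sq// eq_sym. Qed.
Let sp1 i j x : 0 <= x -> x <= 1 -> p1 i j x = p1 j i x.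
Proof. by move=> x0 x1; rewrite /p1 /shiftp sq// eq_sym. Qed.

Let Kb : 2 * b + 1 <= K.
Proof. by have h := b0; have := sqr_ge0 b; rewrite /K sqrrD expr1n exprMn; lra. Qed.

Let coer (u : 'I_2 -> R) x : 0 <= x -> x <= 1 ->
  1 * \sum_i u i * u i <= \sum_i u i * \sum_j p i j x * u j.
Proof.
move=> _ _; apply: le_trans (@shiftp_coercive R q b K u x (fun i j => qb i j x)).
apply: ler_wpM2r; first by apply: sumr_ge0 => i _; rewrite -expr2 sqr_ge0.
by have := Kb; lra.
Qed.

Let pos1 (u : 'I_2 -> R) x : 0 <= x -> x <= 1 -> 0 <= \sum_i u i * \sum_j p1 i j x * u j.
Proof.
move=> _ _; apply: le_trans (@shiftp_coercive R q b (K - 1) u x (fun i j => qb i j x)).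
apply: mulr_ge0; last by apply: sumr_ge0 => i _; rewrite -expr2 sqr_ge0.
by have := Kb; lra.
Qed.

Variables (y yt yx yxx : 'I_2 -> R -> R -> R).
Hypothesis hy : gsol p1 c y yt yx yxx.

Let cs (u : 'I_2 -> R -> R -> R) s : (forall i, continuous (fun p : R * R => u i p.1 p.2)) ->
  forall i, continuous (u i ^~ s).
Proof. by move=> cu i; cts. Qed.

Lemma Der_flow k s : (forall i, continuous (k i)) -> - c < s ->
  Der (fun s => ip k (fun i x => y i x s)) s (ip k (fun i x => yt i x s)).
Proof.
move=> ck s0; have [[cy cyt _ _] Dt _ _] := hy.
apply: (@Der_Int R (fun x t => \sum_i k i x * y i x t) (fun x t => \sum_i k i x * yt i x t) 0 1 (- c) (s + 1)) => //.
- by cts.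
- by cts.
- by rewrite ltrDl.
move=> x t x0 x1 t0 _; have D i : Der (y i x) t (yt i x t) by exact: Dt.
by der; apply: eq_bigr => i _; rewrite mul0r add0r.
Qed.

Lemma continuous_flow k : (forall i, continuous (k i)) -> continuous (fun s => ip k (fun i x => y i x s)).
Proof.
move=> ck; have [[cy _ _ _] _ _ _] := hy.
by apply: (@continuous_Int_slice R (fun x t => \sum_i k i x * y i x t)); cts.
Qed.

(** With A = - d^2/dx^2 + p the flow satisfies y_t = y - A y, and (f, A y) = (w, y) because A f =
    w. *)
Lemma green_flow w f fx s : (forall i, continuous (w i)) -> green p w f fx -> - c < s ->
  ip f (fun i x => yt i x s) = ip f (fun i x => y i x s) - ip w (fun i x => y i x s).
Proof.
move=> cw gf s0; have [[cy cyt cyx cyxx] Dt Dx yx0] := hy; have [cf cfx df _ _] := gf.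
rewrite ipC (ip_yt cp1 hy s0 cf).
rewrite (@ip_parts R (fun i x => y i x s) (fun i x => yx i x s) _ f fx) //; try exact: cs.
- rewrite (green_weak cp cw gf (@cs _ s cy) (@cs _ s cyx)); last first.
    by move=> i x x0 x1; have [] := Dx i x s x0 x1 s0.
  rewrite (ipC fx) (ip_mulp _ _ sp1) (ip_mulp _ _ sp).
  have -> : mulp p (fun i x => y i x s) = fun i x => mulp p1 (fun i x => y i x s) i x + y i x s.
    by apply/funext => i; apply/funext => x; rewrite !mulp_shiftp; ring.
  rewrite [ip f (fun i x => mulp p1 _ i x + _)]ipC ipDl; [|exact: (continuous_mulp cp1 (@cs _ s cy))|exact: cs|by []].
  rewrite (ipC (fun i x => y i x s) (mulp p1 f)) (ip_mulp _ _ sp1) (ipC (mulp p1 _)) (ipC (fun i x => y i x s) f).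
  by ring.
- by move=> i x x0 x1; have [] := Dx i x s x0 x1 s0.
- by move=> i; exact: yx0.
Qed.

(* The hypothesis makes s |-> (k, y(s)) a multiple of exp, whereas the flow is bounded. *)
Lemma flow_growth k : (forall i, continuous (k i)) ->
  (forall s, 0 < s -> ip k (fun i x => yt i x s) = ip k (fun i x => y i x s)) ->
  forall s, 0 <= s -> ip k (fun i x => y i x s) = 0.
Proof.
move=> ck E; have [[cy _ _ _] _ _ _] := hy; have c0' := c0.
apply: (@exp_bounded0 (fun s => ip k (fun i x => y i x s)) (ip k k * ip (fun i x => y i x 0) (fun i x => y i x 0))).
- exact: continuous_flow.
- by move=> s s0; rewrite -[X in Der _ _ X]E//; apply: Der_flow => //; lra.
- move=> s s0; apply: (le_trans (ip_CauchySchwarz ck (@cs _ s cy))).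
  by rewrite ler_wpM2l ?ip_ge0//; exact: (norm_anti c0 cp1 pos1 hy).
Qed.

(** The form in which the generating property enters; it is discharged by [generating_total]. *)
Hypothesis eig : forall f fx (mu : R), 0 < mu -> green p (fun i x => mu * f i x) f fx ->
  (forall s, 0 <= s -> ip f (fun i x => y i x s) = 0) -> ip f f = 0.

Lemma flow_total k : (forall i, continuous (k i)) ->
  (forall s, 0 <= s -> ip k (fun i x => y i x s) = 0) -> ip k k = 0.
Proof.
move=> ck Nk; have [[cy _ _ _] _ _ _] := hy.
apply/eqP; apply: contraT => kn.
have kp : 0 < ip k k by rewrite lt_neqAle eq_sym kn ip_ge0.
have ex w : (forall i, continuous (w i)) -> exists f fx, green p w f fx by move=> cw; exact: green_exists.
have [|||f [fx [mu [mu0 Nf fp gf]]]] := @green_eigen R p cp sp coer ex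
    (fun k => forall s, 0 <= s -> ip k (fun i x => y i x s) = 0) _ _ _ k ck Nk kp.
- move=> l f fx cl Nl gf s s0; have [cf _ _ _ _] := gf; have c0' := c0.
  apply: flow_growth => // r r0.
  by rewrite (green_flow cl gf) ?Nl ?subr0//; [exact: ltW|lra].
- by move=> l a cl Nl s s0; rewrite ipZl ?Nl ?mulr0//; exact: cs.
- move=> h ch H s s0.
  set Y := fun i x => y i x s.
  have cY : forall i, continuous (Y i) by exact: cs.
  have H2 : ip h Y ^+ 2 <= 0.
    apply/ler_addgt0Pr => e e0; rewrite add0r.
    have Y0 := ip_ge0 Y.
    have d0 : 0 < e / (2 * (ip Y Y + 1)) by rewrite divr_gt0// mulr_gt0// ltr_wpDl.
    pose d := Num.min 1 (e / (2 * (ip Y Y + 1))).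
    have dp : 0 < d by rewrite lt_min ltr01.
    have d1 : d <= 1 by rewrite ge_min lexx.
    have d2 : d <= e / (2 * (ip Y Y + 1)) by rewrite ge_min lexx orbT.
    have [f [Nf cf fh]] := H d dp.
    have cfh i : continuous (fun x => f i x - h i x) by cts.
    have -> : ip h Y ^+ 2 = ip (fun i x => f i x - h i x) Y ^+ 2.
      by rewrite ipBl// Nf// sub0r sqrrN.
    apply: (le_trans (ip_CauchySchwarz cfh cY)).
    have A := ip_unif (ltW dp) cfh fh.
    have dd : d ^+ 2 <= d by rewrite expr2 ler_piMl// ltW.
    apply: (@le_trans _ _ (2 * d * ip Y Y)).
      by rewrite ler_wpM2r//; apply: (le_trans A); rewrite ler_pM2l.
    apply: (@le_trans _ _ (2 * d * (ip Y Y + 1))).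
      by rewrite ler_wpM2l ?mulr_ge0 ?(ltW dp)// lerDl.
    move: d2; rewrite ler_pdivlMr; last by rewrite mulr_gt0// ltr_wpDl.
    by rewrite mulrA [d * 2]mulrC.
  by apply/eqP; rewrite -sqrf_eq0 eq_le H2 sqr_ge0.
by move: fp; rewrite (eig mu0 gf Nf) ltxx.
Qed.

Lemma flow_total_interval k T : 0 < T -> (forall i, continuous (k i)) ->
  (forall s, 0 <= s -> s < T -> ip k (fun i x => y i x s) = 0) -> ip k k = 0.
Proof.
move=> T0 ck H; apply: flow_total => //.
apply: (functional_continuation c0 cp1 sp1 pos1 hy (L := ip k) (B := ip k k)) T0 H.
- exact: ip_ge0.
- by move=> f g cf cg; rewrite ipC ipBl// !(ipC k).
- by move=> f cf; exact: ip_CauchySchwarz.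
Qed.

Definition comb (l : seq (R * R)) : 'I_2 -> R -> R := fun i x => \sum_(z <- l) z.1 * y i x z.2.

Lemma continuous_comb l i : continuous (comb l i).
Proof. by have [[cy _ _ _] _ _ _] := hy; rewrite /comb; cts. Qed.

Lemma comb_cat_scale t l1 l2 i x :
  comb (l1 ++ [seq (t * z.1, z.2) | z <- l2]) i x = comb l1 i x + t * comb l2 i x.
Proof.
rewrite /comb big_cat big_map mulr_sumr; congr (_ + _).
by apply: eq_bigr => z _; rewrite /= mulrA.
Qed.

Lemma ultra_ip_cvg (U : set_system nat) (f : nat -> 'I_2 -> R -> R) h g : UltraFilter U ->
  (forall n i, continuous (f n i)) -> (forall i, continuous (h i)) -> (forall i, continuous (g i)) ->
  (forall e, 0 < e -> \forall n \near U, forall i x, 0 <= x -> x <= 1 -> `|f n i x - h i x| <= e) ->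
  ip (f n) g @[n --> U] --> ip h g.
Proof.
move=> UU cf ch cg fh; apply/cvgrPdist_le => e e0.
have G0 := ip_ge0 g.
pose d := e / (2 * (ip g g + 1)).
have d0 : 0 < d by rewrite divr_gt0// mulr_gt0// ltr_wpDl.
apply: filterS (fh d d0) => n Hn.
have cfh i : continuous (fun x => f n i x - h i x) by have c1 := cf n; cts.
rewrite distrC -ipBl//.
apply: le_sqr_norm; first exact: ltW.
apply: (le_trans (ip_CauchySchwarz cfh cg)).
apply: (@le_trans _ _ (2 * d ^+ 2 * (ip g g + 1) ^+ 2)).
  apply: ler_pM; [exact: ip_ge0|by []|exact: ip_unif (ltW d0) cfh Hn|].
  by rewrite expr2; have : 0 <= ip g g * ip g g by [rewrite mulr_ge0]; lra.
have -> : 2 * d ^+ 2 * (ip g g + 1) ^+ 2 = e ^+ 2 / 2.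
  by rewrite /d; field; rewrite gt_eqF// ltr_wpDl.
by rewrite ler_pdivrMr// ler_peMr ?sqr_ge0// ler1n.
Qed.

(* The residuals r_n of a minimizing sequence of approximants converge weakly to a functional L that
   kills the flow; h = lim G r_n is then orthogonal to the flow, hence 0, so (r_n, f) = (G r_n, w) -> 0. *)
Lemma flow_dense w f fx T : 0 < T -> (forall i, continuous (w i)) -> green p w f fx ->
  forall e, 0 < e -> exists l, (forall z, z \in l -> 0 <= z.2 /\ z.2 < T) /\
    ip (fun i x => f i x - comb l i x) (fun i x => f i x - comb l i x) <= e.
Proof.
move=> T0 cw gf e e0; have [[cy cyt _ _] _ _ _] := hy; have [cf _ _ _ _] := gf; have c0' := c0.
pose adm (l : seq (R * R)) := forall z, z \in l -> 0 <= z.2 /\ z.2 < T.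
pose D l := ip (fun i x => f i x - comb l i x) (fun i x => f i x - comb l i x).
have adm_cat t l1 l2 : adm l1 -> adm l2 -> adm (l1 ++ [seq (t * z.1, z.2) | z <- l2]).
  move=> h1 h2 z; rewrite mem_cat => /orP[/h1//|/mapP[z' /h2 hz ->]]; exact: hz.
have hinf : has_inf [set D l | l in adm].
  split; first by exists (D [::]), [::].
  by exists 0 => _ [l _ <-]; exact: ip_ge0.
pose m := inf [set D l | l in adm].
have mle l : adm l -> m <= D l by move=> al; apply: (ge_inf hinf.2); exists l.
have seq n : exists l, adm l /\ D l < m + n.+1%:R^-1.
  have n0 : 0 < n.+1%:R^-1 :> R by rewrite invr_gt0.
  by have [_ [l al <-] Hl] := inf_adherent n0 hinf; exists l.
have /choice[ln Hl] := seq.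
pose r n : 'I_2 -> R -> R := fun i x => f i x - comb (ln n) i x.
have cr n i : continuous (r n i) by have c1 := @continuous_comb (ln n); rewrite /r; cts.
have rM n : ip (r n) (r n) <= m + 1.
  by apply: (le_trans (ltW (Hl n).2)); rewrite lerD2l invf_le1// ler1n.
(* Adding any multiple of an admissible combination to the n-th approximant cannot bring the squared
   distance below the infimum; the discriminant of this quadratic makes the residuals almost
   orthogonal to the flow. *)
have opt n l : adm l -> ip (r n) (comb l) ^+ 2 <= n.+1%:R^-1 * ip (comb l) (comb l).
  move=> al; have cl := @continuous_comb l.
  have H : ip (r n) (comb l) ^+ 2 <= (ip (r n) (r n) - m) * ip (comb l) (comb l).
    apply: discriminant_le => [|t]; first exact: ip_ge0.
    have := mle _ (adm_cat (t) _ _ (Hl n).1 al).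
    have -> : D (ln n ++ [seq (t * z.1, z.2) | z <- l]) = ip (fun i x => r n i x - t * comb l i x) (fun i x => r n i x - t * comb l i x).
      by apply: eq_ip => i x _ _; rewrite comb_cat_scale /r; ring.
    by rewrite ip_sub2//; lra.
  apply: (le_trans H); rewrite ler_wpM2r ?ip_ge0//.
  by rewrite lerBlDl; exact: ltW (Hl n).2.
have [U [UU sU]] := ultra_nat.
have PU : ProperFilter U by exact: ultra_proper.
have inv_small (d : R) : 0 < d -> U (fun n => n.+1%:R^-1 <= d).
  move=> d0; have H := sU _ (near_infty_natSinv_lt (PosNum d0)).
  by apply: (@filterS nat U _ _ _ _ H) => n /= /ltW.
(* The functional has to be defined on all functions; on discontinuous ones 0 is a placeholder. *)
have /choice[L LE] (g : 'I_2 -> R -> R) : exists l : R, (forall i, continuous (g i)) -> ip (r n) g @[n --> U] --> l.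
  have [cg|ncg] := pselect (forall i, continuous (g i)); last by exists 0.
  have [n|l Hl'] := @ultra_cvg R U UU (fun n => ip (r n) g) ((m + 1) * ip g g + 1); last by exists l.
  have B0 : 0 <= (m + 1) * ip g g by apply: mulr_ge0; [exact: le_trans (ip_ge0 _) (rM 0%N)|exact: ip_ge0].
  apply: le_sqr_norm; first by rewrite addr_ge0.
  apply: (le_trans (ip_CauchySchwarz (cr n) cg)).
  apply: (@le_trans _ _ ((m + 1) * ip g g)); first by rewrite ler_wpM2r ?ip_ge0.
  by rewrite sqrrD expr1n mulr1; have := sqr_ge0 ((m + 1) * ip g g); lra.
have L0 s : 0 <= s -> s < T -> L (fun i x => y i x s) = 0.
  move=> s0 sT; have cys := @cs _ s cy.
  have al : adm [:: (1, s)] by move=> z; rewrite inE => /eqP ->.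
  have ce : comb [:: (1, s)] = fun i x => y i x s.
    by apply/funext => i; apply/funext => x; rewrite /comb big_seq1 mul1r.
  apply: (filter_cvg_unique PU (LE _ cys)); apply/cvgrPdist_le => d d0.
  set Y := fun i x => y i x s; have Y0 := ip_ge0 Y.
  have dd : 0 < d ^+ 2 / (ip Y Y + 1) by apply: divr_gt0; [exact: exprn_gt0|rewrite ltr_wpDl].
  apply: (@filterS _ U _ _ _ _ (inv_small _ dd)) => n Hn; rewrite sub0r normrN.
  apply: le_sqr_norm; first exact: ltW.
  have := opt n _ al; rewrite ce => /le_trans; apply.
  apply: (le_trans (ler_wpM2r Y0 Hn)).
  by rewrite mulrAC ler_pdivrMr ?ltr_wpDl// ler_pM2l ?exprn_gt0// lerDl.
have LN s : 0 <= s -> L (fun i x => y i x s) = 0.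
  apply: (functional_continuation c0 cp1 sp1 pos1 hy (L := L) (B := m + 1)) T0 L0 s.
  - exact: le_trans (ip_ge0 _) (rM 0%N).
  - move=> g h cg ch; have cgh i : continuous (fun x => g i x - h i x) by cts.
    apply: (filter_cvg_unique PU (LE _ cgh)).
    have -> : (fun n => ip (r n) (fun i x => g i x - h i x)) = fun n => ip (r n) g - ip (r n) h.
      by apply/funext => n; rewrite ipC ipBl// !(ipC (r n)).
    by apply: cvgB; exact: LE.
  - move=> g cg.
    have C : ip (r n) g * ip (r n) g @[n --> U] --> L g * L g by apply: cvgM; exact: LE.
    rewrite expr2; apply: (cvgr_to_le C); apply: filterE => n.
    by rewrite -expr2; apply: (le_trans (ip_CauchySchwarz (cr n) cg)); rewrite ler_wpM2r ?ip_ge0.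
have ex g : exists F : ('I_2 -> R -> R) * ('I_2 -> R -> R), (forall i, continuous (g i)) -> green p g F.1 F.2.
  have [cg|ncg] := pselect (forall i, continuous (g i)); last by exists (g, g).
  by have [u [ux gu]] := green_exists b0 cq qb cg; exists (u, ux).
have /choice[G GE] := ex.
pose k n := (G (r n)).1.
have gk n : green p (r n) (k n) (G (r n)).2 := GE _ (cr n).
have ck n i : continuous (k n i) by have [H _ _ _ _] := gk n; exact: H.
have [h [ch hE]] := ultra_green UU cp (lexx 1) coer cr gk rM.
have hN s : 0 <= s -> ip h (fun i x => y i x s) = 0.
  apply: flow_growth => // {}s s0.
  have s1 : - c < s by lra.
  have cys := @cs _ s cy; have cyts := @cs _ s cyt.
  (* In the limit, [green_flow] for the pairs (r_n, k_n) reads (h, y_t) = (h, y) - L(y(s)), and the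
     last term is 0 by [LN]. *)
  apply: (filter_cvg_unique PU (ultra_ip_cvg UU ck ch cyts hE)).
  have -> : (fun n => ip (k n) (fun i x => yt i x s)) =
      fun n => ip (k n) (fun i x => y i x s) - ip (r n) (fun i x => y i x s).
    by apply/funext => n; exact: green_flow (cr n) (gk n) s1.
  rewrite -[X in _ --> X]subr0 -(LN s (ltW s0)).
  by apply: cvgB; [exact: ultra_ip_cvg|exact: LE].
have h0 : ip h w = 0.
  have hz := flow_total ch hN.
  have := ip_CauchySchwarz ch cw; rewrite hz mul0r => H.
  by apply/eqP; rewrite -sqrf_eq0 eq_le H sqr_ge0.
have rf : ip (r n) f @[n --> U] --> 0.
  rewrite -h0; have -> : (fun n => ip (r n) f) = fun n => ip (k n) w.
    by apply/funext => n; have E := @green_sym R p cp (r n) (k n) _ w f fx sp (cr n) cw (gk n) gf; exact: E.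
  exact: ultra_ip_cvg.
have e2 : 0 < e / 2 by rewrite divr_gt0.
have M0 : 0 <= m + 1 := le_trans (ip_ge0 _) (rM 0%N).
pose C := 2 * ip f f + 2 * (m + 1).
have C0 : 0 <= C by rewrite addr_ge0// mulr_ge0// ip_ge0.
have eC : 0 < (e / 2) ^+ 2 / (C + 1) by apply: divr_gt0; [exact: exprn_gt0|rewrite ltr_wpDl].
have /cvgrPdist_le /(_ _ e2) rfn := rf.
have [n [/= n1 n2]] := @filter_ex _ U PU _ (@filterI _ U _ _ _ rfn (inv_small _ eC)).
exists (ln n); split; first exact: (Hl n).1.
rewrite -/(r n).
have ccn := @continuous_comb (ln n).
(* The residual is [f] minus a combination: its pairing with [f] tends to 0 by [rf], and its pairing
   with the combination is small by [opt]. *)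
have -> : ip (r n) (r n) = ip (r n) f - ip (r n) (comb (ln n)).
  by rewrite [ip (r n) f]ipC [ip (r n) (comb _)]ipC -ipBl.
have H1 : ip (r n) f <= e / 2.
  by move: n1; rewrite sub0r normrN; apply: le_trans; exact: ler_norm.
have H2 : `|ip (r n) (comb (ln n))| <= e / 2.
  apply: le_sqr_norm; first exact: ltW.
  apply: (le_trans (opt n _ (Hl n).1)).
  have CB : ip (comb (ln n)) (comb (ln n)) <= C.
    have -> : comb (ln n) = fun i x => f i x - r n i x.
      by apply/funext => i; apply/funext => x; rewrite /r; ring.
    by apply: (le_trans (ip_sub_le cf (cr n))); rewrite lerD2l ler_pM2l.
  have n3 : 0 <= n.+1%:R^-1 :> R by rewrite invr_ge0.
  apply: (le_trans (ler_wpM2l n3 CB)).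
  apply: (le_trans (ler_wpM2r C0 n2)).
  by rewrite mulrAC ler_pdivrMr ?ltr_wpDl// ler_pM2l ?exprn_gt0// lerDl.
by move: H2; rewrite ler_norml => /andP[H2 _]; move: H1 H2; exact: sub_half_le.
Qed.

End Flow.

(** * Boundary traces *)

Section Transformations.
Context (R : realType).
Implicit Types (x s t r c d k : R) (i j : 'I_2) (p q : 'I_2 -> 'I_2 -> R -> R) (y yt yx yxx z zt zx zxx : 'I_2 -> R -> R -> R).

Lemma gsol_shift p c d y yt yx yxx : gsol p c y yt yx yxx ->
  gsol p (c + d) (fun i x s => y i x (s + d)) (fun i x s => yt i x (s + d))
    (fun i x s => yx i x (s + d)) (fun i x s => yxx i x (s + d)).
Proof.
move=> [[cy cyt cyx cyxx] Dt Dx yx0].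
have sh s : - (c + d) < s -> - c < s + d by lra.
split; first by split=> i; cts.
- move=> i x s x0 x1 cs.
  have D : Der (fun s => s + d) s (1 + 0) := DerD (Der_id s) (Der_cst d s).
  by have := Der_comp (f := y i x) (g := fun s => s + d) (Dt i x _ x0 x1 (sh _ cs)) D; rewrite addr0 mulr1.
- by move=> i x s x0 x1 cs; have [d1 d2 e1] := Dx i x _ x0 x1 (sh _ cs); split.
- by move=> i s cs; exact: yx0 (sh _ cs).
Qed.

(** An exponential factor in time adds a constant to the potential; this is how the flow is made
    dissipative. *)
Lemma gsol_exp p c k y yt yx yxx : gsol p c y yt yx yxx ->
  gsol (shiftp p k) c (fun i x s => expR (- k * s) * y i x s)
    (fun i x s => expR (- k * s) * (yt i x s - k * y i x s))
    (fun i x s => expR (- k * s) * yx i x s) (fun i x s => expR (- k * s) * yxx i x s).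
Proof.
move=> [[cy cyt cyx cyxx] Dt Dx yx0].
split; first by split=> i; cts.
- by move=> i x s x0 x1 cs; have D := Dt i x s x0 x1 cs; der; ring.
- move=> i x s x0 x1 cs; have [d1 d2 e1] := Dx i x s x0 x1 cs; split.
  + by der; ring.
  + by der; ring.
  have := mulp_shiftp p k (fun i x => expR (- k * s) * y i x s) i x.
  rewrite /mulp => ->; rewrite e1.
  have -> : \sum_j p i j x * (expR (- k * s) * y j x s) = expR (- k * s) * \sum_j p i j x * y j x s.
    by rewrite mulr_sumr; apply: eq_bigr => j _; ring.
  by ring.
- by move=> i s cs; have [-> ->] := yx0 i s cs; rewrite mulr0.
Qed.

Lemma gsol_comb p c c' (l : seq (R * R)) y yt yx yxx : gsol p c y yt yx yxx ->
  (forall m : R * R, m \in l -> c' <= c + m.2) ->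
  gsol p c' (fun i x s => \sum_(m <- l) m.1 * y i x (s + m.2)) (fun i x s => \sum_(m <- l) m.1 * yt i x (s + m.2))
    (fun i x s => \sum_(m <- l) m.1 * yx i x (s + m.2)) (fun i x s => \sum_(m <- l) m.1 * yxx i x (s + m.2)).
Proof.
move=> hy; elim: l => [|m l IH] lc.
  have E (g : R -> 'I_2 -> R -> R -> R) : (fun i x s => \sum_(m <- [::] : seq (R * R)) m.1 * g m.2 i x s) = fun _ _ _ => 0.
    by apply/funext => i; apply/funext => x; apply/funext => s; rewrite big_nil.
  rewrite !(E (fun d i x s => _ i x (s + d))).
  split; first by split=> i; cts.
  - by move=> i x s _ _ _; exact: Der_cst.
  - move=> i x s _ _ _; split; [exact: Der_cst|exact: Der_cst|].
    by rewrite big1 ?subrr// => j _; rewrite mulr0.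
  - by [].
have zl : c' <= c + m.2 by apply: lc; rewrite mem_head.
have {}IH := IH (fun m' m'l => lc m' (mem_behead (s := m :: l) m'l)).
have [[cy cyt cyx cyxx] Dt Dx yx0] := gsol_shift m.2 hy.
have [[by' byt byx byxx] Dt' Dx' yx0'] := IH.
have [cy' cyt' cyx' cyxx'] : [/\ forall i, continuous (fun p : R * R => y i p.1 p.2),
         forall i, continuous (fun p : R * R => yt i p.1 p.2),
         forall i, continuous (fun p : R * R => yx i p.1 p.2) &
         forall i, continuous (fun p : R * R => yxx i p.1 p.2)] by have [] := hy.
have sh s : - c' < s -> - (c + m.2) < s by lra.
have Dcons (g : R * R -> R -> R) a dz dl : Der (g m) a dz -> Der (fun t => \sum_(m' <- l) m'.1 * g m' t) a dl ->
    Der (fun t => \sum_(m' <- m :: l) m'.1 * g m' t) a (m.1 * dz + dl).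
  move=> D1 D2.
  have -> : (fun t => \sum_(m' <- m :: l) m'.1 * g m' t) = fun t => m.1 * g m t + \sum_(m' <- l) m'.1 * g m' t.
    by apply/funext => t; rewrite big_cons.
  by der; ring.
split; first by split=> i; cts.
- move=> i x s x0 x1 cs; rewrite big_cons; apply: (Dcons (fun m' s => y i x (s + m'.2))).
    exact: (Dt i x s x0 x1 (sh _ cs)).
  exact: Dt'.
- move=> i x s x0 x1 cs; have [d1 d2 e1] := Dx i x s x0 x1 (sh _ cs); have [d1' d2' e1'] := Dx' i x s x0 x1 cs.
  rewrite !big_cons; split.
  + exact: (Dcons (fun m' x => y i x (s + m'.2))).
  + exact: (Dcons (fun m' x => yx i x (s + m'.2))).
  rewrite e1 e1'.
  have -> : \sum_j p i j x * \sum_(m' <- m :: l) m'.1 * y j x (s + m'.2) =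
      m.1 * (\sum_j p i j x * y j x (s + m.2)) + \sum_j p i j x * \sum_(m' <- l) m'.1 * y j x (s + m'.2).
    by rewrite mulr_sumr -big_split; apply: eq_bigr => j _; rewrite /= big_cons; ring.
  by ring.
- move=> i s cs; have [e1 e2] := yx0 i s (sh _ cs); have [e1' e2'] := yx0' i s cs.
  by rewrite !big_cons e1 e2 e1' e2' mulr0 addr0.
Qed.

Lemma gsol_heat_on p c r y yt yx yxx : r < c -> gsol p c y yt yx yxx -> heat_on p r y yt yx yxx.
Proof.
move=> rc [C Dt Dx yx0]; split=> //.
- by move=> i x s x0 x1 rs _; apply: Dt => //; lra.
- by move=> i x s x0 x1 rs _; apply: Dx => //; lra.
- by move=> i s rs _; have [] := yx0 i s; lra.
Qed.

Lemma gsol_reflect_heat_on p c r y yt yx yxx : r < c -> gsol p c y yt yx yxx ->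
  heat_on (fun i j x => p i j (1 - x)) r (fun i x s => y i (1 - x) s) (fun i x s => yt i (1 - x) s)
    (fun i x s => - yx i (1 - x) s) (fun i x s => yxx i (1 - x) s).
Proof.
move=> rc [[cy cyt cyx cyxx] Dt Dx yx0].
have d1 x : Der (fun x => 1 - x) x (0 - 1) := DerB (Der_cst _ _) (Der_id _).
split; first by split=> i; cts.
- by move=> i x s x0 x1 rs _; apply: Dt; lra.
- move=> i x s x0 x1 rs _.
  have h0 : 0 < 1 - x by lra.
  have h1 : 1 - x < 1 by lra.
  have [D1 D2 e] := Dx i (1 - x) s h0 h1 ltac:(lra).
  split=> //.
  + by apply: (Der_eq (Der_comp (f := y i ^~ s) (g := fun x => 1 - x) D1 (d1 x))); ring.
  + by apply: (Der_eq (DerN (Der_comp (f := yx i ^~ s) (g := fun x => 1 - x) D2 (d1 x)))); ring.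
- by move=> i s rs _; have [_] := yx0 i s ltac:(lra); rewrite subr0 => ->; rewrite oppr0.
Qed.

Lemma Int_reflect a b (f : R -> R) : a <= b -> continuous f -> Int a b (fun x => f (1 - x)) = Int (1 - b) (1 - a) f.
Proof.
move=> ab cf.
pose F x := Int (1 - b - 1) x f.
have cF : continuous F by exact: continuous_Int.
have cf1 : continuous (fun x => f (1 - x)) by cts.
have -> : Int a b (fun x => f (1 - x)) = - F (1 - b) - - F (1 - a).
  apply: (@FTC2 R (fun x => - F (1 - x))) => //; first by cts.
  move=> x ax xb.
  have D : Der F (1 - x) (f (1 - x)) by apply: FTC1 => //; lra.
  have d1 : Der (fun x => 1 - x) x (0 - 1) := DerB (Der_cst _ _) (Der_id _).
  by apply: (Der_eq (DerN (Der_comp (f := F) (g := fun x => 1 - x) D d1))); ring.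
rewrite /F (@Int_cat R (1 - b - 1) (1 - b) (1 - a)) //; [ring|lra|lra].
Qed.

Lemma right_comparison p q c r l b y yt yx yxx z zt zx zxx i : 0 < r -> r < c ->
  0 < l -> l < 1 -> (forall i j, continuous (p i j)) -> (forall i j, continuous (q i j)) ->
  (forall i j x, `|p i j x| <= b) -> (forall i j x, `|q i j x| <= b) ->
  gsol p c y yt yx yxx -> gsol q c z zt zx zxx ->
  (forall i s, - r <= s -> s <= r -> y i 1 s = z i 1 s) ->
  (z i l 0 - y i l 0) ^+ 2 <= wave_const b * Int l 1 (fun x => \sum_i y i x 0 ^+ 2).
Proof.
move=> r0 rc l0 l1 cp cq pb qb hy hz yz.
have [[cy _ _ _] _ _ _] := hy.
have cp1 i' j : continuous (fun x => p i' j (1 - x)) by cts.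
have cq1 i' j : continuous (fun x => q i' j (1 - x)) by cts.
have := @left_comparison R _ _ r (1 - l) b _ _ _ _ _ _ _ _ i r0 _ _ cp1 cq1
  (fun i j x => pb i j _) (fun i j x => qb i j _) (gsol_reflect_heat_on rc hy) (gsol_reflect_heat_on rc hz).
rewrite subKr.
have -> : Int 0 (1 - l) (fun x => \sum_i y i (1 - x) 0 ^+ 2) = Int l 1 (fun x => \sum_i y i x 0 ^+ 2).
  rewrite (@Int_reflect 0 (1 - l) (fun x => \sum_i y i x 0 ^+ 2)); [|lra|by cts].
  by rewrite subr0 subKr.
by apply; [lra|lra|move=> j s rs sr; rewrite subr0; exact: yz].
Qed.

End Transformations.

(** * Square integrable functions and the initial value *)

Section L2Limit.
Context (R : realType).
Notation mu := (@lebesgue_measure R).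
Implicit Types (f g : R -> R) (a : R -> 'cV[R]_2).

Local Notation D := [set` `](0 : R), 1[].

Lemma continuous_integrable_oo f : continuous f -> mu.-integrable D (EFin \o f).
Proof.
move=> cf; apply: integrableS (continuous_integrable 0 1 cf) => //.
by move=> x; rewrite /= !in_itv/= => /andP[/ltW-> /ltW->].
Qed.

Lemma Int_oo f : continuous f -> \int[mu]_(x in D) f x = Int 0 1 f.
Proof.
move=> cf; rewrite /Int Rintegral_itv_bndo_bndc; last exact: continuous_integrable_oo.
rewrite Rintegral_itv_obnd_cbnd//.
apply: integrableS (continuous_integrable 0 1 cf) => //.
by apply: subset_itvr; rewrite bnd_simp.
Qed.

Lemma L2_01_continuous f : continuous f -> L2_01 f.
Proof.
move=> cf; rewrite /L2_01 inE; apply/andP; split; rewrite inE/=.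
  apply/measurable_restrict => //; rewrite setTI.
  by apply: measurable_funTS; exact: continuous_measurable_fun.
rewrite /finite_norm unlock poweR_lty//.
have cf2 : continuous (fun x => f x ^+ 2) by cts.
apply: (@le_lt_trans _ _ (\int[mu]_(x in D) (f x ^+ 2)%:E)%E); last first.
  exact: integrable_lty (continuous_integrable_oo cf2).
rewrite [leRHS]integral_mkcond le_eqVlt; apply/orP; left; apply/eqP.
apply: eq_integral => x _.
rewrite [X in X = _](_ : _ = (`|(f \_ D) x| `^ 2)%:E)// !patchE.
case: ifP => _; first by rewrite powR_mulrn// real_normK ?num_real.
by rewrite [point]/(0 : R) normr0 powR0.
Qed.

Lemma L2_mul_integrable f g : L2_01 f -> L2_01 g -> mu.-integrable D (EFin \o (fun x => f x * g x)).
Proof.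
move=> f2 g2; have := Lfun2_mul_Lfun1 f2 g2 => /Lfun1_integrable.
rewrite [X in _ -> X]integrable_mkcond//.
rewrite (_ : EFin \o _ = (EFin \o (fun x => f x * g x)) \_ D)//.
apply/funext => x; rewrite /= !patchE.
by case: ifP => _; rewrite ?mulr0.
Qed.

End L2Limit.

Section InnerLimit.
Context (R : realType).
Notation mu := (@lebesgue_measure R).
Implicit Types (x t e eta : R).
Local Notation D := [set` `](0 : R), 1[].

(** Young's inequality, from two completed squares, one for each sign. *)
Lemma norm_mul_le (a w k eta : R) : 0 < eta ->
  `|(a - w) * k| <= (2 * eta)^-1 * (w - a) ^+ 2 + eta / 2 * k ^+ 2.
Proof.
move=> e0.
have E (s : R) : s ^+ 2 = 1 -> (2 * eta)^-1 * (w - a) ^+ 2 + eta / 2 * k ^+ 2 - s * ((a - w) * k) =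
    (2 * eta)^-1 * (a - w - s * (eta * k)) ^+ 2.
  move=> s1; have -> : (a - w - s * (eta * k)) ^+ 2 =
    (w - a) ^+ 2 - 2 * s * eta * ((a - w) * k) + s ^+ 2 * eta ^+ 2 * k ^+ 2 by ring.
  rewrite s1.
  by field; rewrite gt_eqF.
have pos (y : R) : 0 <= (2 * eta)^-1 * y ^+ 2.
  by apply: mulr_ge0; [rewrite invr_ge0 mulr_ge0// ltW|exact: sqr_ge0].
have e1 := E 1 (expr1n _ _); have e2 := E (-1); rewrite sqrrN expr1n in e2; have {}e2 := e2 erefl.
have p1 := pos (a - w - 1 * (eta * k)); have p2 := pos (a - w - -1 * (eta * k)).
rewrite -e1 mul1r subr_ge0 in p1; rewrite -e2 mulN1r opprK in p2.
by rewrite ler_norml p1 andbT -subr_ge0 opprK addrC.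
Qed.

Lemma inner_limit0 (a : R -> 'cV[R]_2) (psi : R -> 'cV[R]_2) (w : R -> 'I_2 -> R -> R) :
  L2v a -> (forall i, continuous (fun x => psi x i 0)) ->
  (forall t i, 0 < t -> continuous (w t i)) ->
  (forall t, 0 < t -> ip (w t) (fun i x => psi x i 0) = 0) ->
  (\int[mu]_(x in D) (\sum_(i < 2) (w t i x - a x i 0) ^+ 2)%:E)%E @[t --> 0^'+] --> 0%E ->
  inner a psi = 0.
Proof.
move=> a2 cpsi cw wpsi wa.
apply/eqP; rewrite -normr_le0; apply/ler_addgt0Pr => e e0; rewrite add0r.
pose C := ip (fun i x => psi x i 0) (fun i x => psi x i 0).
have C0 : 0 <= C := ip_ge0 _.
(* This balances Young's inequality: eta C / 2 is at most e / 2, and so is the other term once the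
   squared distance of w(t) to the initial value is below eta e. *)
pose eta := e / (C + 1).
have eta0 : 0 < eta by rewrite divr_gt0// ltr_wpDl.
have ee0 : 0 < eta * e by exact: mulr_gt0.
pose S t x := \sum_(i < 2) (w t i x - a x i 0) ^+ 2.
have [t [t0 St]] : exists t, 0 < t /\ (\int[mu]_(x in D) (S t x)%:E < (eta * e)%:E)%E.
  have H1 : \forall t \near 0^'+, (\int[mu]_(x in D) (S t x)%:E < (eta * e)%:E)%E.
    have : nbhs (0%E : \bar R) [set y | (y < (eta * e)%:E)%E].
      by apply: (@open_nbhs_nbhs (\bar R)); split; [exact: open_ereal_lt_ereal|rewrite /= lte_fin].
    exact: wa.
  have H2 : \forall t \near (0 : R)^'+, 0 < t by exact: nbhs_right_gt.
  by have [t [h1 h2]] := filter_ex (filterI H2 H1); exists t.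
have cwt i := cw t i t0.
have iaa i j : mu.-integrable D (EFin \o (fun x => a x i 0 * a x j 0)) := L2_mul_integrable (a2 i) (a2 j).
have iap i : mu.-integrable D (EFin \o (fun x => a x i 0 * psi x i 0)) := L2_mul_integrable (a2 i) (L2_01_continuous (cpsi i)).
have iwa i : mu.-integrable D (EFin \o (fun x => w t i x * a x i 0)) := L2_mul_integrable (L2_01_continuous (cwt i)) (a2 i).
have iS : mu.-integrable D (EFin \o S t).
  have Hi i : mu.-integrable D (EFin \o (fun x => (w t i x - a x i 0) ^+ 2)).
    have cw2 : continuous (fun x => w t i x * w t i x) by cts.
    have := integrableD _ (continuous_integrable_oo cw2) (iaa i i).
    move=> /(_ (measurable_itv _)) H1.
    have := integrableB _ H1 (integrableZl _ 2 (iwa i)).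
    move=> /(_ (measurable_itv _) (measurable_itv _)).
    apply: eq_integrable => // x _ /=.
    by rewrite -!EFinD; congr (_%:E); rewrite !expr2; ring.
  have := integrableD _ (Hi ord0) (Hi (lift ord0 ord0)) => /(_ (measurable_itv _)).
  by apply: eq_integrable => // x _ /=; rewrite /S !big_ord_recl big_ord0 addr0 EFinD.
have cP : continuous (fun x => \sum_(i < 2) psi x i 0 ^+ 2) by cts.
have iP := continuous_integrable_oo cP.
pose G x := \sum_(i < 2) (a x i 0 - w t i x) * psi x i 0.
have iG : mu.-integrable D (EFin \o G).
  have Hi i : mu.-integrable D (EFin \o (fun x => (a x i 0 - w t i x) * psi x i 0)).
    have cwp : continuous (fun x => w t i x * psi x i 0) by cts.
    have := integrableB _ (iap i) (continuous_integrable_oo cwp) => /(_ (measurable_itv _)).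
    by apply: eq_integrable => // x _ /=; rewrite -EFinB mulrBl.
  have := integrableD _ (Hi ord0) (Hi (lift ord0 ord0)) => /(_ (measurable_itv _)).
  by apply: eq_integrable => // x _ /=; rewrite /G !big_ord_recl big_ord0 addr0 EFinD.
have -> : inner a psi = \int[mu]_(x in D) G x.
  have cwp : continuous (fun x => \sum_(i < 2) w t i x * psi x i 0) by cts.
  transitivity (inner a psi - ip (w t) (fun i x => psi x i 0)); first by rewrite wpsi ?subr0.
  rewrite /ip -Int_oo// /inner -RintegralB//.
  - apply: eq_Rintegral => x _; rewrite /G !big_ord_recl !big_ord0 !addr0.
    rewrite (_ : lift ord0 ord0 = 1 :> 'I_2); last exact: val_inj.
    by ring.
  - have := integrableD _ (iap 0) (iap 1) => /(_ (measurable_itv _)).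
    by apply: eq_integrable => // x _ /=; rewrite EFinD.
  - exact: continuous_integrable_oo.
have iB : mu.-integrable D (EFin \o (fun x => (2 * eta)^-1 * S t x + eta / 2 * \sum_(i < 2) psi x i 0 ^+ 2)).
  have := integrableD _ (integrableZl _ (2 * eta)^-1 iS) (integrableZl _ (eta / 2) iP).
  move=> /(_ (measurable_itv _) (measurable_itv _) (measurable_itv _)).
  by apply: eq_integrable => // x _ /=; rewrite -EFinD.
have iNG : mu.-integrable D (EFin \o (fun x => `|G x|)).
  by have := integrable_abse iG; apply: eq_integrable.
apply: (le_trans (le_normr_Rintegral _ iG)) => //.
apply: (@le_trans _ _ (\int[mu]_(x in D) ((2 * eta)^-1 * S t x + eta / 2 * \sum_(i < 2) psi x i 0 ^+ 2))).
  apply: le_Rintegral => // x _; rewrite /G /S.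
  apply: (le_trans (ler_norm_sum _ _ _)).
  rewrite !mulr_sumr -big_split /=; apply: ler_sum => i _; exact: norm_mul_le.
rewrite RintegralD//; last 2 first.
- by have := integrableZl _ (2 * eta)^-1 iS => /(_ (measurable_itv _)); apply: eq_integrable.
- by have := integrableZl _ (eta / 2) iP => /(_ (measurable_itv _)); apply: eq_integrable.
rewrite !RintegralZl//.
have SE : \int[mu]_(x in D) S t x <= eta * e.
  have fin : (\int[mu]_(x in D) (S t x)%:E)%E \is a fin_num by apply: (integrable_fin_num _ iS).
  by rewrite -lee_fin fineK//; exact: ltW.
have -> : \int[mu]_(x in D) (\sum_(i < 2) psi x i 0 ^+ 2) = C.
  by rewrite Int_oo//; apply: eq_Int => x _ _; apply: eq_bigr => i _; rewrite expr2.
have A : (2 * eta)^-1 * \int[mu]_(x in D) S t x <= e / 2.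
  have h : 0 < 2 * eta by rewrite mulr_gt0.
  by rewrite mulrC ler_pdivrMr//; apply: (le_trans SE); rewrite le_eqVlt; apply/orP; left; apply/eqP; field.
have B : eta / 2 * C <= e / 2.
  rewrite mulrAC ler_pM2r ?invr_gt0//.
  by rewrite /eta mulrAC ler_pdivrMr ?ltr_wpDl// ler_pM2l// lerDl.
by rewrite (splitr e); exact: lerD.
Qed.

End InnerLimit.

(** * From the objects of the statement to continuous data on the line *)

Section Interface.
Context (R : realType).
Notation mu := (@lebesgue_measure R).
Implicit Types (f fx : R -> R) (x y s t l e d : R) (i j : 'I_2).

Lemma has_deriv01P f x l : has_deriv01 f x l <->
  (forall e, 0 < e -> exists2 d, 0 < d & forall y, 0 <= y -> y <= 1 -> `|y - x| < d ->
    `|f y - f x - (y - x) * l| <= e * `|y - x|).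
Proof.
have step e y : y != x -> (`|l - (f y - f x) / (y - x)| <= e) = (`|f y - f x - (y - x) * l| <= e * `|y - x|).
  move=> yx; have yx0 : y - x != 0 by rewrite subr_eq0.
  have -> : l - (f y - f x) / (y - x) = - ((f y - f x - (y - x) * l) / (y - x)) by field.
  by rewrite normrN normrM normfV ler_pdivrMr// normr_gt0.
split.
  move=> /cvgrPdist_le H e e0.
  have := H e e0; move=> /nbhs_ballP[d /= d0 Hd].
  exists d => // y y0 y1 yx.
  have [->|yn] := eqVneq y x; first by rewrite !subrr mul0r subr0 normr0 mulr0.
  rewrite -step//; apply: Hd => //; first by rewrite /ball/= distrC.
  by rewrite /= in_itv/= y0.
move=> H; apply/cvgrPdist_le => e e0; have [d d0 Hd] := H e e0.
apply/nbhs_ballP; exists d => // y /=; rewrite /ball/= distrC => yx yn.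
rewrite in_itv/= => /andP[y0 y1]; rewrite step//; exact: Hd.
Qed.

Lemma has_deriv01_Der f x l : 0 < x -> x < 1 -> has_deriv01 f x l -> Der f x l.
Proof.
move=> x0 x1 /has_deriv01P H; apply: Der_eps => e e0; have [d d0 Hd] := H e e0.
have I : \forall y \near x, y \in `]0, 1[ by apply: near_in_itvoo; rewrite in_itv/= x0.
have B : \forall y \near x, `|y - x| < d.
  by apply/nbhs_ballP; exists d => // y; rewrite /ball/= distrC.
apply: filterS (filterI I B) => y []; rewrite in_itv/= => /andP[y0 y1]; apply: Hd; exact: ltW.
Qed.

(** The derivative is given only inside; the mean value theorem and the continuity of [fx] recover
    the one-sided derivatives at the ends. *)
Lemma has_deriv01_of_Der f fx x : continuous f -> continuous fx ->
  (forall y, 0 < y -> y < 1 -> Der f y (fx y)) -> 0 <= x -> x <= 1 -> has_deriv01 f x (fx x).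
Proof.
move=> cf cfx df x0 x1; apply/has_deriv01P => e e0.
have /cvgrPdist_le /(_ e e0) /nbhs_ballP[d /= d0 Hd] := cfx x.
exists d => // y y0 y1 yx.
have mvt a b : 0 <= a -> b <= 1 -> a < b -> exists c, [/\ a < c, c < b & f b - f a = fx c * (b - a)].
  move=> a0 b1 ab; have [|c] := @MVT R f fx a b ab _ (continuous_subspaceT cf).
    by move=> z; rewrite in_itv/= => /andP[az zb]; apply: df; [exact: le_lt_trans az|exact: lt_le_trans b1].
  by rewrite in_itv/= => /andP[? ?] ?; exists c.
have close c : `|x - c| <= `|y - x| -> `|fx c - fx x| <= e.
  by move=> xc; rewrite distrC; apply: Hd; rewrite /ball/=; apply: le_lt_trans yx.
have [xy|xy|->] := ltgtP x y; last by rewrite !subrr mul0r subr0 normr0 mulr0.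
  have [c [xc cy ->]] := mvt x y x0 y1 xy.
  rewrite mulrC -mulrBr normrM mulrC ler_wpM2r//; apply: close.
  by rewrite distrC !ger0_norm ?subr_ge0 ?(ltW xc) ?(ltW xy)// lerD2r ltW.
have [c [xc cy E]] := mvt y x y0 x1 xy.
have -> : f y - f x - (y - x) * fx x = (y - x) * (fx c - fx x).
  by rewrite -[f y - f x]opprB E; ring.
rewrite normrM mulrC ler_wpM2r//; apply: close.
by rewrite (distrC y) !ger0_norm ?subr_ge0 ?(ltW cy) ?(ltW xy)// lerD2l lerN2 ltW.
Qed.

Lemma has_deriv01_continuous_clamp f (df : R -> R) :
  (forall x, 0 <= x -> x <= 1 -> has_deriv01 f x (df x)) -> continuous (fun x => f (clamp 0 1 x)).
Proof.
move=> H s; set x := clamp 0 1 s.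
have x0 : 0 <= x by exact: clamp_ge.
have x1 : x <= 1 by apply: clamp_le.
have /has_deriv01P /(_ 1 ltr01)[d d0 Hd] := H x x0 x1.
apply/cvgrPdist_le => e e0.
pose M := `|df x| + 1.
have M0 : 0 < M by rewrite ltr_wpDl.
have m0 : 0 < Num.min d (e / M) by rewrite lt_min d0 divr_gt0.
apply/nbhs_ballP; exists (Num.min d (e / M)) => // r; rewrite /ball/= lt_min => /andP[rd re].
have L : `|clamp 0 1 r - x| <= `|s - r| by rewrite distrC; exact: clamp_lip.
have := Hd (clamp 0 1 r) (clamp_ge _ _ _) (clamp_le _ ler01) (le_lt_trans L rd).
rewrite mul1r => A.
have B : `|f (clamp 0 1 r) - f x| <= M * `|clamp 0 1 r - x|.
  rewrite -[f _ - f x](subrK ((clamp 0 1 r - x) * df x)).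
  apply: (le_trans (ler_normD _ _)); rewrite normrM.
  have -> : M * `|clamp 0 1 r - x| = `|clamp 0 1 r - x| + `|clamp 0 1 r - x| * `|df x| by rewrite /M; ring.
  by rewrite lerD2r.
rewrite distrC; apply: (le_trans B).
have := le_lt_trans L re; rewrite ltr_pdivlMr// mulrC; exact: ltW.
Qed.

(** An entry of [P], continued by its end values outside [0, 1]. *)
Definition coeff (P : R -> 'M[R]_2) i j x : R := P (clamp 0 1 x) i j.

Lemma continuous_coeff P i j : C1mx P -> continuous (coeff P i j).
Proof.
move=> /(_ i j)[df H _]; apply: (@has_deriv01_continuous_clamp (fun x => P x i j) df).
by move=> x x0 x1; apply: H; rewrite in_itv/= x0.
Qed.

Lemma coeff_sym P i j x : symmetric_on01 P -> coeff P i j x = coeff P j i x.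
Proof.
move=> H; have /H E : clamp (0 : R) 1 x \in `[0, 1] by rewrite in_itv/= clamp_ge clamp_le.
by rewrite /coeff -[in LHS]E mxE.
Qed.

Lemma coeff_bounded P : C1mx P -> exists2 b, 0 <= b & forall i j x, `|coeff P i j x| <= b.
Proof.
move=> hP.
have H i j : exists b, 0 <= b /\ forall x, `|coeff P i j x| <= b.
  have cc := @continuous_coeff P i j hP.
  have c2 : continuous (fun p : R * R => coeff P i j p.1) by cts.
  have [b b0 Hb] := @bounded_rect R (fun x _ => coeff P i j x) 0 1 0 1 c2.
  exists b; split=> // x.
  have -> : coeff P i j x = coeff P i j (clamp 0 1 x).
    by rewrite /coeff [in RHS]clamp_id ?clamp_ge ?clamp_le.
  by apply: (Hb (clamp 0 1 x) 0); rewrite ?clamp_ge ?clamp_le.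
have /choice[B HB] : forall ij : 'I_2 * 'I_2, exists b, 0 <= b /\ forall x, `|coeff P ij.1 ij.2 x| <= b.
  by move=> ij; exact: H.
exists (\sum_ij B ij); first by apply: sumr_ge0 => ij _; have [] := HB ij.
move=> i j x; rewrite (bigD1 (i, j))//=; apply: (le_trans ((HB (i, j)).2 x)).
by rewrite lerDl; apply: sumr_ge0 => ij _; have [] := HB ij.
Qed.

(** Agrees with [w] on [0, 1] from time [tau] on; frozen before [tau] and constant in x outside
    [0, 1], which makes it continuous on the plane. The parameter [- tau] in [strip_gsol] restricts
    the equation to s > tau. *)
Definition window (w : R -> R -> 'cV[R]_2) tau i x s : R := w (clamp 0 1 x) (Num.max tau s) i 0.

Lemma continuous_window w tau i : 0 < tau -> continuous_strip w ->
  continuous (fun p : R * R => window w tau i p.1 p.2).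
Proof.
move=> t0 /(_ i) cw.
have cmax : continuous (fun s : R => Num.max tau s).
  by move=> s; apply: (@continuous_max R R (cst tau) id); [exact: cvg_cst|exact: cvg_id].
apply: (@continuous_comp_within _ _ _ _ (fun p : R * R => w p.1 p.2 i 0)
  (fun p : R * R => (clamp 0 1 p.1, Num.max tau p.2)) cw).
  have c1 : continuous (fun p : R * R => clamp 0 1 p.1).
    by have cc := @continuous_clamp R 0 1; cts.
  have c2 : continuous (fun p : R * R => Num.max tau p.2) by cts.
  by move=> p; exact: (@cvg_pair _ _ _ (nbhs p) (nbhs (clamp 0 1 p.1)) (nbhs (Num.max tau p.2)) _ _ _ _ _ (c1 p) (c2 p)).
by move=> p /=; rewrite in_itv/= clamp_ge clamp_le// lt_max t0.
Qed.

Lemma strip_gsol P a u tau : 0 < tau -> parabolic_solution P a u ->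
  exists yt yx yxx, gsol (coeff P) (- tau) (window u tau) yt yx yxx.
Proof.
move=> t0 [ut [ux [uxx [[cu cut cux cuxx] D E B _]]]].
exists (window ut tau), (window ux tau), (window uxx tau).
have wE w i x s : 0 <= x -> x <= 1 -> tau < s -> window w tau i x s = w x s i 0.
  by move=> x0 x1 ts; rewrite /window clamp_id// (max_idPr (ltW ts)).
split; first by split=> i; exact: continuous_window.
- move=> i x s x0 x1; rewrite opprK => ts; rewrite wE//.
  have xI : x \in `[0, 1] by rewrite in_itv/= x0.
  have [d _ _] := D x s i xI (lt_trans t0 ts).
  apply: (@Der_local R (fun s => u x s i 0) _ tau (s + 1)) d => //; first by rewrite ltrDl.
  by move=> r tr _; rewrite wE.
- move=> i x s x0 x1; rewrite opprK => ts.
  have s0 := lt_trans t0 ts.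
  have xI : x \in `[0, 1] by rewrite in_itv/= !ltW.
  have [_ d1 d2] := D x s i xI s0.
  rewrite !wE ?(ltW x0) ?(ltW x1)//; split.
  + apply: (@Der_local R (fun y => u y s i 0) _ 0 1) => //; last exact: has_deriv01_Der.
    by move=> y y0 y1; rewrite wE// ltW.
  + apply: (@Der_local R (fun y => ux y s i 0) _ 0 1) => //; last exact: has_deriv01_Der.
    by move=> y y0 y1; rewrite wE// ltW.
  have xO : x \in `]0, 1[ by rewrite in_itv/= x0.
  have := congr1 (fun v : 'cV_2 => v i 0) (E x s xO s0).
  rewrite !mxE => /eqP; rewrite addr_eq0 subr_eq => /eqP ->; rewrite addrC; congr (_ - _).
  by apply: eq_bigr => j _; rewrite wE ?(ltW x0) ?(ltW x1)// /coeff clamp_id ?ltW.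
- move=> i s; rewrite opprK => ts; have [e0 e1] := B s (lt_trans t0 ts).
  by rewrite !wE ?ler01// e0 e1 !mxE.
Qed.

(** The relation reads - f'' + (P + k) f = m f, so the eigenvalue of A_P is m - k; the second
    derivative required by [operA] is the classical one. *)
Lemma eigenfunction_of_green P k (m : R) (f fx : 'I_2 -> R -> R) : C1mx P -> ip f f != 0 ->
  green (shiftp (coeff P) k) (fun i x => m * f i x) f fx ->
  eigenfunction P (m - k) (fun x => \col_i f i x).
Proof.
move=> hP fn gf; have [cf cfx df dfx f0] := gf.
have cp i j : continuous (shiftp (coeff P) k i j).
  by have c := @continuous_coeff P i j hP; rewrite /shiftp; cts.
have cm := continuous_mulp cp cf.
have cfxx i : continuous (fun x => mulp (shiftp (coeff P) k) f i x - m * f i x) by cts.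
split.
  exists (fun x => \col_i fx i x), (fun x => \col_i (mulp (shiftp (coeff P) k) f i x - m * f i x)).
  split.
  - move=> i; rewrite (_ : (fun x => _) = fun x => mulp (shiftp (coeff P) k) f i x - m * f i x).
      exact: L2_01_continuous.
    by apply/funext => x; rewrite mxE.
  - move=> x i; rewrite in_itv/= => /andP[x0 x1]; rewrite !mxE; split.
      rewrite (_ : (fun x => _) = f i); last by apply/funext => y; rewrite mxE.
      by apply: has_deriv01_of_Der => //; exact: df.
    rewrite (_ : \int[_]_(y in _) _ = Int 0 x (fun x => mulp (shiftp (coeff P) k) f i x - m * f i x)).
      rewrite (@FTC2 R (fx i)) ?subrKC//.
      by move=> y y0 y1; apply: dfx => //; exact: lt_le_trans x1.
    by apply: eq_Rintegral => y _; rewrite mxE.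
  - by split; apply/colP => i; rewrite !mxE; have [] := f0 i.
  - apply: aeW => x; rewrite in_itv/= => /andP[x0 x1]; apply/colP => i; rewrite !mxE mulp_shiftp /mulp.
    rewrite [X in _ = _ + X](_ : _ = \sum_j coeff P i j x * f j x); first by ring.
    by apply: eq_bigr => j _; rewrite mxE /coeff clamp_id ?ltW.
apply: contrapT => H; case/negP: fn; apply/eqP.
have fz i x : 0 <= x -> x <= 1 -> f i x = 0.
  move=> x0 x1; apply: contrapT => fx0; apply: H; exists x; first by rewrite in_itv/= x0.
  by apply/eqP => /colP/(_ i); rewrite !mxE.
rewrite /ip (@eq_Int R 0 1 _ (fun=> 0)) ?Int_cst ?mul0r// => x x0 x1.
by rewrite big1// => i _; rewrite fz// mul0r.
Qed.

End Interface.

(** * A twice differentiable cutoff *)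

Section Cutoff.
Context (R : realType).
Implicit Types (x z : R).
Variables (al be : R).
Hypotheses (al0 : 0 < al) (albe : al < be) (be1 : be < 1).

(** [pp c] is twice the positive part of z - c and [I c] its primitive, zero up to c and positive
    beyond. The product [rho] is then a continuously differentiable bump carried by [al, be], and
    chi is 1 minus its normalised primitive. *)
Lemma cutoff : exists chi chi1 chi2 : R -> R,
  [/\ [/\ continuous chi, continuous chi1 & continuous chi2],
    forall x, 0 < x -> x < 1 -> Der chi x (chi1 x) /\ Der chi1 x (chi2 x),
    chi1 0 = 0 /\ chi1 1 = 0,
    forall x, 0 <= x -> x <= 1 -> 0 <= chi x <= 1 &
    (forall x, 0 <= x -> x <= al -> chi x = 1) /\ (forall x, be <= x -> x <= 1 -> chi x = 0)].
Proof.
have al0' := al0; have albe' := albe; have be1' := be1.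
pose pp c z : R := (z - c) + `|z - c|.
have cpp c : continuous (pp c) by rewrite /pp; cts.
have pp0 c z : 0 <= pp c z by have := ler_norm (- (z - c)); rewrite normrN /pp; lra.
have ppn c z : z <= c -> pp c z = 0 by move=> zc; rewrite /pp ler0_norm ?subr_le0// subrr.
have ppp c z : c < z -> 0 < pp c z.
  by move=> cz; rewrite /pp gtr0_norm ?subr_gt0// addr_gt0 ?subr_gt0.
pose I c x := Int 0 x (pp c).
have cI c : continuous (I c) by exact: continuous_Int.
have I0 c x : 0 <= I c x by apply: Int_ge0.
have In c x : x <= c -> I c x = 0.
  move=> xc; have [x0|x0] := leP x 0; first exact: Int_eq0.
  rewrite /I (@eq_Int R 0 x _ (fun=> 0)) ?Int_cst ?mul0r ?(ltW x0)// => z _ zx.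
  by apply: ppn; exact: le_trans xc.
have Ip c x : 0 <= c -> c < x -> 0 < I c x.
  move=> c0 cx; rewrite lt_neqAle I0 andbT eq_sym; apply/eqP => I00.
  have m1 : c < (c + x) / 2 by lra.
  have m2 : (c + x) / 2 < x by lra.
  have := ppp _ _ m1; rewrite (Int_eq0_ge0 (cpp c) (fun z _ _ => pp0 c z) I00) ?ltxx//.
  exact: le_lt_trans m1.
have dI c x : 0 < x -> Der (I c) x (pp c x) by move=> x0; exact: FTC1.
pose rho x := I al x * I (1 - be) (1 - x).
pose rho' x := pp al x * I (1 - be) (1 - x) - I al x * pp (1 - be) (1 - x).
have crho : continuous rho.
  by rewrite /rho; have c1 := cI al; have c2 := cI (1 - be); cts.
have crho' : continuous rho'.
  by rewrite /rho'; have c1 := cI al; have c2 := cI (1 - be); have c3 := cpp al; have c4 := cpp (1 - be); cts.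
have rho0 x : 0 <= rho x by exact: mulr_ge0.
have rhol x : x <= al -> rho x = 0 by move=> xa; rewrite /rho In ?mul0r.
have rhor x : be <= x -> rho x = 0 by move=> xb; rewrite /rho [I (1 - be) _]In ?mulr0//; lra.
have drho x : 0 < x -> x < 1 -> Der rho x (rho' x).
  move=> x0 x1; have D1 := dI al x x0.
  have d1 : Der (fun x => 1 - x) x (0 - 1) := DerB (Der_cst _ _) (Der_id _).
  have D2 : Der (fun x => I (1 - be) (1 - x)) x (pp (1 - be) (1 - x) * (0 - 1)).
    by apply: (Der_comp (f := I (1 - be)) (g := fun x => 1 - x) _ d1); apply: dI; lra.
  by rewrite /rho /rho'; der; ring.
have Ip1 : 0 < I al ((al + be) / 2) by apply: Ip; lra.
have Ip2 : 0 < I (1 - be) (1 - (al + be) / 2) by apply: Ip; lra.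
have rhop : 0 < rho ((al + be) / 2) by exact: mulr_gt0.
clearbody I; clearbody rho rho'; clear pp cpp pp0 ppn ppp cI I0 In Ip dI Ip1 Ip2.
pose A x := Int 0 x rho.
have cA : continuous A by exact: continuous_Int.
have A0 x : 0 <= A x by exact: Int_ge0.
have A1 : 0 < A 1.
  rewrite lt_neqAle A0 andbT eq_sym; apply/eqP => A00.
  by move: rhop; rewrite (Int_eq0_ge0 crho (fun z _ _ => rho0 z) A00) ?ltxx//; lra.
have dA x : 0 < x -> Der A x (rho x) by move=> x0; exact: FTC1.
have Al x : x <= al -> A x = 0.
  move=> xa; have [x0|x0] := leP x 0; first exact: Int_eq0.
  rewrite /A (@eq_Int R 0 x _ (fun=> 0)) ?Int_cst ?mul0r ?(ltW x0)// => z _ zx.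
  by apply: rhol; exact: le_trans xa.
have Acat x : 0 <= x -> x <= 1 -> A 1 = A x + Int x 1 rho by move=> x0 x1; exact: Int_cat.
have Ar x : be <= x -> x <= 1 -> A x = A 1.
  move=> bx x1; rewrite (Acat x) ?(@eq_Int R x 1 _ (fun=> 0)) ?Int_cst ?mul0r ?addr0//; last by lra.
  by move=> z xz _; apply: rhor; exact: le_trans xz.
have A10 : A 1 != 0 by rewrite gt_eqF.
exists (fun x => 1 - A x * (A 1)^-1), (fun x => - rho x * (A 1)^-1), (fun x => - rho' x * (A 1)^-1).
split.
- by split; cts.
- move=> x x0 x1; have D1 := dA x x0; have D2 := drho x x0 x1; split.
  + by der; ring.
  + by der; ring.
- by rewrite rhol ?(ltW al0)// rhor ?(ltW be1)// oppr0 mul0r.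
- move=> x x0 x1; have AA : A x <= A 1 by rewrite (Acat x)// lerDl; exact: Int_ge0.
  have h1 : A x * (A 1)^-1 <= 1 by rewrite ler_pdivrMr// mul1r.
  have h2 : 0 <= A x * (A 1)^-1 by rewrite divr_ge0// ltW.
  by rewrite subr_ge0 h1/= gerDl oppr_le0.
- split=> [x _ xa|x bx x1]; first by rewrite Al// mul0r subr0.
  by rewrite Ar// mulfV// subrr.
Qed.

End Cutoff.

(** * Equality in the interior from the two traces *)

Section TracesDetermine.
Context (R : realType).
Implicit Types (x s t e c : R) (i j : 'I_2) (l : seq (R * R)).

Lemma sqrD_le (X Y : R) : (X + Y) ^+ 2 <= 2 * X ^+ 2 + 2 * Y ^+ 2.
Proof.
rewrite -subr_ge0 (_ : _ - _ = (X - Y) ^+ 2); [exact: sqr_ge0|ring].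
Qed.

Lemma two_sided_bound (W I1 I2 X Y e n : R) : 0 <= W -> X ^+ 2 <= W * I1 -> Y ^+ 2 <= W * I2 ->
  I1 <= e -> I2 <= 2 * n + 2 * e -> (X + Y) ^+ 2 <= W * (6 * e + 4 * n).
Proof.
move=> W0 hX hY h1 h2.
have a1 := ler_wpM2l W0 h1; have a2 := ler_wpM2l W0 h2.
have -> : W * (6 * e + 4 * n) = 2 * (W * e) + 2 * (W * (2 * n + 2 * e)) by ring.
by apply: (le_trans (sqrD_le X Y)); lra.
Qed.

Lemma Int_sub_le (a b : R) (f g : 'I_2 -> R -> R) : (forall i, continuous (f i)) -> (forall i, continuous (g i)) ->
  Int a b (fun x => \sum_i (f i x - g i x) ^+ 2) <= 2 * Int a b (fun x => \sum_i f i x ^+ 2) + 2 * Int a b (fun x => \sum_i g i x ^+ 2).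
Proof.
move=> cf cg; rewrite -!IntZ; [|by cts..].
rewrite -IntD; [|by cts..].
apply: le_Int => [| |x _ _]; [by cts|by cts|].
rewrite !mulr_sumr -big_split /=; apply: ler_sum => i _.
by have := sqrD_le (f i x) (- g i x); rewrite sqrrN.
Qed.

Lemma Int_le_ip (a b : R) (f : 'I_2 -> R -> R) : 0 <= a -> a <= b -> b <= 1 -> (forall i, continuous (f i)) ->
  Int a b (fun x => \sum_i f i x ^+ 2) <= ip f f.
Proof.
move=> a0 ab b1 cf.
have cs : continuous (fun x => \sum_i f i x ^+ 2) by cts.
have s0 x : 0 <= \sum_i f i x ^+ 2 by apply: sumr_ge0 => i _; exact: sqr_ge0.
have -> : ip f f = Int 0 1 (fun x => \sum_i f i x ^+ 2).
  by apply: eq_Int => x _ _; apply: eq_bigr => i _; rewrite expr2.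
rewrite (Int_cat cs a0 (le_trans ab b1)) (Int_cat cs ab b1).
rewrite addrCA lerDl addr_ge0//; exact: Int_ge0.
Qed.

Variables (q q' : 'I_2 -> 'I_2 -> R -> R) (b tau T : R).
Hypotheses (cq : forall i j, continuous (q i j)) (cq' : forall i j, continuous (q' i j)).
Hypotheses (qb : forall i j x, `|q i j x| <= b) (qb' : forall i j x, `|q' i j x| <= b).
Hypothesis sq : forall i j x, 0 <= x -> x <= 1 -> q i j x = q j i x.
Hypothesis tau0 : 0 < tau.
Variables (u ut ux uxx v vt vx vxx : 'I_2 -> R -> R -> R).
Hypothesis hu : gsol q (- tau) u ut ux uxx.
Hypothesis hv : gsol q' (- tau) v vt vx vxx.
Hypothesis uv : forall i t, tau <= t -> t < T -> u i 0 t = v i 0 t /\ u i 1 t = v i 1 t.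

Let K := (4 * b + 1) ^+ 2.
(** Time 2 tau becomes time 0, so the flow exists for s > - tau; the exponential adds K - 1 to the
    potential, as required for density. *)
Let y i x s := expR (- (K - 1) * s) * u i x (s + 2 * tau).
Let yt i x s := expR (- (K - 1) * s) * (ut i x (s + 2 * tau) - (K - 1) * u i x (s + 2 * tau)).
Let yx i x s := expR (- (K - 1) * s) * ux i x (s + 2 * tau).
Let yxx i x s := expR (- (K - 1) * s) * uxx i x (s + 2 * tau).

Lemma scaled_gsol : gsol (shiftp q (K - 1)) tau y yt yx yxx.
Proof.
have -> : tau = - tau + 2 * tau by ring.
exact: (gsol_exp (K - 1) (gsol_shift (2 * tau) hu)).
Qed.

Hypothesis eig : forall (f fx : 'I_2 -> R -> R) (m : R), 0 < m -> green (shiftp q K) (fun i x => m * f i x) f fx ->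
  (forall s, 0 <= s -> ip f (fun i x => y i x s) = 0) -> ip f f = 0.

Let F l i x : R := \sum_(z <- l) z.1 * u i x z.2.
(** These times stay at distance at least [tau] from the ends of [tau, T), where the traces agree,
    so a window of half-width tau / 2 fits around each of them. *)
Let adm l := forall z, z \in l -> 2 * tau <= z.2 /\ z.2 < T - tau.

Let cF l i : continuous (F l i).
Proof. by have [[cu _ _ _] _ _ _] := hu; rewrite /F; cts. Qed.

Lemma comb_comparison l i x0 : 0 < x0 -> x0 < 1 -> adm l ->
  let d := \sum_(z <- l) z.1 * v i x0 z.2 - \sum_(z <- l) z.1 * u i x0 z.2 in
  d ^+ 2 <= wave_const b * Int 0 x0 (fun x => \sum_i F l i x ^+ 2) /\
  d ^+ 2 <= wave_const b * Int x0 1 (fun x => \sum_i F l i x ^+ 2).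
Proof.
move=> x00 x01 al d; have t0 := tau0.
have lc z : z \in l -> tau <= - tau + z.2 by move=> /al[h _]; lra.
have gu := gsol_comb hu lc; have gv := gsol_comb hv lc.
have r0 : 0 < tau / 2 by rewrite divr_gt0.
have rt : tau / 2 < tau by lra.
have tr j s : - (tau / 2) <= s -> s <= tau / 2 ->
    (\sum_(z <- l) z.1 * u j 0 (s + z.2) = \sum_(z <- l) z.1 * v j 0 (s + z.2)) /\
    (\sum_(z <- l) z.1 * u j 1 (s + z.2) = \sum_(z <- l) z.1 * v j 1 (s + z.2)).
  move=> s1 s2; split; apply: eq_big_seq => z /al[z1 z2];
    by have [e0 e1] := @uv j (s + z.2) ltac:(lra) ltac:(lra); rewrite ?e0 ?e1.
have dE : d = \sum_(z <- l) z.1 * v i x0 (0 + z.2) - \sum_(z <- l) z.1 * u i x0 (0 + z.2).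
  by congr (_ - _); apply: eq_bigr => z _; rewrite add0r.
have FE : (fun x => \sum_i F l i x ^+ 2) = fun x => \sum_i (\sum_(z <- l) z.1 * u i x (0 + z.2)) ^+ 2.
  apply/funext => x; apply: eq_bigr => j _; congr (_ ^+ 2).
  by apply: eq_bigr => z _; rewrite add0r.
rewrite dE FE; split.
  apply: (left_comparison i r0 x00 x01 cq cq' qb qb' (gsol_heat_on rt gu) (gsol_heat_on rt gv)).
  by move=> j s s1 s2; have [] := tr j s s1 s2.
apply: (right_comparison i r0 rt x00 x01 cq cq' qb qb' gu gv).
by move=> j s s1 s2; have [] := tr j s s1 s2.
Qed.

Lemma combE l i x : comb y l i x = F [seq (z.1 * expR (- (K - 1) * z.2), z.2 + 2 * tau) | z <- l] i x.
Proof. by rewrite /comb /F big_map; apply: eq_bigr => z _; rewrite /y mulrA. Qed.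

(** [flow_dense] approximates functions in the range of the Green operator. Here chi u is one: chi
    is twice differentiable and its derivative vanishes at both ends. *)
Lemma green_cutoff (chi chi1 chi2 : R -> R) s :
  [/\ continuous chi, continuous chi1 & continuous chi2] ->
  (forall x, 0 < x -> x < 1 -> Der chi x (chi1 x) /\ Der chi1 x (chi2 x)) ->
  chi1 0 = 0 /\ chi1 1 = 0 -> tau < s ->
  exists w fx, (forall i, continuous (w i)) /\ green (shiftp q K) w (fun i x => chi x * u i x s) fx.
Proof.
move=> [cc cc1 cc2] dc [c10 c11] ts; have [[cu cut cux cuxx] Dt Dx u0] := hu.
have cqK i j : continuous (shiftp q K i j) by have c1 := @cq i j; rewrite /shiftp; cts.
have cf i : continuous (fun x => chi x * u i x s) by cts.
have cm := continuous_mulp cqK cf.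
pose fxx i x := chi2 x * u i x s + 2 * chi1 x * ux i x s + chi x * uxx i x s.
have cfxx i : continuous (fxx i) by rewrite /fxx; cts.
exists (fun i x => mulp (shiftp q K) (fun i x => chi x * u i x s) i x - fxx i x).
exists (fun i x => chi1 x * u i x s + chi x * ux i x s).
have ts' : - - tau < s by rewrite opprK.
split; first by move=> i; cts.
split=> //.
- by move=> i; cts.
- by move=> i x x0 x1; have [D1 D2] := dc x x0 x1; have [d1 d2 _] := Dx i x s x0 x1 ts'; der.
- move=> i x x0 x1; have [D1 D2] := dc x x0 x1; have [d1 d2 _] := Dx i x s x0 x1 ts'.
  by rewrite /fxx; der; ring.
- by move=> i; have [-> ->] := u0 i s ts'; rewrite c10 c11 !mul0r !mulr0 addr0.
Qed.

(* Approximate chi u by a combination g of the flow, with chi a cutoff equal to 0 beyond x0 and to 1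
   except close to x0; bound the g part from the right of x0 and the u - g part from its left. *)
Lemma traces_determine i x0 t0 : 2 * tau <= t0 -> t0 < T - tau -> 0 < x0 -> x0 < 1 -> u i x0 t0 = v i x0 t0.
Proof.
move=> t1 t2 x00 x01; have tau0' := tau0.
have tt0 : tau < t0 by lra.
have [[cu cut cux cuxx] Dt Dx u0] := hu.
have [M M0 HM] : exists2 M, 0 <= M & forall i x, 0 <= x -> x <= 1 -> `|u i x t0| <= M.
  have [M0 M00 H0] := @bounded_rect R (u ord0) 0 1 t0 t0 (cu ord0).
  have [M1 M10 H1] := @bounded_rect R (u ord_max) 0 1 t0 t0 (cu ord_max).
  exists (M0 + M1); first exact: addr_ge0.
  move=> j x h0 h1; have [->|->] : j = ord0 \/ j = ord_max.
    by case: (unliftP ord0 j) => [k ->|->]; [right; apply: val_inj; rewrite (ord1 k)|left].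
    by apply: (le_trans (H0 x t0 h0 h1 _ _)); rewrite ?lexx// lerDl.
  by apply: (le_trans (H1 x t0 h0 h1 _ _)); rewrite ?lexx// lerDr.
have W0 : 0 <= wave_const b.
  rewrite /wave_const; apply: mulr_ge0; first exact: expR_ge0.
  apply: addr_ge0 => //; by apply: mulr_ge0; apply: mulr_ge0 => //; rewrite ?sqr_ge0 ?expR_ge0.
set W := wave_const b in W0.
have small e : 0 < e -> (v i x0 t0 - u i x0 t0) ^+ 2 <= W * (6 * e + 4 * e).
  move=> e0.
  have M1 : 0 < 2 * M ^+ 2 + 1 by rewrite ltr_wpDl// mulr_ge0// sqr_ge0.
  (* On the transition zone [al, x0] the squared norm of chi u - u is at most 2 M^2, and the zone is
     short enough for its integral to be at most [e]; x0 / 2 keeps [al] positive. *)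
  pose al := Num.max (x0 / 2) (x0 - e / (2 * M ^+ 2 + 1)).
  have al1 : x0 / 2 <= al by rewrite le_max lexx.
  have al2 : x0 - e / (2 * M ^+ 2 + 1) <= al by rewrite le_max lexx orbT.
  have al3 : al < x0.
    by rewrite gt_max ltr_pdivrMr// ltr_pMr// ltr1n/= gtrBl divr_gt0.
  move: al al1 al2 al3 => al al1 al2 al3.
  have al0 : 0 < al by apply: lt_le_trans al1; rewrite divr_gt0.
  have [chi [chi1 [chi2 [cchi dchi chi01 chib [chil chir]]]]] := cutoff al0 al3 x01.
  have [cc _ _] := cchi.
  have [w [fx [cw gf]]] := green_cutoff cchi dchi chi01 tt0.
  (* The length of the admissible interval [2 tau, T - tau), which the flow [y] sees as starting at
     0. *)
  have T1 : 0 < T - tau - 2 * tau by lra.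
  have [l [al' Hl]] := flow_dense tau0 cq qb sq scaled_gsol eig T1 cw gf e0.
  set l' := [seq (z.1 * expR (- (K - 1) * z.2), z.2 + 2 * tau) | z <- l].
  have adm1 : adm l'.
    by move=> z /mapP[z' /al'[z1 z2] -> /=]; split; lra.
  have adm2 : adm [:: (1, t0)] by move=> z; rewrite inE => /eqP ->.
  have adm3 : adm ((1, t0) :: [seq (- z.1, z.2) | z <- l']).
    move=> z; rewrite inE => /predU1P[->//|/mapP[z' /adm1 h ->]]; exact: h.
  pose f i x := chi x * u i x t0.
  have cf j : continuous (f j) by rewrite /f; cts.
  have cd j : continuous (fun x => f j x - F l' j x) by have c1 := @cF l'; cts.
  have Hd : ip (fun i x => f i x - F l' i x) (fun i x => f i x - F l' i x) <= e.
    apply: le_trans Hl; rewrite le_eqVlt; apply/orP; left; apply/eqP.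
    by apply: eq_ip => j x _ _; rewrite combE.
  have [_ B1] := comb_comparison i x00 x01 adm1.
  have [B2 _] := comb_comparison i x00 x01 adm3.
  set d1 := (X in X ^+ 2 <= _) in B1; set d2 := (X in X ^+ 2 <= _) in B2.
  (* The deviation between the two solutions is linear in the combination: [d1] is that of the
     approximant and [d2] that of u minus the approximant. *)
  have dE : v i x0 t0 - u i x0 t0 = d1 + d2.
    rewrite /d1 /d2 !big_cons !big_map /= !mul1r.
    under [in RHS]eq_bigr do idtac.
    rewrite [X in _ = _ + (_ + X - _)](_ : _ = - \sum_(z <- l) z.1 * expR (- (K - 1) * z.2) * v i x0 (z.2 + 2 * tau)); last first.
      by rewrite -sumrN; apply: eq_bigr => z _; rewrite mulNr.
    rewrite [X in _ = _ + (_ - (_ + X))](_ : _ = - \sum_(z <- l) z.1 * expR (- (K - 1) * z.2) * u i x0 (z.2 + 2 * tau)); last first.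
      by rewrite -sumrN; apply: eq_bigr => z _; rewrite mulNr.
    by ring.
  rewrite dE; apply: (two_sided_bound W0 B1 B2).
    apply: le_trans Hd.
    have <- : Int x0 1 (fun x => \sum_i (f i x - F l' i x) ^+ 2) = Int x0 1 (fun x => \sum_i F l' i x ^+ 2).
      apply: eq_Int => x h0 h1; apply: eq_bigr => j _.
      by rewrite /f chir// mul0r sub0r sqrrN.
    by apply: Int_le_ip => //; exact: ltW.
  have FE : (fun x => \sum_i F ((1, t0) :: [seq (- z.1, z.2) | z <- l']) i x ^+ 2) =
      fun x => \sum_i ((f i x - F l' i x) - (f i x - u i x t0)) ^+ 2.
    apply/funext => x; apply: eq_bigr => j _; congr (_ ^+ 2).
    rewrite /F big_cons /= mul1r [X in _ + X = _](_ : _ = - F l' j x); first by rewrite /F; ring.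
    by rewrite /F [in LHS]big_map -sumrN; apply: eq_bigr => z _; rewrite mulNr.
  rewrite FE.
  have cfu j : continuous (fun x => f j x - u j x t0) by cts.
  apply: (le_trans (Int_sub_le _ _ cd cfu)).
  rewrite addrC; apply: lerD; rewrite ler_pM2l//; last first.
    by apply: (le_trans _ Hd); apply: Int_le_ip => //; exact: ltW.
  have cs : continuous (fun x => \sum_i (f i x - u i x t0) ^+ 2) by cts.
  rewrite (Int_cat cs (ltW al0) (ltW al3)).
  rewrite (@eq_Int R 0 al _ (fun=> 0)); last first.
    move=> x h0 h1; rewrite big1// => j _.
    by rewrite /f chil// mul1r subrr expr0n.
  rewrite Int_cst ?(ltW al0)// mul0r add0r.
  apply: (@le_trans _ _ (Int al x0 (fun=> 2 * M ^+ 2))).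
    apply: le_Int => [| |x h0 h1]; [exact: cs|by cts|].
    rewrite (_ : 2 * M ^+ 2 = \sum_(j < 2) M ^+ 2); last by rewrite sumr_const card_ord mulr_natl.
    apply: ler_sum => j _.
    have x0' : 0 <= x by exact: le_trans (ltW al0) h0.
    have x1' : x <= 1 by exact: le_trans h1 (ltW x01).
    have /andP[k0 k1] := chib x x0' x1'.
    have -> : f j x - u j x t0 = (chi x - 1) * u j x t0 by rewrite /f; ring.
    rewrite -[leLHS]real_normK ?num_real// ler_pXn2r ?nnegrE// normrM.
    apply: le_trans (HM j x x0' x1'); rewrite ler_piMl// distrC ger0_norm ?subr_ge0//.
    by rewrite gerBl.
  rewrite Int_cst ?(ltW al3)//.
  have : x0 - al <= e / (2 * M ^+ 2 + 1) by lra.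
  rewrite ler_pdivlMr// => h.
  have h2 : 0 <= x0 - al by rewrite subr_ge0 ltW.
  by rewrite mulrC; apply: le_trans h; rewrite ler_wpM2l// lerDl.
apply/eqP; rewrite eq_sym -subr_eq0 -sqrf_eq0 eq_le sqr_ge0 andbT.
apply/ler_addgt0Pr => e e0; rewrite add0r.
have e1 : 0 < e / (10 * (W + 1)) by rewrite divr_gt0// mulr_gt0// ltr_wpDl.
apply: (le_trans (small _ e1)).
set k := e / _; have -> : 6 * k + 4 * k = 10 * k by ring.
have -> : W * (10 * k) = e * (W / (W + 1)) by rewrite /k; field; rewrite gt_eqF// ltr_wpDl.
rewrite -[leRHS]mulr1 ler_pM2l// ler_pdivrMr ?ltr_wpDl// mul1r lerDl.
exact: ler01.
Qed.

End TracesDetermine.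

(** * From generating elements to equality of the potentials *)

Section Assembly.
Context (R : realType).
Implicit Types (x s t : R) (i j : 'I_2) (P Q : R -> 'M[R]_2) (a : R -> 'cV[R]_2) (u v : R -> R -> 'cV[R]_2).

Lemma windowE u tau i x t : 0 <= x -> x <= 1 -> tau <= t -> window u tau i x t = u x t i 0.
Proof. by move=> x0 x1 tt; rewrite /window clamp_id// (max_idPr tt). Qed.

(** Paired with an eigenvector the flow obeys h' = (1 - m) h, so vanishing at one time propagates
    back to every t > 0; letting t tend to 0 gives (a, f) = 0. *)
Lemma generating_total P a u (b tau : R) (f fx : 'I_2 -> R -> R) (m : R) : C1mx P -> symmetric_on01 P ->
  generating P a -> parabolic_solution P a u -> (forall i j x, `|coeff P i j x| <= b) -> 0 < tau ->
  green (shiftp (coeff P) ((4 * b + 1) ^+ 2)) (fun i x => m * f i x) f fx ->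
  (forall s, 0 <= s -> ip f (fun i x => expR (- ((4 * b + 1) ^+ 2 - 1) * s) * window u tau i x (s + 2 * tau)) = 0) ->
  ip f f = 0.
Proof.
move=> hP sP [a2 gen] hu Pb tau0 gf Hf.
apply/eqP; apply: contraT => fn.
have [cf _ _ _ _] := gf.
have cq i j : continuous (coeff P i j) := continuous_coeff (i := i) (j := j) hP.
have sq i j x : 0 <= x -> x <= 1 -> coeff P i j x = coeff P j i x by move=> _ _; exact: coeff_sym.
have orth t : 0 < t -> ip f (fun i x => u (clamp 0 1 x) t i 0) = 0.
  move=> t0; have t2 : 0 < t / 2 by rewrite divr_gt0.
  have [yt [yx [yxx hy]]] := strip_gsol t2 hu.
  (* With the window t / 2 the rescaled flow starts at time t of [u]; its time 2 tau is time t of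
     the flow in the hypothesis, up to an exponential factor. *)
  have hY := scaled_gsol b hy.
  set K := (4 * b + 1) ^+ 2 in Hf gf hY *.
  set y := (fun i x s => expR (- (K - 1) * s) * _) in hY.
  pose h s := ip f (fun i x => y i x s).
  have cmf i : continuous (fun x => m * f i x) by cts.
  have [[cy _ _ _] _ _ _] := hY.
  have cys s : forall i, continuous (fun x => y i x s) by move=> i; cts.
  have dh s : 0 < s -> Der h s ((1 - m) * h s).
    move=> s0; have s1 : - (t / 2) < s by apply: lt_trans s0; rewrite oppr_lt0.
    apply: (Der_eq (Der_flow hY cf s1)).
    by rewrite (green_flow cq sq hY cmf gf s1) ipZl// /h; ring.
  have ch : continuous h := continuous_flow hY cf.
  pose g s := expR ((m - 1) * s) * h s.
  have cg : continuous g by rewrite /g; cts.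
  have g0 : g (2 * tau) = g 0.
    apply: eq_of_Der0; [exact: mulr_ge0 (ler0n _ 2) (ltW tau0)|exact: cg|].
    by move=> s s0 _; have D := dh s s0; rewrite /g; der; ring.
  have h1 : h (2 * tau) = 0.
    rewrite /h; transitivity (ip f (fun i x => expR (- (K - 1) * (2 * tau - t)) *
        (expR (- (K - 1) * t) * window u tau i x (t + 2 * tau)))).
      apply: eq_ip => // i x x0 x1; rewrite /y [RHS]mulrA -expRD !windowE//.
      - by congr (_ * u _ _ _ _); [congr expR|]; field.
      - by rewrite ler_wpDl ?ltW//; lra.
      - by lra.
    have cw : forall i, continuous (fun x => expR (- (K - 1) * t) * window u tau i x (t + 2 * tau)).
      have [_ [_ [_ [[cw _ _ _] _ _ _]]]] := strip_gsol tau0 hu.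
      by move=> i; cts.
    by rewrite ipC ipZl// ipC Hf ?mulr0// ltW.
  move: g0; rewrite /g h1 mulr0 mulr0 expR0 mul1r => /esym h0.
  rewrite -[RHS]h0 /h; apply: eq_ip => // i x x0 x1.
  have tt : t / 2 <= 2 * (t / 2) by rewrite ler_peMl ?ler1n// ltW.
  by rewrite /y mulr0 expR0 mul1r add0r windowE// clamp_id// (mulrC 2) divfK ?pnatr_eq0.
have eigP := eigenfunction_of_green hP fn gf.
suff : inner a (fun x => \col_i f i x) = 0 by move=> i0; have := gen _ _ eigP; rewrite i0 eqxx.
have [ut [ux [uxx [[cu _ _ _] _ _ _ lim]]]] := hu.
apply: (@inner_limit0 R a (fun x => \col_i f i x) (fun t i x => u (clamp 0 1 x) t i 0)) => //.
- by move=> i; rewrite (_ : (fun x => _) = f i)//; apply/funext => x; rewrite mxE.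
- move=> t i t0; have cw := continuous_window (i := i) t0 cu.
  rewrite (_ : (fun x => _) = fun x => window u t i x t); first by cts.
  by apply/funext => x; rewrite /window maxxx.
- move=> t t0; rewrite ipC -[RHS](orth t t0); apply: eq_ip => // i x _ _.
  by rewrite mxE.
- have E : (fun t => (\int[lebesgue_measure]_(x in `]0%R, 1%R[) (\sum_(i < 2) (u x t i 0 - a x i 0) ^+ 2)%:E)%E) =
      fun t => (\int[lebesgue_measure]_(x in `]0%R, 1%R[) (\sum_(i < 2) (u (clamp 0 1 x) t i 0 - a x i 0) ^+ 2)%:E)%E; last by rewrite -E.
  apply/funext => t; apply: eq_integral => x; rewrite inE/= in_itv/= => /andP[x0 x1].
  by rewrite clamp_id ?ltW.
Qed.

Lemma eq_interior P Q a u v (T : R) i x t : C1mx P -> C1mx Q -> symmetric_on01 P ->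
  generating P a -> parabolic_solution P a u -> parabolic_solution Q a v ->
  (forall t, 0 < t -> t < T -> u 0 t = v 0 t /\ u 1 t = v 1 t) ->
  0 < x -> x < 1 -> 0 < t -> t < T -> u x t i 0 = v x t i 0.
Proof.
move=> hP hQ sP gen hu hv huv x0 x1 t0 tT.
have [b1 b10 Pb] := coeff_bounded hP; have [b2 b20 Qb] := coeff_bounded hQ.
have Pb' j k y : `|coeff P j k y| <= b1 + b2 by apply: (le_trans (Pb _ _ _)); rewrite lerDl.
have Qb' j k y : `|coeff Q j k y| <= b1 + b2 by apply: (le_trans (Qb _ _ _)); rewrite lerDr.
(* Small enough for [t] to satisfy 2 tau <= t < T - tau, as [traces_determine] requires. *)
pose tau := Num.min t (T - t) / 4.
have tau0 : 0 < tau by rewrite divr_gt0// lt_min t0 subr_gt0.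
have tau1 : 4 * tau <= t by rewrite /tau mulrC divfK ?pnatr_eq0// ge_min lexx.
have tau2 : 4 * tau <= T - t by rewrite /tau mulrC divfK ?pnatr_eq0// ge_min lexx orbT.
move: tau tau0 tau1 tau2 => tau tau0 tau1 tau2.
have [yt [yx [yxx hy]]] := strip_gsol tau0 hu.
have [zt [zx [zxx hz]]] := strip_gsol tau0 hv.
have := @traces_determine R (coeff P) (coeff Q) (b1 + b2) tau T _ _ Pb' Qb' _ tau0 _ _ _ _ _ _ _ _ hy hz _ _ i x t.
have tt : tau <= t by lra.
rewrite (windowE u i (ltW x0) (ltW x1) tt) (windowE v i (ltW x0) (ltW x1) tt); apply=> //.
- by move=> j k; exact: continuous_coeff.
- by move=> j k; exact: continuous_coeff.
- by move=> j k y _ _; exact: coeff_sym.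
- move=> j s ts sT; rewrite !windowE//.
  by have [-> ->] := huv s (lt_le_trans tau0 ts) sT.
- by move=> f fx m _ gf H; exact: (generating_total hP sP gen hu Pb' tau0 gf H).
- by lra.
- by lra.
Qed.

End Assembly.

Theorem theorem1p4 (R : realType) (P Q : R -> 'M[R]_2) (a : R -> 'cV[R]_2)
    (u v : R -> R -> 'cV[R]_2) (T : R)
    (hPC1 : C1mx P) (hQC1 : C1mx Q)
    (hPsym : symmetric_on01 P) (hQsym : symmetric_on01 Q)
    (hPsimple : all_eigenvalues_simple P)
    (hQsimple : all_eigenvalues_simple Q)
    (haP : generating P a) (haQ : generating Q a)
    (hu : parabolic_solution P a u) (hv : parabolic_solution Q a v)
    (hT : 0 < T)
    (huv : forall t : R, 0 < t -> t < T -> u 0 t = v 0 t /\ u 1 t = v 1 t) :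
  forall x : R, x \in `[0, 1] -> P x = Q x.
Proof.
move=> x; rewrite in_itv/= => /andP[x0 x1]; apply/matrixP => i j.
have [b b0 Pb] := coeff_bounded hPC1.
(* The times s + 2 tau with 0 <= s < tau then lie strictly between tau and T. *)
pose tau := T / 4; have tau0 : 0 < tau by rewrite divr_gt0.
have tauT : 4 * tau = T by rewrite /tau mulrC divfK ?pnatr_eq0.
move: tau tau0 tauT => tau tau0 tauT.
have [yt [yx [yxx hy]]] := strip_gsol tau0 hu.
have [zt [zx [zxx hz]]] := strip_gsol tau0 hv.
have [[cy cyt cyx cyxx] Dt Dx y01] := hy; have [_ Dt' Dx' _] := hz.
have yz k z s : 0 < z -> z < 1 -> tau < s -> s < T -> window u tau k z s = window v tau k z s.
  move=> z0 z1 ts sT; rewrite !windowE ?ltW//.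
  exact: (eq_interior k hPC1 hQC1 hPsym haP hu hv huv z0 z1 (lt_trans tau0 ts) sT).
(* On the open rectangle ]0, 1[ x ]tau, T[ the two solutions coincide, hence so do their derivatives
   in t and x; subtracting the equations leaves only the potentials. *)
have key k z s : 0 < z -> z < 1 -> tau < s -> s < T ->
    \sum_l (coeff P k l z - coeff Q k l z) * window u tau l z s = 0.
  move=> z0 z1 ts sT; have ts' : - - tau < s by rewrite opprK.
  have [d1 d2 e1] := Dx k z s z0 z1 ts'; have [d1' d2' e2] := Dx' k z s z0 z1 ts'.
  have Et : yt k z s = zt k z s.
    apply: (Der_uniq (Dt k z s (ltW z0) (ltW z1) ts')).
    apply: (Der_local ts sT _ (Dt' k z s (ltW z0) (ltW z1) ts')) => r r0 r1.
    by rewrite yz.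
  have Ex w : 0 < w -> w < 1 -> yx k w s = zx k w s.
    move=> w0 w1; have [d _ _] := Dx k w s w0 w1 ts'; have [d' _ _] := Dx' k w s w0 w1 ts'.
    apply: (Der_uniq d); apply: (Der_local w0 w1 _ d') => r r0 r1.
    by rewrite yz.
  have Exx : yxx k z s = zxx k z s.
    by apply: (Der_uniq d2); apply: (Der_local z0 z1 _ d2') => r r0 r1; rewrite Ex.
  rewrite (eq_bigr (fun l => coeff P k l z * window u tau l z s - coeff Q k l z * window v tau l z s)); last first.
    by move=> l _; rewrite mulrBl yz.
  by rewrite sumrB; move: e1; rewrite Et Exx e2; lra.
have cP k l : continuous (coeff P k l) := continuous_coeff (i := k) (j := l) hPC1.
have cQ k l : continuous (coeff Q k l) := continuous_coeff (i := k) (j := l) hQC1.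
have cg l : continuous (fun z => coeff P i l z - coeff Q i l z) by cts.
have g0 : ip (fun l z => coeff P i l z - coeff Q i l z) (fun l z => coeff P i l z - coeff Q i l z) = 0.
  apply: (flow_total_interval tau0 _ Pb _ (scaled_gsol b hy) _ tau0 cg).
  - by [].
  - by move=> k l z _ _; exact: coeff_sym.
  - by move=> f fx m _ gf H; exact: (generating_total hPC1 hPsym haP hu Pb tau0 gf H).
  - move=> s s0 st.
    rewrite ipC ipZl//; last by move=> k; cts.
    rewrite ipC [X in _ * X](_ : _ = 0) ?mulr0//.
    rewrite /ip (@eq_Int R 0 1 _ (fun=> 0)) ?Int_cst ?mul0r// => z z0 z1.
    have cs : continuous (fun z => \sum_l (coeff P i l z - coeff Q i l z) * window u tau l z (s + 2 * tau)) by cts.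
    apply: (continuous_interior cs) => // w w0 w1; apply: key => //; lra.
have := ip_eq0 j cg g0 x0 x1.
by rewrite /coeff clamp_id// => /eqP; rewrite subr_eq0 => /eqP.
Qed.
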